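(* Let $M$ be a transitive model of ZFC, let $\mathbf{P}\in M$ be a forcing notion that adds reals, and let $M[G]$ be a generic extension of $M$ by $\mathbf{P}$. Let $A=(\mathbb{Z}^\omega)^M$ and $B=(\mathbb{Z}^\omega)^{M[G]}$ be the Baer-Specker groups of $M$ and $M[G]$. Then in $M[G]$ there is no $K$-filtration of $B$ from $A$, where $K$ is the class of cotorsionfree groups in $M[G]$.
   Context: All groups are abelian. $\mathbb{Z}^\omega$ is the direct product of countably many copies of $\mathbb{Z}$; $A=\mathbb{Z}^\omega\cap M$ is a subgroup of $B$. ''$\mathbf{P}$ adds reals'' means that $M[G]$ contains reals (e.g. functions $\omega\to\mathbb{Z}$) not in $M$. A group $G$ is cotorsion if $\mathrm{Ext}(J,G)=0$ for every torsionfree group $J$, and cotorsionfree if it has no nonzero cotorsion subgroup (equivalently, no subgroup isomorphic to $\mathbb{Q}$, $\mathbb{Z}/p\mathbb{Z}$ or the $p$-adic integers $J_p$, for any prime $p$). For a class $C$ of groups closed under isomorphism and a subgroup $A$ of $B$, a $C$-filtration of $B$ from $A$ is a continuous increasing chain $\langle A_\alpha:\alpha\le\delta\rangle$ ($\delta$ an ordinal) of subgroups of $B$ such that $A_0=A$, $A_\delta=B$, and for all $\alpha<\delta$ the quotient $A_{\alpha+1}/A_\alpha$ is isomorphic to a member of $C$; continuous means $A_\xi=\bigcup_{\zeta<\xi}A_\zeta$ for limit $\xi\le\delta$. *)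

(* Defs.v *)
From Stdlib Require Import Utf8 FunctionalExtensionality PropExtensionality.
From Stdlib Require Import ProofIrrelevance.

Set Implicit Arguments.
Unset Strict Implicit.
Unset Printing Implicit Defensive.

(** * The ambient universe of sets

    Aczel's well-founded trees, quotiented by bisimilarity so that [=] on [set]
    is extensional equality.  A [set] is a bisimilarity class of trees. *)

Inductive tree : Type := node (I : Type) (f : I → tree).

Fixpoint bisim (t u : tree) : Prop :=
  match t, u with
  | node f, node g =>
      (∀ i, ∃ j, bisim (f i) (g j)) ∧ (∀ j, ∃ i, bisim (f i) (g j))
  end.

Definition tmem (t u : tree) : Prop :=
  match u with node g => ∃ j, bisim t (g j) end.

Record set : Type := Set_ { cls : tree → Prop; clsP : ∃ t, cls = bisim t }.

Definition mem (x y : set) : Prop := ∃ t u, cls x t ∧ cls y u ∧ tmem t u.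

Lemma bisim_refl t : bisim t t.
Proof. induction t as [I f IH]; simpl; split; intros i; exists i; apply IH. Qed.

Lemma bisim_sym t u : bisim t u → bisim u t.
Proof.
revert u; induction t as [I f IH]; intros [J g] [H1 H2]; simpl; split.
- intros j; destruct (H2 j) as [i Hi]; exists i; now apply IH.
- intros i; destruct (H1 i) as [j Hj]; exists j; now apply IH.
Qed.

Lemma bisim_trans t u v : bisim t u → bisim u v → bisim t v.
Proof.
revert u v; induction t as [I f IH]; intros [J g] [K h] [H1 H2] [H3 H4].
simpl; split.
- intros i; destruct (H1 i) as [j Hj]; destruct (H3 j) as [k Hk].
  exists k; now apply IH with (g j).
- intros k; destruct (H4 k) as [j Hj]; destruct (H2 j) as [i Hi].
  exists i; now apply IH with (g j).
Qed.

Lemma bisim_cls t u : bisim t u → bisim t = bisim u.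
Proof.
intros H; apply functional_extensionality; intros v.
apply propositional_extensionality; split; intros H'.
- now apply bisim_trans with t; [apply bisim_sym|].
- now apply bisim_trans with u.
Qed.

Lemma set_ext (x y : set) : (∀ z, mem z x ↔ mem z y) → x = y.
Proof.
destruct x as [p [[I f] Hp]], y as [q [[J g] Hq]]; intros H.
assert (key : ∀ (K L : Type) (h : K → tree) (l : L → tree),
  (∀ z : set, (∃ t u, cls z t ∧ bisim (node h) u ∧ tmem t u) →
              (∃ t u, cls z t ∧ bisim (node l) u ∧ tmem t u)) →
  ∀ k, ∃ j, bisim (h k) (l j)).
{ intros K L h l Hsub k.
  destruct (Hsub (Set_ (ex_intro _ (h k) eq_refl)))
    as (t & [L' l'] & Ht & Hu & [j' Hj']).
  - exists (h k), (node h); repeat split; try apply bisim_refl.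
    + intros i; exists i; apply bisim_refl.
    + intros i; exists i; apply bisim_refl.
    + exists k; apply bisim_refl.
  - simpl in Ht; destruct Hu as [_ Hu]; destruct (Hu j') as [j Hj].
    exists j; apply bisim_trans with t; trivial.
    apply bisim_trans with (l' j'); trivial; now apply bisim_sym. }
assert (Hpq : p = q).
{ subst p q; apply bisim_cls; simpl; split.
  - apply key; intros z; apply H.
  - intros j; destruct (key _ _ g f (fun z => proj2 (H z)) j) as [i Hi].
    exists i; now apply bisim_sym. }
revert Hp Hq H; rewrite Hpq; intros Hp Hq _; f_equal; apply proof_irrelevance.
Qed.

(** * The language of set theory

    Everything in this section is a formula in the language {∈, =}, written as
    a predicate over an arbitrary structure [(S, E)]; applying it to the
    structure carried by a class [N] of sets gives its relativization to [N],
    that is, "[N] satisfies the formula". *)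

Section Language.

Variables (S : Type) (E : S → S → Prop).
Local Infix "∈" := E (at level 70).
Local Notation "x ⊆ y" := (∀ z, z ∈ x → z ∈ y) (at level 70).

Definition is_empty (x : S) := ∀ z, ¬ z ∈ x.

Definition is_upair (z a b : S) := ∀ w, w ∈ z ↔ w = a ∨ w = b.

(** [z] is the Kuratowski pair {{a}, {a, b}}. *)
Definition is_opair (z a b : S) :=
  ∃ u v, is_upair u a a ∧ is_upair v a b ∧ is_upair z u v.

Definition is_succ (y x : S) := ∀ w, w ∈ y ↔ w ∈ x ∨ w = x.

Definition is_transitive (x : S) := ∀ y, y ∈ x → y ⊆ x.

Definition is_ordinal (x : S) :=
  is_transitive x ∧ ∀ y, y ∈ x → is_transitive y.

Definition is_limit (x : S) :=
  is_ordinal x ∧ ¬ is_empty x ∧ ∀ y, y ∈ x → ∃ z, z ∈ x ∧ is_succ z y.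

Definition is_omega (w : S) := is_limit w ∧ ∀ n, n ∈ w → ¬ is_limit n.

(** ** The axioms of ZFC *)

(** First-order formulas with de Bruijn indices, needed for the two schemas. *)
Inductive formula : Type :=
  | FMem (i j : nat)
  | FEq (i j : nat)
  | FFalse
  | FImp (φ ψ : formula)
  | FAll (φ : formula).

Definition scons (x : S) (ρ : nat → S) (n : nat) : S :=
  match n with O => x | Datatypes.S m => ρ m end.

Fixpoint sat (ρ : nat → S) (φ : formula) : Prop :=
  match φ with
  | FMem i j => ρ i ∈ ρ j
  | FEq i j => ρ i = ρ j
  | FFalse => False
  | FImp φ ψ => sat ρ φ → sat ρ ψ
  | FAll φ => ∀ x, sat (scons x ρ) φ
  end.

Record ZFC : Prop := {
  zfc_extensionality : ∀ x y, (∀ z, z ∈ x ↔ z ∈ y) → x = y;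
  zfc_foundation :
    ∀ x, ¬ is_empty x → ∃ y, y ∈ x ∧ ∀ z, ¬ (z ∈ x ∧ z ∈ y);
  zfc_pairing : ∀ a b, ∃ z, is_upair z a b;
  zfc_union : ∀ x, ∃ u, ∀ z, z ∈ u ↔ ∃ y, y ∈ x ∧ z ∈ y;
  zfc_powerset : ∀ x, ∃ p, ∀ y, y ∈ p ↔ y ⊆ x;
  zfc_infinity :
    ∃ w, (∃ e, e ∈ w ∧ is_empty e) ∧ ∀ x, x ∈ w → ∃ y, y ∈ w ∧ is_succ y x;
  zfc_separation : ∀ (φ : formula) (ρ : nat → S) (a : S),
    ∃ b, ∀ x, x ∈ b ↔ x ∈ a ∧ sat (scons x ρ) φ;
  zfc_replacement : ∀ (φ : formula) (ρ : nat → S) (a : S),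
    (∀ x, x ∈ a → ∀ y y', sat (scons x (scons y ρ)) φ →
       sat (scons x (scons y' ρ)) φ → y = y') →
    ∃ b, ∀ y, y ∈ b ↔ ∃ x, x ∈ a ∧ sat (scons x (scons y ρ)) φ;
  zfc_choice : ∀ a,
    (∀ x, x ∈ a → ¬ is_empty x) →
    (∀ x, x ∈ a → ∀ y, y ∈ a → x ≠ y → ∀ z, ¬ (z ∈ x ∧ z ∈ y)) →
    ∃ c, ∀ x, x ∈ a → exists! y, y ∈ x ∧ y ∈ c
}.

(** ** Relations and functions as sets of ordered pairs *)

Definition rel (r x y : S) := ∃ p, is_opair p x y ∧ p ∈ r.

Definition is_function_on (f X : S) :=
  (∀ p, p ∈ f → ∃ x, x ∈ X ∧ ∃ y, is_opair p x y) ∧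
  (∀ x, x ∈ X → exists! y, rel f x y).

Definition is_function (f X Y : S) :=
  is_function_on f X ∧ ∀ x y, rel f x y → y ∈ Y.

Definition rel2 (f x y z : S) := ∃ p, is_opair p x y ∧ rel f p z.

Definition is_product (Q X Y : S) :=
  ∀ p, p ∈ Q ↔ ∃ x, x ∈ X ∧ ∃ y, y ∈ Y ∧ is_opair p x y.

Definition is_binop (f X : S) := ∃ Q, is_product Q X X ∧ is_function f Q X.

Definition is_preorder (P le : S) :=
  (∀ p, p ∈ P → rel le p p) ∧
  (∀ p q r, p ∈ P → q ∈ P → r ∈ P → rel le p q → rel le q r → rel le p r).

(** ** Abelian groups *)

Record gstr : Type := Gstr { car : S; gop : S }.

Definition is_zero (G : gstr) (e : S) :=
  e ∈ car G ∧ ∀ x, x ∈ car G → rel2 (gop G) e x x.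

Definition is_abgroup (G : gstr) :=
  is_binop (gop G) (car G) ∧
  (∀ x y z u v w, rel2 (gop G) x y u → rel2 (gop G) u z w →
     rel2 (gop G) y z v → rel2 (gop G) x v w) ∧
  (∀ x y z, rel2 (gop G) x y z → rel2 (gop G) y x z) ∧
  (∃ e, is_zero G e ∧ ∀ x, x ∈ car G → ∃ y, y ∈ car G ∧ rel2 (gop G) x y e).

Definition is_hom (f : S) (G H : gstr) :=
  is_function f (car G) (car H) ∧
  ∀ x y z x' y' z', rel2 (gop G) x y z →
    rel f x x' → rel f y y' → rel f z z' → rel2 (gop H) x' y' z'.

Definition is_injective (f : S) := ∀ x x' y, rel f x y → rel f x' y → x = x'.

Definition is_surjective (f Y : S) := ∀ y, y ∈ Y → ∃ x, rel f x y.

Definition isomorphic (G H : gstr) :=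
  ∃ f, is_hom f G H ∧ is_injective f ∧ is_surjective f (car H).

(** A subgroup carries the restriction of the ambient operation. *)
Definition is_subgroup (H G : gstr) :=
  is_abgroup H ∧ car H ⊆ car G ∧
  ∀ x y z, rel2 (gop H) x y z → rel2 (gop G) x y z.

Definition is_coset (G H : gstr) (x c : S) :=
  ∀ y, y ∈ c ↔ ∃ h, h ∈ car H ∧ rel2 (gop G) x h y.

(** [Q] is the quotient G/H on the set of cosets of [H]. *)
Definition is_quotient (G H Q : gstr) :=
  (∀ c, c ∈ car Q ↔ ∃ x, x ∈ car G ∧ is_coset G H x c) ∧
  is_binop (gop Q) (car Q) ∧
  (∀ x y z a b c, rel2 (gop G) x y z →
     is_coset G H x a → is_coset G H y b → is_coset G H z c →
     rel2 (gop Q) a b c).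

(** [m] is the function n ↦ n·x from ω to [G]. *)
Definition is_multiples (G : gstr) (w x m : S) :=
  is_omega w ∧ is_function m w (car G) ∧
  (∀ n e, is_empty n → is_zero G e → rel m n e) ∧
  (∀ n, n ∈ w → ∀ n' y z, is_succ n' n → rel m n y → rel2 (gop G) y x z →
     rel m n' z).

Definition torsionfree (G : gstr) :=
  ∀ w x m, x ∈ car G → is_multiples G w x m →
    ∀ n, n ∈ w → ∀ e, ¬ is_empty n → is_zero G e → rel m n e → x = e.

Definition is_short_exact (i p : S) (G X J : gstr) :=
  is_hom i G X ∧ is_hom p X J ∧
  is_injective i ∧ is_surjective p (car J) ∧
  (∀ x, (∃ g, rel i g x) ↔ (∃ e, is_zero J e ∧ rel p x e)).

(** Ext(J, G) is the group of extensions of [G] by [J] up to equivalence, whose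
    zero is the class of the split extensions. *)
Definition Ext_zero (J G : gstr) :=
  ∀ (X : gstr) (i p : S), is_abgroup X → is_short_exact i p G X J →
    ∃ s, is_hom s J X ∧ ∀ j x, rel s j x → rel p x j.

Definition cotorsion (G : gstr) :=
  is_abgroup G ∧ ∀ J, is_abgroup J → torsionfree J → Ext_zero J G.

Definition cotorsionfree (G : gstr) :=
  is_abgroup G ∧
  ∀ H, is_subgroup H G → cotorsion H → ∀ x, x ∈ car H → is_zero H x.

(** ** The Baer-Specker group *)

Definition is_nat_add (w a : S) :=
  is_omega w ∧ is_binop a w ∧
  (∀ m, m ∈ w → ∀ e, is_empty e → rel2 a m e m) ∧
  (∀ m n k n' k', rel2 a m n k → is_succ n' n → is_succ k' k →
     rel2 a m n' k').

(** The integer m - n is coded by the pair (m, n) of natural numbers at least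
    one of which is 0; (m, n) + (m', n') = (k, l) iff m + m' + l = n + n' + k. *)
Definition is_integers (Z : gstr) :=
  ∃ w a, is_nat_add w a ∧
  (∀ z, z ∈ car Z ↔
     ∃ m, m ∈ w ∧ ∃ n, n ∈ w ∧ is_opair z m n ∧ (is_empty m ∨ is_empty n)) ∧
  is_binop (gop Z) (car Z) ∧
  (∀ x y z m n m' n' k l, rel2 (gop Z) x y z →
     is_opair x m n → is_opair y m' n' → is_opair z k l →
     ∃ s t u, rel2 a m m' s ∧ rel2 a s l u ∧ rel2 a n n' t ∧ rel2 a t k u).

Definition is_integer_sequence (x : S) :=
  ∃ w Z, is_omega w ∧ is_integers Z ∧ is_function x w (car Z).

(** [B] is the set of all functions ω → ℤ under pointwise addition. *)
Definition is_baer_specker (B : gstr) :=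
  (∀ x, x ∈ car B ↔ is_integer_sequence x) ∧
  is_binop (gop B) (car B) ∧
  (∀ Z, is_integers Z → ∀ x y z n i j k, rel2 (gop B) x y z →
     rel x n i → rel y n j → rel z n k → rel2 (gop Z) i j k).

(** ** Filtrations *)

(** [F] is a function with domain δ + 1, and [F] maps α to A_α. *)
Definition is_filtration (K : gstr → Prop) (A : S) (B : gstr) (δ F : S) :=
  is_ordinal δ ∧
  (∃ δ', is_succ δ' δ ∧ is_function_on F δ') ∧
  (∀ α X, rel F α X → ∃ H, car H = X ∧ is_subgroup H B) ∧
  (∀ α β X Y, rel F α X → rel F β Y → α ∈ β → X ⊆ Y) ∧
  (∀ ξ X, is_limit ξ → rel F ξ X →
     ∀ x, x ∈ X ↔ ∃ ζ, ζ ∈ ξ ∧ ∃ Y, rel F ζ Y ∧ x ∈ Y) ∧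
  (∀ α, is_empty α → rel F α A) ∧
  rel F δ (car B) ∧
  (∀ α α' X X', α ∈ δ → is_succ α' α → rel F α X → rel F α' X' →
     ∃ H H' Q C, car H = X ∧ is_subgroup H B ∧
       car H' = X' ∧ is_subgroup H' B ∧
       is_quotient H' H Q ∧ isomorphic Q C ∧ K C).

End Language.

Arguments gstr S : clear implicits.

(** * Transitive models and generic extensions *)

(** The structure (M, ∈) carried by a class [M] of sets. *)
Definition elt (M : set → Prop) : Type := {x : set | M x}.
Definition elt_set (M : set → Prop) (x : elt M) : set := proj1_sig x.
Definition emem (M : set → Prop) (x y : elt M) : Prop :=
  mem (elt_set x) (elt_set y).

Definition transitive_model_ZFC (M : set → Prop) : Prop :=
  (∀ x y, M y → mem x y → M x) ∧ ZFC (@emem M).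

Definition forcing_notion (M : set → Prop) (P le : elt M) : Prop :=
  ¬ is_empty (@emem M) P ∧ is_preorder (@emem M) P le.

Definition dense (P le D : set) : Prop :=
  (∀ p, mem p D → mem p P) ∧
  (∀ p, mem p P → ∃ q, mem q D ∧ rel mem le q p).

Definition filter (P le G : set) : Prop :=
  (∀ p, mem p G → mem p P) ∧
  (∃ p, mem p G) ∧
  (∀ p q, mem p G → mem q P → rel mem le p q → mem q G) ∧
  (∀ p q, mem p G → mem q G →
     ∃ r, mem r G ∧ rel mem le r p ∧ rel mem le r q).

Definition generic (M : set → Prop) (P le G : set) : Prop :=
  filter P le G ∧
  ∀ D, M D → dense P le D → ∃ p, mem p D ∧ mem p G.

Inductive is_name (P : set) (τ : set) : Prop :=
  Is_name : (∀ w, mem w τ →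
               ∃ σ p, is_opair mem w σ p ∧ is_name P σ ∧ mem p P) →
            is_name P τ.

(** [is_val G τ y] says that [y] is the value
    τ_G = {σ_G : (σ, p) ∈ τ for some p ∈ G}; the recursion on τ is rendered as
    an inductive predicate, with one premise for each inclusion. *)
Inductive is_val (G : set) (τ y : set) : Prop :=
  Is_val :
    (∀ z, mem z y →
       ∃ σ p w, is_opair mem w σ p ∧ mem w τ ∧ mem p G ∧ is_val G σ z) →
    (∀ σ p w, is_opair mem w σ p → mem w τ → mem p G →
       ∃ z, mem z y ∧ is_val G σ z) →
    is_val G τ y.

(** M[G] *)
Definition generic_extension (M : set → Prop) (P G : set) (y : set) : Prop :=
  ∃ τ, M τ ∧ is_name P τ ∧ is_val G τ y.

(** N contains reals that are not in M. *)
Definition adds_reals (M N : set → Prop) : Prop :=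
  ∃ r : elt N, is_integer_sequence (@emem N) r ∧ ¬ M (elt_set r).

(* Main.v *)
(** Let [r] be a real of [M[G]] not in [M] and put [x i = i! * r i].  Then [x] is
    not in [A], but for every [n > 0] it differs from [n y], for some [y] in [B],
    by a finitely supported sequence, which lies in [A]; so [B/A] has a nonzero
    element divisible by every [n].  Along a filtration with cotorsionfree steps
    all the quotients [B/A_α] are torsionfree, because [ℤ/p] is cotorsion; hence
    at the first stage [A_(β+1)] containing [x] the class of [x] in
    [A_(β+1)/A_β] is still divisible by every [n], and the elements with this
    property form a nonzero divisible subgroup of a torsionfree group, which is
    cotorsion.

    That bounded and divisible groups are cotorsion needs separation and choice
    in [M[G]].  Separation comes from the forcing theorem.  For choice, a
    well-ordering in [M] of the names occurring in a name [τ] gives a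
    well-ordering of the value of [τ]; along it a complement of a subgroup is
    built by Gaussian elimination, with no recursion inside [M[G]]. *)

Require Import Defs.
From Stdlib Require Import Utf8 FunctionalExtensionality.
From Stdlib Require Import ProofIrrelevance Classical ClassicalEpsilon.
From Stdlib Require Import Arith Lia Wellfounded ZArith Ring.
From Stdlib Require Znumtheory.

Set Implicit Arguments.
Unset Strict Implicit.
Unset Printing Implicit Defensive.

(** * Definability with parameters *)

(** What is transferred to [M[G]] is a fragment: extensionality, pairing, union, power set,
    separation, external well-foundedness, and a well-ordering of every set. Without replacement,
    iteration and closures are described there by quantifying over all sets closed under the
    relevant clauses; transitive supersets and the well-ordering theorem are proved in [M], where
    replacement holds. Separation accepts only definable predicates, whereas calculations want
    functions. Most notions therefore occur twice, as a relation in the language and as a function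
    obtained by description, with a lemma joining the two. Cotorsion groups are tested against every
    extension of [G] by a torsionfree [J] inside [M[G]]. A splitting of such an extension [X] is the
    inverse of the projection on a complement of [G]. The case of [G] killed by a prime p and the
    case of [G] torsionfree divisible share one elimination, carried out modulo pX and modulo 0.
    Factorials serve twice: n divides i! once i ≥ n, and multiplication by i! can be undone inside
    [M], so that [x] in [M] forces [r] into [M]. *)

Definition up_ren (f : nat → nat) (n : nat) : nat :=
  match n with O => O | S m => S (f m) end.

Fixpoint ren (f : nat → nat) (φ : formula) : formula :=
  match φ with
  | FMem i j => FMem (f i) (f j)
  | FEq i j => FEq (f i) (f j)
  | FFalse => FFalse
  | FImp φ ψ => FImp (ren f φ) (ren f ψ)
  | FAll φ => FAll (ren (up_ren f) φ)
  end.

Section Definability.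

Variables (S : Type) (E : S → S → Prop).

Definition eval (e : nat → S) (t : nat + S) : S :=
  match t with inl i => e i | inr c => c end.

Definition Tm (t : (nat → S) → S) : Prop := ∃ u, ∀ e, t e = eval e u.

(** Each variable of the formula is read either as a coordinate of the
    environment or as a parameter. *)
Definition Def (Q : (nat → S) → Prop) : Prop :=
  ∃ φ (t : nat → nat + S), ∀ e, Q e ↔ sat E (λ n, eval e (t n)) φ.

Lemma sat_ren φ : ∀ f ρ, sat E ρ (ren f φ) ↔ sat E (λ n, ρ (f n)) φ.
Proof.
induction φ as [i j|i j| |φ IH1 ψ IH2|φ IH]; intros f ρ; simpl; try tauto.
- rewrite IH1, IH2; tauto.
- assert (H : ∀ x, (λ n, scons x ρ (up_ren f n)) = scons x (λ n, ρ (f n))).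
  { intros x; apply functional_extensionality; intros [|n]; reflexivity. }
  split; intros H' x; specialize (H' x); [apply IH in H'|apply IH];
    rewrite H in *; exact H'.
Qed.

Lemma Tm_var i : Tm (λ e, e i).
Proof. now exists (inl i). Qed.

Lemma Tm_cst c : Tm (λ _, c).
Proof. now exists (inr c). Qed.

Lemma Def_ext Q Q' : (∀ e, Q e ↔ Q' e) → Def Q → Def Q'.
Proof. intros H (φ & t & Ht); exists φ, t; intros e; rewrite <- H; apply Ht. Qed.

Lemma Def_mem t u : Tm t → Tm u → Def (λ e, E (t e) (u e)).
Proof.
intros [a Ha] [b Hb].
exists (FMem 0 1), (λ n, match n with O => a | _ => b end).
intros e; simpl; rewrite Ha, Hb; tauto.
Qed.

Lemma Def_eq t u : Tm t → Tm u → Def (λ e, t e = u e).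
Proof.
intros [a Ha] [b Hb].
exists (FEq 0 1), (λ n, match n with O => a | _ => b end).
intros e; simpl; rewrite Ha, Hb; tauto.
Qed.

(** Even and odd indices keep the variables of the two formulas apart, so each retains its own
    reading as coordinates or parameters. *)
Lemma Def_imp Q R : Def Q → Def R → Def (λ e, Q e → R e).
Proof.
intros (φ & t & Ht) (ψ & u & Hu).
exists (FImp (ren (λ n, 2 * n) φ) (ren (λ n, 1 + 2 * n) ψ)),
  (λ n, if Nat.even n then t (Nat.div2 n) else u (Nat.div2 n)).
intros e; cbn [sat]; rewrite !sat_ren, Ht, Hu.
assert (H1 : (λ n, eval e (if Nat.even (2 * n) then t (Nat.div2 (2 * n))
                           else u (Nat.div2 (2 * n)))) = λ n, eval e (t n)).
{ apply functional_extensionality; intros n.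
  rewrite Nat.even_mul, Nat.div2_double; reflexivity. }
assert (H2 : (λ n, eval e (if Nat.even (1 + 2 * n) then t (Nat.div2 (1 + 2 * n))
                else u (Nat.div2 (1 + 2 * n)))) = λ n, eval e (u n)).
{ apply functional_extensionality; intros n.
  rewrite Nat.even_add, Nat.even_mul; simpl (Nat.even 1).
  change (1 + 2 * n) with (Datatypes.S (2 * n)).
  rewrite Nat.div2_succ_double; reflexivity. }
rewrite H1, H2; tauto.
Qed.

Lemma Def_all (Q : (nat → S) → S → Prop) :
  Def (λ e, Q (λ n, e (Datatypes.S n)) (e O)) → Def (λ e, ∀ x, Q e x).
Proof.
intros (φ & t & Ht).
(* Every variable read as coordinate 0 becomes the bound index 0; the others are shifted past the
   new binder. *)
set (f := λ n, match t n with inl O => O | _ => Datatypes.S n end).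
exists (FAll (ren f φ)),
  (λ n, match t n with inl (Datatypes.S i) => inl i | u => u end).
intros e; cbn [sat]; set (v := λ n, match t n with _ => _ end).
assert (Hf : ∀ x, (λ n, scons x v (f n)) =
                  λ n, eval (scons x e) (t n)).
{ intros x; apply functional_extensionality; intros n.
  unfold f, v; destruct (t n) as [[|i]|c] eqn:Et; simpl; rewrite ?Et; reflexivity. }
split; intros H x; specialize (H x).
- rewrite sat_ren, Hf; exact (proj1 (Ht (scons x e)) H).
- rewrite sat_ren, Hf in H; exact (proj2 (Ht (scons x e)) H).
Qed.

(** Classically a proposition independent of the environment is true or false, so it may be any
    statement of the metatheory. *)
Lemma Def_const (P : Prop) : Def (λ _, P).
Proof.
destruct (classic P) as [HP|HP].
- exists (FImp FFalse FFalse), inl; simpl; tauto.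
- exists FFalse, inl; simpl; tauto.
Qed.

Lemma Def_not Q : Def Q → Def (λ e, ¬ Q e).
Proof. intros H; apply (Def_imp H (Def_const False)). Qed.

Lemma Def_and Q R : Def Q → Def R → Def (λ e, Q e ∧ R e).
Proof.
intros H1 H2; apply Def_ext with (λ e, ¬ (Q e → ¬ R e)); [intros e; tauto|].
apply Def_not, Def_imp, Def_not; assumption.
Qed.

Lemma Def_or Q R : Def Q → Def R → Def (λ e, Q e ∨ R e).
Proof.
intros H1 H2; apply Def_ext with (λ e, ¬ Q e → R e); [intros e; tauto|].
apply Def_imp; [apply Def_not|]; assumption.
Qed.

Lemma Def_iff Q R : Def Q → Def R → Def (λ e, Q e ↔ R e).
Proof. intros H1 H2; apply Def_and; apply Def_imp; assumption. Qed.

Lemma Def_ex (Q : (nat → S) → S → Prop) :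
  Def (λ e, Q (λ n, e (Datatypes.S n)) (e O)) → Def (λ e, ∃ x, Q e x).
Proof.
intros H; apply Def_ext with (λ e, ¬ ∀ x, ¬ Q e x).
- intros e; split; [|firstorder].
  intros H'; apply NNPP; contradict H'; intros x Hx; apply H'; now exists x.
- apply Def_not, (Def_all (Q := λ e x, ¬ Q e x)), Def_not, H.
Qed.

Lemma Def_subst Q (u : (nat → S) → nat → S) :
  (∀ n, Tm (λ e, u e n)) → Def Q → Def (λ e, Q (u e)).
Proof.
intros Hu (φ & t & Ht).
set (v := λ n, proj1_sig (constructive_indefinite_description _ (Hu n))).
exists φ, (λ n, match t n with inl i => v i | inr c => inr c end).
intros e; rewrite Ht; replace (λ n, eval (u e) (t n)) with
  (λ n, eval e (match t n with inl i => v i | inr c => inr c end)); [tauto|].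
apply functional_extensionality; intros n; destruct (t n) as [i|c]; simpl; trivial.
unfold v; destruct (constructive_indefinite_description _ (Hu i)) as [w Hw].
simpl; now rewrite Hw.
Qed.

Lemma Def1 (R : S → Prop) t : Def (λ e, R (e 0)) → Tm t → Def (λ e, R (t e)).
Proof.
intros H Ht; apply (@Def_subst _ (λ e _, t e)) in H; trivial.
Qed.

Lemma Def2 (R : S → S → Prop) t u :
  Def (λ e, R (e 0) (e 1)) → Tm t → Tm u → Def (λ e, R (t e) (u e)).
Proof.
intros H Ht Hu.
apply (@Def_subst _ (λ e n, match n with 0 => t e | _ => u e end)) in H; trivial.
intros [|n]; trivial.
Qed.

Lemma Def3 (R : S → S → S → Prop) t u v :
  Def (λ e, R (e 0) (e 1) (e 2)) → Tm t → Tm u → Tm v →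
  Def (λ e, R (t e) (u e) (v e)).
Proof.
intros H Ht Hu Hv.
apply (@Def_subst _ (λ e n, match n with 0 => t e | 1 => u e | _ => v e end)) in H;
  trivial.
intros [|[|n]]; trivial.
Qed.

End Definability.

Create HintDb defs.

Ltac tm := first [exact (Tm_var _ _) | exact (Tm_cst _)].

Ltac def_unfold := progress unfold is_empty, is_upair, is_opair, is_succ,
  is_transitive, is_ordinal, is_limit, is_omega, rel, rel2, is_function_on,
  is_function, is_zero, unique, is_binop, is_product.

(** Descends through the connectives. Registered predicates are recognized before anything is
    unfolded; [Def1] to [Def3] move such a fact from the first coordinates to arbitrary terms. *)
Ltac def := cbv beta;
  first
  [ refine (Def_const _ _)
  | refine (Def_mem _ _ _); tm
  | refine (Def_eq _ _ _); tm
  | refine (Def_and _ _); def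
  | refine (Def_or _ _); def
  | refine (Def_iff _ _); def
  | refine (Def_not _); def
  | refine (Def_imp _ _); def
  | refine (Def_all _); def
  | refine (Def_ex _); def
  | solve [eauto 2 with defs]
  | refine (Def1 _ _); [solve [eauto 2 with defs]|tm]
  | refine (Def2 _ _ _); [solve [eauto 2 with defs]|tm..]
  | refine (Def3 _ _ _ _); [solve [eauto 2 with defs]|tm..]
  | def_unfold; def ].

(** * Zermelo set theory in a well-founded structure *)

(** The fragment common to [M] and [M[G]]. Well-foundedness is that of the metatheory, so induction
    applies to predicates that are not definable. *)
Record Zermelo (S : Type) (E : S → S → Prop) : Prop := {
  z_inh : inhabited S;
  z_ext : ∀ x y, (∀ z, E z x ↔ E z y) → x = y;
  z_wf : well_founded E;
  z_pair : ∀ a b, ∃ z, is_upair E z a b;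
  z_union : ∀ x, ∃ u, ∀ z, E z u ↔ ∃ y, E y x ∧ E z y;
  z_power : ∀ x, ∃ p, ∀ y, E y p ↔ ∀ z, E z y → E z x;
  z_sep : ∀ φ ρ a, ∃ b, ∀ x, E x b ↔ E x a ∧ sat E (scons x ρ) φ
}.

Section SetTheory.

Context {S : Type} {E : S → S → Prop} (ZF : Zermelo E).
Local Infix "∈" := E (at level 70).

(** A choice operator of the metatheory turns descriptions into total functions. Terms built with it
    are invisible to [def], which is why definability proofs go back to relations. *)
Definition the (P : S → Prop) : S := epsilon (z_inh ZF) P.

Lemma theP (P : S → Prop) : (∃ x, P x) → P (the P).
Proof. apply epsilon_spec. Qed.

(** As [Q] looks only at coordinate 0, all coordinates read by the formula can be identified with
    the element being tested; the parameters form the assignment. *)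
Lemma sep (Q : S → Prop) a :
  Def E (λ e, Q (e 0)) → ∃ b, ∀ x, x ∈ b ↔ x ∈ a ∧ Q x.
Proof.
intros (φ & t & Ht).
destruct (z_sep ZF (ren (λ n, match t n with inl _ => 0 | inr _ => Datatypes.S n end) φ)
  (λ n, match t n with inl _ => a | inr c => c end) a) as [b Hb].
exists b; intros x; rewrite Hb, sat_ren.
specialize (Ht (λ _, x)); simpl in Ht; rewrite Ht.
match goal with |- _ ∧ sat E ?r φ ↔ _ ∧ sat E ?s φ => replace r with s; [tauto|] end.
apply functional_extensionality; intros n; destruct (t n) eqn:Et; simpl; trivial.
now rewrite Et.
Qed.

Lemma mem_irrefl x : ¬ x ∈ x.
Proof. intros H; induction (z_wf ZF x) as [x _ IH]; eauto. Qed.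

Lemma mem_asym x y : x ∈ y → ¬ y ∈ x.
Proof.
revert y; induction (z_wf ZF x) as [x _ IH]; intros y H H'; exact (IH y H' x H' H).
Qed.

Lemma upair_eq z a b c d :
  is_upair E z a b → is_upair E z c d → (a = c ∧ b = d) ∨ (a = d ∧ b = c).
Proof.
intros H1 H2.
assert (Ha : a = c ∨ a = d) by (apply H2, H1; auto).
assert (Hb : b = c ∨ b = d) by (apply H2, H1; auto).
assert (Hc : c = a ∨ c = b) by (apply H1, H2; auto).
assert (Hd : d = a ∨ d = b) by (apply H1, H2; auto).
intuition congruence.
Qed.

Lemma upair_fun z z' a b : is_upair E z a b → is_upair E z' a b → z = z'.
Proof. intros H1 H2; apply (z_ext ZF); intros w; now rewrite (H1 w), (H2 w). Qed.

Lemma opair_fun z z' a b : is_opair E z a b → is_opair E z' a b → z = z'.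
Proof.
intros (u & v & H1 & H2 & H3) (u' & v' & H1' & H2' & H3').
rewrite (upair_fun H1' H1), (upair_fun H2' H2) in *.
apply (upair_fun H3 H3').
Qed.

Lemma opair_inj z a b c d : is_opair E z a b → is_opair E z c d → a = c ∧ b = d.
Proof.
intros (u & v & H1 & H2 & H3) (u' & v' & H1' & H2' & H3').
destruct (upair_eq H3 H3') as [[e1 e2]|[e1 e2]]; subst.
- destruct (upair_eq H1 H1'), (upair_eq H2 H2'); intuition congruence.
- destruct (upair_eq H1 H2'), (upair_eq H2 H1'); intuition congruence.
Qed.

Lemma opair_ex a b : ∃ z, is_opair E z a b.
Proof.
destruct (z_pair ZF a a) as [u Hu], (z_pair ZF a b) as [v Hv], (z_pair ZF u v) as [z Hz].
now exists z, u, v.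
Qed.

Definition pr (a b : S) : S := the (λ z, is_opair E z a b).

Lemma opairE z a b : is_opair E z a b ↔ z = pr a b.
Proof.
assert (H : is_opair E (pr a b) a b) by exact (theP (opair_ex a b)).
split; [intros H'; exact (opair_fun H' H)|intros ->; exact H].
Qed.

Lemma pr_is a b : is_opair E (pr a b) a b.
Proof. now apply opairE. Qed.

Lemma pr_inj a b c d : pr a b = pr c d → a = c ∧ b = d.
Proof.
intros H; apply (@opair_inj (pr a b)); apply opairE; [reflexivity|exact H].
Qed.

Lemma pr_eq a b c d : pr a b = pr c d ↔ a = c ∧ b = d.
Proof. split; [apply pr_inj|intros [-> ->]; reflexivity]. Qed.

Lemma relE r x y : rel E r x y ↔ pr x y ∈ r.
Proof.
split.
- intros (p & Hp & H); apply opairE in Hp; now subst.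
- intros H; exists (pr x y); split; [now apply opairE|exact H].
Qed.

Lemma rel2E f x y z : rel2 E f x y z ↔ pr (pr x y) z ∈ f.
Proof.
split.
- intros (p & Hp & H); apply opairE in Hp; apply relE in H; now subst.
- intros H; exists (pr x y); split; [now apply opairE|now apply relE].
Qed.

Lemma union2_ex x y : ∃ u, ∀ z, z ∈ u ↔ z ∈ x ∨ z ∈ y.
Proof.
destruct (z_pair ZF x y) as [p Hp], (z_union ZF p) as [u Hu].
exists u; intros z; rewrite Hu; split.
- intros (w & Hw & H); apply Hp in Hw; destruct Hw as [-> | ->]; auto.
- intros [H|H]; [exists x|exists y]; (split; [apply Hp; auto|exact H]).
Qed.

Lemma adjoin_ex x a : ∃ u, ∀ z, z ∈ u ↔ z ∈ x ∨ z = a.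
Proof.
destruct (z_pair ZF a a) as [p Hp], (union2_ex x p) as [u Hu].
exists u; intros z; rewrite Hu, (Hp z); tauto.
Qed.

Lemma product_ex X Y : ∃ Q, ∀ p, p ∈ Q ↔ ∃ x y, x ∈ X ∧ y ∈ Y ∧ p = pr x y.
Proof.
destruct (union2_ex X Y) as [U HU], (z_power ZF U) as [P HP], (z_power ZF P) as [PP HPP].
destruct (@sep (λ p, ∃ x, x ∈ X ∧ ∃ y, y ∈ Y ∧ is_opair E p x y) PP) as [Q HQ]; [def|].
exists Q; intros p; rewrite HQ; split.
- intros (_ & x & Hx & y & Hy & H); exists x, y; now rewrite <- opairE.
- intros (x & y & Hx & Hy & H); apply opairE in H; split.
  + destruct H as (u & v & Hu & Hv & Hp).
    apply HPP; intros w Hw; apply HP; intros z Hz; apply HU.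
    apply Hp in Hw; destruct Hw as [-> | ->]; [apply Hu in Hz|apply Hv in Hz];
      destruct Hz as [-> | ->]; auto.
  + exists x; split; trivial; exists y; auto.
Qed.

Lemma is_productE Q X Y :
  (∀ p, p ∈ Q ↔ ∃ x y, x ∈ X ∧ y ∈ Y ∧ p = pr x y) → is_product E Q X Y.
Proof.
intros H p; rewrite H; split.
- intros (x & y & Hx & Hy & ->); exists x; split; trivial; exists y; split; trivial.
  now apply opairE.
- intros (x & Hx & y & Hy & Hp); exists x, y; rewrite <- opairE; auto.
Qed.

Lemma sep2 (Q : S → S → Prop) X Y : Def E (λ e, Q (e 0) (e 1)) →
  ∃ r, (∀ x y, pr x y ∈ r ↔ x ∈ X ∧ y ∈ Y ∧ Q x y) ∧
       ∀ p, p ∈ r → ∃ x y, x ∈ X ∧ y ∈ Y ∧ p = pr x y.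
Proof.
intros HQ; destruct (product_ex X Y) as [P HP].
destruct (@sep (λ p, ∃ x y, is_opair E p x y ∧ Q x y) P) as [r Hr].
{ refine (Def_ex _); refine (Def_ex _); refine (Def_and _ _); [def|].
  refine (Def2 HQ _ _); tm. }
exists r; split.
- intros x y; rewrite Hr, HP; split.
  + intros [(x1 & y1 & Hx & Hy & H) (x2 & y2 & H2 & HQ2)].
    apply opairE in H2; apply pr_inj in H, H2.
    destruct H as [-> ->], H2 as [-> ->]; auto.
  + intros (Hx & Hy & H); split; [now exists x, y|].
    exists x, y; split; trivial; now apply opairE.
- intros p Hp; apply Hr, proj1, HP in Hp; exact Hp.
Qed.

(** * Ordinals, natural numbers and iteration *)

Lemma ord_trans x y z : is_ordinal E x → z ∈ y → y ∈ x → z ∈ x.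
Proof. intros [H _] Hz Hy; exact (H y Hy z Hz). Qed.

Lemma ord_mem x y : is_ordinal E x → y ∈ x → is_ordinal E y.
Proof.
intros [H1 H2] Hy; split; [now apply H2|].
intros z Hz; apply H2; exact (H1 y Hy z Hz).
Qed.

(** Nested induction: an element of one ordinal lying outside the other is compared with that other
    ordinal by an induction hypothesis, and transitivity concludes. *)
Lemma ord_trichotomy x y :
  is_ordinal E x → is_ordinal E y → x ∈ y ∨ x = y ∨ y ∈ x.
Proof.
revert y; induction (z_wf ZF x) as [x _ IHx]; intros y Hx.
induction (z_wf ZF y) as [y _ IHy]; intros Hy.
destruct (classic (∀ z, z ∈ x → z ∈ y)) as [Hxy|Hxy].
- destruct (classic (∀ z, z ∈ y → z ∈ x)) as [Hyx|Hyx].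
  + right; left; apply (z_ext ZF); split; auto.
  + apply not_all_ex_not in Hyx; destruct Hyx as [z Hz].
    apply imply_to_and in Hz; destruct Hz as [Hz Hz'].
    destruct (IHy z Hz (ord_mem Hy Hz)) as [H|[H|H]]; [left|left|contradiction].
    * exact (ord_trans Hy H Hz).
    * now subst.
- apply not_all_ex_not in Hxy; destruct Hxy as [z Hz].
  apply imply_to_and in Hz; destruct Hz as [Hz Hz'].
  destruct (IHx z Hz y (ord_mem Hx Hz) Hy) as [H|[H|H]]; [contradiction|subst; auto|].
  right; right; exact (ord_trans Hx H Hz).
Qed.

Lemma succ_ord x y : is_ordinal E x → is_succ E y x → is_ordinal E y.
Proof.
intros [H1 H2] Hy; split.
- intros z Hz w Hw; apply Hy in Hz; apply Hy; left; destruct Hz as [Hz|Hz]; [|now subst].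
  exact (H1 z Hz w Hw).
- intros z Hz; apply Hy in Hz; destruct Hz as [Hz|Hz]; subst; auto.
Qed.

Lemma empty_fun x y : is_empty E x → is_empty E y → x = y.
Proof. intros Hx Hy; apply (z_ext ZF); intros z; split; intros H; firstorder. Qed.

Lemma succ_fun x y y' : is_succ E y x → is_succ E y' x → y = y'.
Proof. intros H H'; apply (z_ext ZF); intros z; now rewrite (H z), (H' z). Qed.

Lemma empty_ex : ∃ x, is_empty E x.
Proof.
destruct (z_inh ZF) as [o]; destruct (@sep (λ _, False) o) as [x Hx]; [def|].
exists x; intros z Hz; now apply Hx in Hz.
Qed.

Fixpoint num (n : nat) : S :=
  match n with
  | O => the (is_empty E)
  | Datatypes.S m => the (λ y, is_succ E y (num m))
  end.

Lemma num0 : is_empty E (num 0).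
Proof. exact (theP empty_ex). Qed.

Lemma numS n : is_succ E (num (Datatypes.S n)) (num n).
Proof. exact (theP (adjoin_ex (num n) (num n))). Qed.

Lemma num_mem n x : x ∈ num n ↔ ∃ m, m < n ∧ x = num m.
Proof.
revert x; induction n as [|n IH]; intros x.
- split; [intros H; destruct (num0 H)|intros (m & Hm & _); lia].
- rewrite (numS n x), IH; split.
  + intros [(m & Hm & ->)| ->]; [exists m|exists n]; split; trivial; lia.
  + intros (m & Hm & ->); destruct (Nat.eq_dec m n) as [->|]; auto.
    left; exists m; split; trivial; lia.
Qed.

Lemma num_inj m n : num m = num n → m = n.
Proof.
intros H; destruct (Nat.lt_trichotomy m n) as [Hl|[Hl|Hl]]; trivial; exfalso.
- apply (@mem_irrefl (num n)); rewrite <- H at 1; apply num_mem; eauto.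
- apply (@mem_irrefl (num m)); rewrite H at 1; apply num_mem; eauto.
Qed.

Lemma num_lt m n : num m ∈ num n ↔ m < n.
Proof.
rewrite num_mem; split; [|eauto].
intros (k & Hk & H); apply num_inj in H; now subst.
Qed.

Lemma num_empty n : is_empty E (num n) ↔ n = 0.
Proof.
split; [|intros ->; exact num0].
intros H; destruct n; trivial; destruct (H (num n)); apply num_lt; lia.
Qed.

Lemma num_succ x n : is_succ E x (num n) ↔ x = num (Datatypes.S n).
Proof.
split; [intros H; exact (succ_fun H (numS n))|intros ->; apply numS].
Qed.

(** External well-foundedness excludes nonstandard numbers: a minimal element of [w] that is no
    numeral would be a limit. Induction on [nat] then replaces induction inside the structure. *)
Lemma omegaE w : is_omega E w → ∀ x, x ∈ w ↔ ∃ n, x = num n.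
Proof.
intros [(Hw & Hne & Hs) Hlim].
assert (H0 : num 0 ∈ w).
{ apply NNPP; intros H0; apply Hne; intros x.
  induction (z_wf ZF x) as [x _ IH]; intros Hx.
  apply H0; replace (num 0) with x; trivial; apply empty_fun; [|exact num0].
  intros y Hy; exact (IH y Hy (ord_trans Hw Hy Hx)). }
assert (Hnum : ∀ n, num n ∈ w).
{ induction n as [|n IH]; trivial.
  destruct (Hs _ IH) as (z & Hz & Hz'); apply num_succ in Hz'; now subst. }
intros x; split; [|intros [n ->]; apply Hnum].
induction (z_wf ZF x) as [x _ IH]; intros Hx.
destruct (classic (is_empty E x)) as [He|He].
{ exists 0; exact (empty_fun He num0). }
apply NNPP; intros Hx'; apply (Hlim x Hx).
split; [exact (ord_mem Hw Hx)|split; trivial].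
intros y Hy; destruct (IH y Hy (ord_trans Hw Hy Hx)) as [n ->].
exists (num (Datatypes.S n)); split; [|apply numS].
destruct (ord_trichotomy (ord_mem Hw (Hnum (Datatypes.S n))) (ord_mem Hw Hx))
  as [H|[H|H]]; trivial.
- destruct Hx'; exists (Datatypes.S n); now symmetry.
- apply num_mem in H; destruct H as (m & _ & H); destruct Hx'; now exists m.
Qed.

(** Quantifying over all sets closed under the recursion clauses below [n] makes
    iteration definable without coding finite sequences. *)
Definition iterated (I : S → Prop) (St : S → S → S → Prop) (n v : S) : Prop :=
  ∀ m, (∀ z u, is_empty E z → I u → rel E m z u) →
    (∀ k k' y y', k ∈ n → is_succ E k' k → rel E m k y → St k y y' → rel E m k' y') →
    rel E m n v.

(** This finite set is the test set at which the quantifier in [iterated] is instantiated; [t] is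
    external, but finitely many of its values can be collected by adjunction. *)
Lemma finite_graph (t : nat → S) n :
  ∃ m, ∀ p, p ∈ m ↔ ∃ k, k ≤ n ∧ p = pr (num k) (t k).
Proof.
induction n as [|n [m Hm]].
- destruct (z_pair ZF (pr (num 0) (t 0)) (pr (num 0) (t 0))) as [m Hm].
  exists m; intros p; rewrite (Hm p); split.
  + intros H; exists 0; split; [lia|tauto].
  + intros (k & Hk & ->); replace k with 0 by lia; auto.
- destruct (adjoin_ex m (pr (num (Datatypes.S n)) (t (Datatypes.S n)))) as [m' Hm'].
  exists m'; intros p; rewrite Hm', Hm; split.
  + intros [(k & Hk & ->)| ->]; eexists; (split; [|reflexivity]); lia.
  + intros (k & Hk & ->); destruct (Nat.eq_dec k (Datatypes.S n)) as [->|]; auto.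
    left; exists k; split; trivial; lia.
Qed.

(** The clauses ask for closure only at [k ∈ n], so the graph of [t] up to [n] qualifies and pins
    the value down; conversely every qualifying [m] contains that graph. *)
Lemma iteratedE (I : S → Prop) St (t : nat → S) n v :
  (∀ u, I u ↔ u = t 0) →
  (∀ k y, St (num k) (t k) y ↔ y = t (Datatypes.S k)) →
  iterated I St (num n) v ↔ v = t n.
Proof.
intros H0 HS; split.
- intros H; destruct (finite_graph t n) as [m Hm].
  specialize (H m); rewrite !relE in H; setoid_rewrite relE in H.
  setoid_rewrite Hm in H; destruct H as (k & Hk & Hk').
  + intros z u Hz Hu; exists 0; split; [lia|].
    apply H0 in Hu; subst u; now rewrite (empty_fun Hz num0).
  + intros k k' y y' Hk Hk' (j & Hj & Hj') Hy.
    apply pr_inj in Hj'; destruct Hj' as [-> ->]; apply HS in Hy; subst y'.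
    apply num_succ in Hk'; subst k'; apply num_lt in Hk.
    exists (Datatypes.S j); split; trivial.
  + apply pr_inj in Hk'; destruct Hk' as [Hk' ->]; apply num_inj in Hk'; now subst.
- intros -> m Hm Hs.
  enough (Hk : ∀ k, k ≤ n → rel E m (num k) (t k)) by now apply Hk.
  induction k as [|k IH]; intros Hk.
  + apply Hm; [exact num0|now apply H0].
  + apply (Hs (num k) _ (t k)); [apply num_lt; lia|apply numS|apply IH; lia|now apply HS].
Qed.

Lemma is_function_val f X Y x :
  is_function E f X Y → x ∈ X → ∃ y, y ∈ Y ∧ ∀ z, rel E f x z ↔ z = y.
Proof.
intros [[_ H1] H2] Hx; destruct (H1 x Hx) as (y & Hy & Hu).
exists y; split; [now apply H2 with x|].
intros z; split; [intros Hz; symmetry; now apply Hu|intros ->; exact Hy].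
Qed.

Lemma is_function_dom f X Y x y : is_function E f X Y → rel E f x y → x ∈ X ∧ y ∈ Y.
Proof.
intros [[H1 _] H2] H; split; [|now apply H2 with x].
apply relE in H; destruct (H1 _ H) as (x' & Hx' & y' & H').
apply opairE, pr_inj in H'; destruct H' as [-> _]; exact Hx'.
Qed.

End SetTheory.

Arguments iterated {S} E I St n v.

(** * Abelian groups *)

Section SquareZero.

Variables (T : Type) (z : T) (a : T → T → T) (n : T → T).

Definition zmul (k : Z) (x : T) : T :=
  match k with
  | Z0 => z
  | Zpos p => Nat.iter (Pos.to_nat p) (a x) z
  | Zneg p => n (Nat.iter (Pos.to_nat p) (a x) z)
  end.

Hypothesis aA : ∀ x y w, a (a x y) w = a x (a y w).
Hypothesis aC : ∀ x y, a x y = a y x.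
Hypothesis a0 : ∀ x, a x z = x.
Hypothesis aN : ∀ x, a x (n x) = z.

Lemma opp_unique x y : a x y = z → y = n x.
Proof.
intros H; rewrite <- (a0 y), <- (aN x), <- aA, (aC y x), H, aC; apply a0.
Qed.

Lemma opp_add x y : n (a x y) = a (n x) (n y).
Proof.
symmetry; apply opp_unique.
now rewrite aA, <- (aA y), (aC y), (aA (n x)), aN, a0, aN.
Qed.

Lemma add_interchange x y w v : a (a x y) (a w v) = a (a x w) (a y v).
Proof. now rewrite !aA, <- (aA y w), (aC y w), (aA w y). Qed.

Lemma zmul_succ k x : zmul (Z.succ k) x = a x (zmul k x).
Proof.
destruct k as [|p|p].
- reflexivity.
- rewrite <- Pos2Z.inj_succ; simpl; now rewrite Pos2Nat.inj_succ.
- destruct (Pos.succ_pred_or p) as [->|Hp].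
  + simpl; now rewrite a0, aN.
  + rewrite <- Hp; generalize (Pos.pred p); intros q.
    replace (Z.succ (Z.neg (Pos.succ q))) with (Z.neg q) by lia.
    cbn [zmul]; rewrite Pos2Nat.inj_succ; simpl.
    now rewrite opp_add, <- aA, aN, (aC z), a0.
Qed.

Lemma zmul_pred k x : zmul (Z.pred k) x = a (n x) (zmul k x).
Proof.
rewrite <- (Z.succ_pred k) at 2; rewrite zmul_succ, <- aA, (aC (n x)), aN.
now rewrite (aC z), a0.
Qed.

Lemma zmul_add k l x : zmul (k + l) x = a (zmul k x) (zmul l x).
Proof.
revert k; apply Z.peano_ind.
- simpl; now rewrite (aC z), a0.
- intros k IH; now rewrite Z.add_succ_l, !zmul_succ, IH, aA.
- intros k IH; now rewrite Z.add_pred_l, !zmul_pred, IH, aA.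
Qed.

Lemma zmul_0 k : zmul k z = z.
Proof.
revert k; apply Z.peano_ind; trivial; intros k IH.
- now rewrite zmul_succ, IH, a0.
- rewrite zmul_pred, IH, a0; symmetry; apply opp_unique; apply a0.
Qed.

Lemma zmul_distr k x y : zmul k (a x y) = a (zmul k x) (zmul k y).
Proof.
revert k; apply Z.peano_ind; [symmetry; apply a0|..]; intros k IH.
- rewrite !zmul_succ, IH; apply add_interchange.
- rewrite !zmul_pred, IH, opp_add; apply add_interchange.
Qed.

Lemma zmul_opp k x : zmul (- k) x = n (zmul k x).
Proof.
apply opp_unique; rewrite <- zmul_add; now replace (k + - k)%Z with 0%Z by lia.
Qed.

Lemma zmul_mul k l x : zmul (k * l) x = zmul k (zmul l x).
Proof.
revert k; apply Z.peano_ind; trivial; intros k IH.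
- now rewrite Z.mul_succ_l, Z.add_comm, zmul_add, zmul_succ, IH.
- replace (Z.pred k * l)%Z with (- l + k * l)%Z by lia.
  now rewrite zmul_add, zmul_pred, IH, zmul_opp.
Qed.

Lemma zmul_1 x : zmul 1 x = x.
Proof. apply a0. Qed.

(** The square-zero extension ℤ ⋉ T is a commutative ring containing T; through
    it, [ring] decides identities in the ℤ-module T. *)
Definition sq_add (u v : Z * T) := ((fst u + fst v)%Z, a (snd u) (snd v)).
Definition sq_mul (u v : Z * T) :=
  ((fst u * fst v)%Z, a (zmul (fst u) (snd v)) (zmul (fst v) (snd u))).
Definition sq_opp (u : Z * T) := ((- fst u)%Z, n (snd u)).

Lemma sq_ring : ring_theory (0%Z, z) (1%Z, z) sq_add sq_mul
  (λ u v, sq_add u (sq_opp v)) sq_opp eq.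
Proof.
constructor; unfold sq_add, sq_mul, sq_opp; intros; cbn [fst snd];
  repeat match goal with u : (Z * T)%type |- _ => destruct u end;
  cbn [fst snd]; try reflexivity; f_equal; try lia.
- now rewrite aC, a0.
- apply aC.
- now rewrite aA.
- now rewrite zmul_1, zmul_0, a0.
- apply aC.
- rewrite !zmul_distr, <- !zmul_mul, aA.
  repeat first [reflexivity | lia | f_equal].
- rewrite zmul_add, zmul_distr; apply add_interchange.
- now rewrite aN.
Qed.

End SquareZero.

Section Groups.

Context {S : Type} {E : S → S → Prop} (ZF : Zermelo E).
Local Infix "∈" := E (at level 70).

Definition gadd (G : gstr S) (x y : S) : S := the ZF (λ z, rel2 E (gop G) x y z).
Definition gzero (G : gstr S) : S := the ZF (is_zero E G).
Definition gopp (G : gstr S) (x : S) : S :=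
  the ZF (λ y, y ∈ car G ∧ rel2 E (gop G) x y (gzero G)).
Definition gmul (G : gstr S) : Z → S → S :=
  zmul (gzero G) (gadd G) (gopp G).

Section OneGroup.

Context {G : gstr S} (HG : is_abgroup E G).

Lemma gop_dom x y z : rel2 E (gop G) x y z → x ∈ car G ∧ y ∈ car G ∧ z ∈ car G.
Proof.
destruct HG as [(Q & HQ & Hf) _]; intros (p & Hp & H).
destruct (is_function_dom ZF Hf H) as [H1 H2].
apply HQ in H1; destruct H1 as (x' & Hx & y' & Hy & Hp').
destruct (opair_inj Hp Hp'); subst; auto.
Qed.

Lemma gop_ex x y : x ∈ car G → y ∈ car G →
  ∃ z, z ∈ car G ∧ ∀ w, rel2 E (gop G) x y w ↔ w = z.
Proof.
destruct HG as [(Q & HQ & Hf) _]; intros Hx Hy.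
destruct (is_function_val Hf (x := pr ZF x y)) as (z & Hz & Hz').
- apply HQ; exists x; split; trivial; exists y; split; trivial; apply pr_is.
- exists z; split; trivial; intros w; rewrite <- Hz', rel2E, relE; reflexivity.
Qed.

Lemma gopE x y z : x ∈ car G → y ∈ car G → rel2 E (gop G) x y z ↔ z = gadd G x y.
Proof.
intros Hx Hy; destruct (gop_ex Hx Hy) as (w & _ & Hw).
assert (H : rel2 E (gop G) x y (gadd G x y)).
{ apply (@theP _ _ ZF (λ z, rel2 E (gop G) x y z)); exists w; now apply Hw. }
rewrite Hw in *; split; congruence.
Qed.

Lemma gadd_car x y : x ∈ car G → y ∈ car G → gadd G x y ∈ car G.
Proof.
intros Hx Hy; apply (@gop_dom x y (gadd G x y)); now apply gopE.
Qed.

Lemma gaddA x y z : x ∈ car G → y ∈ car G → z ∈ car G →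
  gadd G (gadd G x y) z = gadd G x (gadd G y z).
Proof.
destruct HG as (_ & HA & _); intros Hx Hy Hz.
apply gopE; auto using gadd_car.
apply HA with y z (gadd G x y); apply gopE; auto using gadd_car.
Qed.

Lemma gaddC x y : x ∈ car G → y ∈ car G → gadd G x y = gadd G y x.
Proof.
destruct HG as (_ & _ & HC & _); intros Hx Hy; apply gopE; trivial.
now apply HC, gopE.
Qed.

Lemma gzero_is : is_zero E G (gzero G).
Proof.
apply (@theP _ _ ZF (is_zero E G)).
destruct HG as (_ & _ & _ & e & He & _); now exists e.
Qed.

Lemma gzero_car : gzero G ∈ car G.
Proof. apply gzero_is. Qed.

Lemma gadd0 x : x ∈ car G → gadd G x (gzero G) = x.
Proof.
intros Hx; rewrite gaddC; trivial; [|exact gzero_car].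
symmetry; apply gopE; trivial; apply gzero_is; trivial.
Qed.

Lemma is_zeroE e : is_zero E G e ↔ e = gzero G.
Proof.
split; [|intros ->; exact gzero_is].
intros [He H]; rewrite <- (gadd0 He); symmetry.
apply gopE; trivial; [exact gzero_car|]; apply H, gzero_car.
Qed.

Lemma gopp_spec x : x ∈ car G → gopp G x ∈ car G ∧ gadd G x (gopp G x) = gzero G.
Proof.
intros Hx; assert (H : gopp G x ∈ car G ∧ rel2 E (gop G) x (gopp G x) (gzero G)).
{ apply (@theP _ _ ZF (λ y, y ∈ car G ∧ rel2 E (gop G) x y (gzero G))).
  destruct HG as (_ & _ & _ & e & He & H); apply is_zeroE in He; subst e; auto. }
destruct H as [H1 H2]; split; trivial; now apply gopE in H2.
Qed.

Lemma gopp_car x : x ∈ car G → gopp G x ∈ car G.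
Proof. apply gopp_spec. Qed.

Lemma gaddN x : x ∈ car G → gadd G x (gopp G x) = gzero G.
Proof. apply gopp_spec. Qed.

(** On this type the group laws hold without membership hypotheses, as a ring structure for the
    [ring] tactic requires. *)
Definition gel : Type := {x : S | x ∈ car G}.
Definition gel0 : gel := exist _ _ gzero_car.
Definition gel_add (x y : gel) : gel :=
  exist _ _ (gadd_car (proj2_sig x) (proj2_sig y)).
Definition gel_opp (x : gel) : gel := exist _ _ (gopp_car (proj2_sig x)).

Lemma gel_eq (x y : gel) : proj1_sig x = proj1_sig y → x = y.
Proof.
destruct x as [x p], y as [y q]; simpl; intros <-; f_equal; apply proof_irrelevance.
Qed.

Lemma gel_ring : ring_theory (0%Z, gel0) (1%Z, gel0) (sq_add gel_add)
  (sq_mul gel0 gel_add gel_opp)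
  (λ u v, sq_add gel_add u (sq_opp gel_opp v)) (sq_opp gel_opp) eq.
Proof.
apply sq_ring; intros; apply gel_eq; simpl.
- apply gaddA; apply proj2_sig.
- apply gaddC; apply proj2_sig.
- apply gadd0; apply proj2_sig.
- apply gaddN; apply proj2_sig.
Qed.

Lemma zmul_gel k (x : gel) :
  proj1_sig (zmul gel0 gel_add gel_opp k x) = gmul G k (proj1_sig x).
Proof.
assert (H : ∀ n, proj1_sig (Nat.iter n (gel_add x) gel0) =
                 Nat.iter n (gadd G (proj1_sig x)) (gzero G)).
{ induction n as [|n IH]; simpl; congruence. }
destruct k; simpl; rewrite ?H; reflexivity.
Qed.

Lemma gmul_car k x : x ∈ car G → gmul G k x ∈ car G.
Proof.
intros Hx; pose proof (zmul_gel k (exist _ x Hx)) as H; simpl in H.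
rewrite <- H; apply proj2_sig.
Qed.

(** The embedding into the square-zero ideal. The default value outside the carrier never matters:
    [grp] proves membership before every rewriting. *)
Definition sq_in (x : S) : Z * gel :=
  match excluded_middle_informative (x ∈ car G) with
  | left p => (0%Z, exist _ x p)
  | right _ => (0%Z, gel0)
  end.

Lemma sq_inE x (p : x ∈ car G) : sq_in x = (0%Z, exist _ x p).
Proof.
unfold sq_in; destruct (excluded_middle_informative (x ∈ car G)); [|contradiction].
do 2 f_equal; apply proof_irrelevance.
Qed.

Lemma sq_in_inj x y : x ∈ car G → y ∈ car G → sq_in x = sq_in y → x = y.
Proof. intros p q; rewrite (sq_inE p), (sq_inE q); congruence. Qed.

Lemma sq_in_add x y : x ∈ car G → y ∈ car G →
  sq_in (gadd G x y) = sq_add gel_add (sq_in x) (sq_in y).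
Proof.
intros p q; rewrite (sq_inE p), (sq_inE q), (sq_inE (gadd_car p q)).
unfold sq_add; simpl; f_equal; now apply gel_eq.
Qed.

Lemma sq_in_zero : sq_in (gzero G) = (0%Z, gel0).
Proof. apply sq_inE. Qed.

Lemma sq_in_opp x : x ∈ car G → sq_in (gopp G x) = sq_opp gel_opp (sq_in x).
Proof.
intros p; rewrite (sq_inE p), (sq_inE (gopp_car p)).
unfold sq_opp; simpl; f_equal; now apply gel_eq.
Qed.

Lemma sq_in_mul k x : x ∈ car G →
  sq_in (gmul G k x) = sq_mul gel0 gel_add gel_opp (k, gel0) (sq_in x).
Proof.
intros p; rewrite (sq_inE p), (sq_inE (gmul_car k p)).
unfold sq_mul; simpl; f_equal; [lia|]; apply gel_eq.
change (gmul G k x = gadd G (proj1_sig (zmul gel0 gel_add gel_opp k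
  (exist (λ y, y ∈ car G) x p))) (gzero G)).
rewrite zmul_gel; simpl; rewrite gadd0; trivial; now apply gmul_car.
Qed.

Lemma sq_cst_add k l : (k + l, gel0)%Z = sq_add gel_add (k, gel0) (l, gel0).
Proof.
unfold sq_add; simpl; f_equal; apply gel_eq; symmetry; apply gadd0, gzero_car.
Qed.

Lemma sq_cst_opp k : (- k, gel0)%Z = sq_opp gel_opp (k, gel0).
Proof.
unfold sq_opp; simpl; f_equal; apply gel_eq; simpl.
transitivity (gadd G (gzero G) (gopp G (gzero G))); [symmetry; apply gaddN, gzero_car|].
rewrite gaddC, gadd0; auto using gzero_car, gopp_car.
Qed.

Lemma sq_cst_mul k l :
  (k * l, gel0)%Z = sq_mul gel0 gel_add gel_opp (k, gel0) (l, gel0).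
Proof.
unfold sq_mul; cbn [fst snd]; f_equal; apply gel_eq; cbn [gel_add proj1_sig].
rewrite !zmul_gel; cbn [gel0 proj1_sig].
assert (H : ∀ k, gmul G k (gzero G) = gzero G); [|rewrite !H; symmetry; apply gadd0, gzero_car].
intros m; change (gzero G) with (proj1_sig gel0); rewrite <- zmul_gel.
f_equal; apply zmul_0; intros; apply gel_eq; simpl.
- apply gaddA; apply proj2_sig.
- apply gaddC; apply proj2_sig.
- apply gadd0; apply proj2_sig.
- apply gaddN; apply proj2_sig.
Qed.

End OneGroup.

End Groups.

Ltac gcar ZF HG :=
  solve [repeat first [assumption | apply (gzero_car ZF HG) | apply (gadd_car ZF HG)
    | apply (gopp_car ZF HG) | apply (gmul_car ZF HG)]].

(** Moves an identity of [G] into ℤ ⋉ G, where a scalar [k] becomes the ring element [(k, 0)], and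
    lets [ring] decide it there. *)
Ltac grp ZF HG :=
  apply (@sq_in_inj _ _ ZF _ HG); [gcar ZF HG|gcar ZF HG|];
  repeat first
    [ rewrite (sq_in_add ZF HG) by gcar ZF HG
    | rewrite (sq_in_opp ZF HG) by gcar ZF HG
    | rewrite (sq_in_mul ZF HG) by gcar ZF HG
    | rewrite (sq_in_zero ZF HG) | rewrite (sq_cst_add ZF HG)
    | rewrite (sq_cst_mul ZF HG) | rewrite (sq_cst_opp ZF HG) ];
  ring.

Section Multiples.

Context {S : Type} {E : S → S → Prop} (ZF : Zermelo E).
Local Infix "∈" := E (at level 70).

(** The definable form of multiplication by a natural number, for use in separation; [gmul] is its
    computational form. *)
Definition mulr (G : gstr S) (n x v : S) : Prop :=
  iterated E (is_zero E G) (λ _ y y', rel2 E (gop G) y x y') n v.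

Lemma mulrE G n x v : is_abgroup E G → x ∈ car G →
  mulr G (num ZF n) x v ↔ v = gmul ZF G (Z.of_nat n) x.
Proof.
intros HG Hx; apply (iteratedE (ZF := ZF) (t := λ n, gmul ZF G (Z.of_nat n) x)).
- intros u; now rewrite (is_zeroE ZF HG).
- intros k y; rewrite (gopE ZF HG); trivial; [|now apply gmul_car].
  rewrite Nat2Z.inj_succ, (gaddC ZF HG); [|now apply gmul_car|trivial].
  enough (H : gmul ZF G (Z.succ (Z.of_nat k)) x =
              gadd ZF G x (gmul ZF G (Z.of_nat k) x)) by now rewrite H.
  unfold gmul; destruct (Z.of_nat k) eqn:Ek; try lia; [reflexivity|].
  rewrite <- Pos2Z.inj_succ; simpl; now rewrite Pos2Nat.inj_succ.
Qed.

End Multiples.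

Arguments mulr {S} E G n x v.

(** * Complements *)

(** External well-foundedness allows induction along [R] for undefinable predicates, and it makes
    [R] irreflexive. *)
Definition well_orders S (E : S → S → Prop) (R X : S) : Prop :=
  (∀ x y, E x X → E y X → rel E R x y ∨ x = y ∨ rel E R y x) ∧
  (∀ x y z, rel E R x y → rel E R y z → rel E R x z) ∧
  well_founded (rel E R).

Definition orderable S (E : S → S → Prop) : Prop := ∀ X, ∃ R, well_orders E R X.

Ltac def_unfold ::= progress unfold is_empty, is_upair, is_opair, is_succ,
  is_transitive, is_ordinal, is_limit, is_omega, rel, rel2, is_function_on,
  is_function, is_zero, unique, is_binop, is_product, mulr, iterated.

Section Complement.

Context {S : Type} {E : S → S → Prop} (ZF : Zermelo E).
Local Infix "∈" := E (at level 70).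

Variables (X : gstr S) (HX : is_abgroup E X).
Local Notation add := (gadd ZF X).
Local Notation opp := (gopp ZF X).
Local Notation zero := (gzero ZF X).
Local Notation "n • x" := (gmul ZF X n x) (at level 40).
Local Notation "! n" := (Z.of_nat n) (at level 5).

Add Ring sq : (gel_ring ZF HX).

Definition subgrp (T : S) : Prop :=
  (∀ x, x ∈ T → x ∈ car X) ∧ zero ∈ T ∧
  (∀ x y, x ∈ T → y ∈ T → add x y ∈ T) ∧ (∀ x, x ∈ T → opp x ∈ T).

Lemma subgrp_mul T k x : subgrp T → x ∈ T → k • x ∈ T.
Proof.
intros (H1 & H2 & H3 & H4) Hx.
assert (H : ∀ n, Nat.iter n (add x) zero ∈ T) by (induction n; simpl; auto).
destruct k; simpl; auto.
Qed.

(** A number outside [NN] acts as zero modulo [K0] ([hdich] below), and one in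
    [NN] is invertible on [G0], so modulo [K0] everything behaves like linear
    algebra over a field. *)
Variables (W NN G0 K0 R : S).

(** These play the part of linear subspaces of X/K0: subgroups closed under division by the numbers
    that count as invertible. *)
Definition closed (T : S) : Prop :=
  subgrp T ∧ (∀ x, x ∈ K0 → x ∈ T) ∧
  ∀ n y, num ZF n ∈ NN → y ∈ car X → !n • y ∈ T → y ∈ T.

Hypothesis hW : is_omega E W.
Hypothesis hNN : ∀ n, n ∈ NN → ∃ k, n = num ZF k.
Hypothesis hNN1 : num ZF 1 ∈ NN.
Hypothesis hNNmul : ∀ m n, num ZF m ∈ NN → num ZF n ∈ NN → num ZF (m * n) ∈ NN.
Hypothesis hG0 : subgrp G0.
Hypothesis hK0 : subgrp K0.
Hypothesis hdiv : ∀ n g, num ZF n ∈ NN → g ∈ G0 → ∃ h, h ∈ G0 ∧ !n • h = g.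
Hypothesis htors : ∀ n g, num ZF n ∈ NN → g ∈ G0 → !n • g = zero → g = zero.
Hypothesis hdisj : ∀ g, g ∈ G0 → g ∈ K0 → g = zero.
Hypothesis hdich : ∀ n, num ZF n ∈ NN ∨ ∀ x, x ∈ car X → !n • x ∈ K0.
Hypothesis hR : well_orders E R (car X).

Lemma Def_closed : Def E (λ e, closed (e 0)).
Proof.
(* Zero, sums, opposites and multiples are rephrased through the graph of the operation; opposites
   appear as solutions of x + y = 0. *)
apply Def_ext with (λ e,
  (∀ x, x ∈ e 0 → x ∈ car X) ∧ (∀ z, is_zero E X z → z ∈ e 0) ∧
  (∀ x y z, x ∈ e 0 → y ∈ e 0 → rel2 E (gop X) x y z → z ∈ e 0) ∧
  (∀ x y z, x ∈ e 0 → y ∈ car X → is_zero E X z → rel2 E (gop X) x y z → y ∈ e 0) ∧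
  (∀ x, x ∈ K0 → x ∈ e 0) ∧
  (∀ n y v, n ∈ NN → y ∈ car X → mulr E X n y v → v ∈ e 0 → y ∈ e 0)); [|def].
intros e; unfold closed, subgrp; generalize (e 0); clear e; intros T; split.
- intros (H1 & H2 & H3 & H4 & H5 & H6); repeat split; trivial.
  + apply H2, gzero_is, HX.
  + intros x y Hx Hy; apply (H3 x y); trivial; apply (gopE ZF HX); auto.
  + intros x Hx; apply (H4 x _ zero); trivial; [|apply gzero_is, HX|].
    * apply gopp_car; auto.
    * apply (gopE ZF HX); auto; [apply gopp_car; auto|].
      symmetry; apply gaddN; auto.
  + intros n y Hn Hy; apply (H6 (num ZF n)); trivial; now apply mulrE.
- intros ((H1 & H2 & H3 & H4) & H5 & H6); split; [|split; [|split; [|split; [|split]]]];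
    trivial.
  + intros z Hz; apply (is_zeroE ZF HX) in Hz; now subst.
  + intros x y z Hx Hy H; apply (gopE ZF HX) in H; auto; subst; auto.
  + intros x y z Hx Hy Hz H; apply (is_zeroE ZF HX) in Hz; subst z.
    apply H1 in Hx as Hx'; apply (gopE ZF HX) in H; trivial.
    replace y with (opp x); [auto|].
    transitivity (add (opp x) (add x y)); [|grp ZF HX].
    rewrite <- H; grp ZF HX.
  + intros n y v Hn Hy H; destruct (hNN Hn) as [k ->].
    apply mulrE in H; trivial; subst; now apply H6.
Qed.

Hint Resolve Def_closed : defs.

Lemma closed_mul T k x : closed T → x ∈ T → k • x ∈ T.
Proof. intros [H _]; now apply subgrp_mul. Qed.

Lemma closed_add T x y : closed T → x ∈ T → y ∈ T → add x y ∈ T.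
Proof. intros [(_ & _ & H & _) _]; apply H. Qed.

Lemma closed_opp T x : closed T → x ∈ T → opp x ∈ T.
Proof. intros [(_ & _ & _ & H) _]; apply H. Qed.

(** The hull is an intersection of closed sets, which is definable without building it up in
    stages. *)
Definition in_closure (P : S → Prop) (x : S) : Prop :=
  x ∈ car X ∧ ∀ T, closed T → (∀ y, P y → y ∈ T) → x ∈ T.

Lemma closed_of (Q : S → Prop) : Def E (λ e, Q (e 0)) →
  (∀ x, Q x → x ∈ car X) → (∀ x, x ∈ K0 → Q x) →
  (∀ x y, Q x → Q y → Q (add x y)) → (∀ x, Q x → Q (opp x)) →
  (∀ n y, num ZF n ∈ NN → y ∈ car X → Q (!n • y) → Q y) →
  ∃ T, closed T ∧ ∀ x, x ∈ T ↔ Q x.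
Proof.
intros HQ H1 H2 H3 H4 H5; destruct (sep ZF (car X) HQ) as [T HT].
assert (HT' : ∀ x, x ∈ T ↔ Q x) by (intros x; rewrite HT; split; [tauto|auto]).
exists T; split; trivial; unfold closed, subgrp; setoid_rewrite HT'.
repeat split; trivial; apply H2, hK0.
Qed.

Lemma closure_closed P :
  (∀ x, x ∈ K0 → in_closure P x) ∧
  (∀ x y, in_closure P x → in_closure P y → in_closure P (add x y)) ∧
  (∀ x, in_closure P x → in_closure P (opp x)) ∧
  (∀ n y, num ZF n ∈ NN → y ∈ car X → in_closure P (!n • y) → in_closure P y).
Proof.
split; [|split; [|split]].
- intros x Hx; split; [now apply (proj1 hK0)|].
  intros T (_ & HT & _) _; now apply HT.
- intros x y [Hx Hx'] [Hy Hy']; split; [now apply gadd_car|].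
  intros T HT HP; apply closed_add; auto.
- intros x [Hx Hx']; split; [now apply gopp_car|].
  intros T HT HP; apply closed_opp; auto.
- intros n y Hn Hy [_ H]; split; trivial.
  intros T HT HP; pose proof HT as (_ & _ & HT'); eauto.
Qed.

Lemma closure_ex P : Def E (λ e, P (e 0)) →
  ∃ T, closed T ∧ ∀ x, x ∈ T ↔ in_closure P x.
Proof.
intros HP; destruct (closure_closed P) as (H1 & H2 & H3 & H4).
apply closed_of; trivial; [unfold in_closure; def|intros x [Hx _]; exact Hx].
Qed.

(** Divisibility of [G0] gives closure under division: if n y = g + k and g = n h, then n (y - h) =
    k, so y - h lies in [K]. *)
Lemma sum_closed K : closed K →
  ∃ T, closed T ∧ ∀ x, x ∈ T ↔ ∃ g k, g ∈ G0 ∧ k ∈ K ∧ x = add g k.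
Proof.
intros HK; pose proof HK as ((K1 & K2 & K3 & K4) & K5 & K6).
pose proof hG0 as (G1 & G2 & G3 & G4).
apply closed_of.
- apply Def_ext with (λ e, ∃ g k, g ∈ G0 ∧ k ∈ K ∧ rel2 E (gop X) g k (e 0)); [|def].
  intros e; split; intros (g & k & Hg & Hk & H); exists g, k; repeat split; trivial;
    apply (gopE ZF HX); auto.
- intros x (g & k & Hg & Hk & ->); apply gadd_car; auto.
- intros x Hx; exists zero, x; repeat split; auto; apply K5, K1 in Hx; grp ZF HX.
- intros x y (g & k & Hg & Hk & ->) (g' & k' & Hg' & Hk' & ->).
  exists (add g g'), (add k k'); repeat split; auto.
  apply G1 in Hg, Hg'; apply K1 in Hk, Hk'; grp ZF HX.
- intros x (g & k & Hg & Hk & ->); exists (opp g), (opp k); repeat split; auto.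
  apply G1 in Hg; apply K1 in Hk; grp ZF HX.
- intros n y Hn Hy (g & k & Hg & Hk & H).
  destruct (hdiv Hn Hg) as (h & Hh & <-); apply G1 in Hh as Hh'.
  apply K1 in Hk as Hk'.
  exists h, (add y (opp h)); repeat split; trivial; [|grp ZF HX].
  apply (K6 n); trivial; [apply gadd_car; trivial; now apply gopp_car|].
  replace (!n • add y (opp h)) with k; trivial.
  transitivity (add (add (!n • h) k) (opp (!n • h))); [grp ZF HX|].
  rewrite <- H; grp ZF HX.
Qed.

(** The set used consists of the x with n x in ℤe + K for some n in [NN]. The coefficient of [e] is
    written as a difference b - a of natural numbers because [mulr] handles only those. *)
Lemma adjoin_closed K e : subgrp K → (∀ x, x ∈ K0 → x ∈ K) → e ∈ car X →
  ∃ T, closed T ∧ (∀ x, x ∈ K → x ∈ T) ∧ e ∈ T ∧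
    ∀ x, x ∈ T → ∃ n a b k, num ZF n ∈ NN ∧ k ∈ K ∧
      add (!n • x) (!a • e) = add (!b • e) k.
Proof.
intros HK HK0 He; pose proof HK as (K1 & K2 & K3 & K4).
pose proof (omegaE ZF hW) as hW'.
destruct (@closed_of (λ x, x ∈ car X ∧ ∃ n a b k, num ZF n ∈ NN ∧ k ∈ K ∧
      add (!n • x) (!a • e) = add (!b • e) k)) as (T & HT & HTx).
- apply Def_ext with (λ ρ, ρ 0 ∈ car X ∧ ∃ n a b k u v w y, n ∈ NN ∧ a ∈ W ∧ b ∈ W ∧ k ∈ K ∧
    mulr E X n (ρ 0) u ∧ mulr E X a e v ∧ mulr E X b e w ∧
    rel2 E (gop X) u v y ∧ rel2 E (gop X) w k y); [|def].
  intros ρ; generalize (ρ 0); clear ρ; intros x; split.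
  + intros (Hx & n & a & b & k & u & v & w & y & Hn & Ha & Hb & Hk & Hu & Hv & Hw & H1 & H2).
    split; trivial; apply hW' in Ha, Hb; destruct (hNN Hn) as [n' ->].
    destruct Ha as [a' ->], Hb as [b' ->].
    apply mulrE in Hu, Hv, Hw; trivial; subst; exists n', a', b', k; repeat split; trivial.
    apply (gopE ZF HX) in H1, H2; auto; [congruence|now apply gmul_car..].
  + intros (Hx & n & a & b & k & Hn & Hk & H); split; trivial.
    exists (num ZF n), (num ZF a), (num ZF b), k, (!n • x), (!a • e), (!b • e), (add (!b • e) k).
    rewrite !hW', !mulrE by trivial; repeat split; eauto.
    * rewrite <- H; apply (gopE ZF HX); trivial; now apply gmul_car.
    * apply (gopE ZF HX); auto; now apply gmul_car.
- tauto.
- intros x Hx; apply HK0 in Hx; apply K1 in Hx as Hx'; split; trivial.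
  exists 1, 0, 0, x; repeat split; trivial; simpl !1; simpl !0; grp ZF HX.
- intros x y (Hx & n & a & b & k & Hn & Hk & H) (Hy & n' & a' & b' & k' & Hn' & Hk' & H').
  split; [now apply gadd_car|].
  exists (n * n'), (n' * a + n * a'), (n' * b + n * b'), (add (!n' • k) (!n • k')).
  repeat split; [now apply hNNmul|apply K3; now apply subgrp_mul|].
  apply K1 in Hk, Hk'; rewrite !Nat2Z.inj_add, !Nat2Z.inj_mul.
  transitivity (add (!n' • add (!n • x) (!a • e)) (!n • add (!n' • y) (!a' • e)));
    [grp ZF HX|rewrite H, H'; grp ZF HX].
- intros x (Hx & n & a & b & k & Hn & Hk & H); split; [now apply gopp_car|].
  exists n, b, a, (opp k); repeat split; auto; apply K1 in Hk.
  transitivity (add (opp (add (!n • x) (!a • e))) (add (!a • e) (!b • e)));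
    [grp ZF HX|rewrite H; grp ZF HX].
- intros m y Hm Hy (_ & n & a & b & k & Hn & Hk & H); split; trivial.
  exists (n * m), a, b, k; repeat split; auto; rewrite <- H, Nat2Z.inj_mul; grp ZF HX.
- exists T; split; trivial; repeat split.
  + intros x Hx; apply HTx; apply K1 in Hx as Hx'; split; trivial.
    exists 1, 0, 0, x; repeat split; trivial; simpl !1; simpl !0; grp ZF HX.
  + apply HTx; split; trivial; exists 1, 0, 1, zero; repeat split; trivial.
  + intros x Hx; now apply HTx.
Qed.

Definition pivot (x : S) : Prop :=
  x ∈ car X ∧ ∃ T, closed T ∧ (∀ g, g ∈ G0 → g ∈ T) ∧
    (∀ y, y ∈ car X → rel E R y x → y ∈ T) ∧ ¬ x ∈ T.

Definition pivot_le (x y : S) : Prop := pivot y ∧ (y = x ∨ rel E R y x).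

Lemma Def_pivot : Def E (λ e, pivot (e 0)).
Proof. unfold pivot; def. Qed.

Hint Resolve Def_pivot : defs.

Lemma Def_closure_le : Def E (λ e, in_closure (pivot_le (e 1)) (e 0)).
Proof. unfold in_closure, pivot_le; def. Qed.

Hint Resolve Def_closure_le : defs.

Lemma closure_mono (P Q : S → Prop) x :
  (∀ y, P y → Q y) → in_closure P x → in_closure Q x.
Proof. intros H [Hx Hx']; split; auto. Qed.

(** Adjoining 0 to [K0] bounds the least closed set: some n x with n in [NN] lies in [K0]. It also
    lies in [G0], so it vanishes, and n is injective on [G0]. *)
Lemma closure_none x : in_closure (λ _, False) x → x ∈ G0 → x = zero.
Proof.
intros [Hx H] Hg.
destruct (@adjoin_closed K0 zero) as (T & HT & _ & _ & HT'); [exact hK0|trivial|exact (gzero_car ZF HX)|].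
assert (H' : x ∈ T) by (apply H; [exact HT|tauto]).
destruct (HT' _ H') as (n & a & b & k & Hn & Hk & Hx').
apply (htors Hn Hg), hdisj; [now apply subgrp_mul|].
replace (!n • x) with k; trivial; apply (proj1 hK0) in Hk.
transitivity (add (!b • zero) k); [|rewrite <- Hx'];
  pose proof (gzero_car ZF HX); grp ZF HX.
Qed.

(** Totality of [R] makes the hulls of the pivots up to y a chain, so two elements of the union lie
    in a common hull. The hull of nothing covers the case of empty [L]. *)
Lemma chain_closed L : ∃ T, closed T ∧
  ∀ x, x ∈ T ↔ in_closure (λ _, False) x ∨
               ∃ y, y ∈ L ∧ y ∈ car X ∧ in_closure (pivot_le y) x.
Proof.
set (Q := λ x, in_closure (λ _, False) x ∨
               ∃ y, y ∈ L ∧ y ∈ car X ∧ in_closure (pivot_le y) x).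
assert (H0 : ∀ P x, in_closure (λ _, False) x → in_closure P x).
{ intros P x; apply closure_mono; tauto. }
assert (HQ1 : ∀ x, Q x →
  ∃ P, in_closure P x ∧ ∀ y, in_closure P y → Q y).
{ intros x [Hx|(y & Hy & Hy' & Hx)]; [exists (λ _, False)|exists (pivot_le y)];
    (split; [exact Hx|]); intros z Hz; [now left|right; eauto]. }
assert (HQ2 : ∀ x x', Q x → Q x' →
  ∃ P, in_closure P x ∧ in_closure P x' ∧ ∀ y, in_closure P y → Q y).
{ intros x x' Hx [Hx'|(y' & Hy' & Hy'' & Hx')].
  - destruct (HQ1 x Hx) as (P & HP & HP'); exists P; auto.
  - destruct Hx as [Hx|(y & Hy & Hy0 & Hx)].
    + exists (pivot_le y'); split; [now apply H0|split; [exact Hx'|]].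
      intros z Hz; right; eauto.
    + destruct hR as (hR1 & hR2 & _).
      assert (H : ∀ u v, rel E R u v → ∀ z, in_closure (pivot_le u) z →
                         in_closure (pivot_le v) z).
      { intros u v Huv z; apply closure_mono; intros w [Hw [->|Hw']]; split; eauto. }
      destruct (hR1 y y' Hy0 Hy'') as [Hr|[<-|Hr]];
        [exists (pivot_le y')|exists (pivot_le y)|exists (pivot_le y)];
        (split; [|split]); eauto; intros z Hz; right; eauto. }
apply closed_of.
- unfold Q, in_closure at 1; def.
- intros x Hx; destruct (HQ1 x Hx) as (P & [HP _] & _); exact HP.
- intros x Hx; left; now apply closure_closed.
- intros x y Hx Hy; destruct (HQ2 x y Hx Hy) as (P & Hx' & Hy' & HP).
  now apply HP, closure_closed.
- intros x Hx; destruct (HQ1 x Hx) as (P & Hx' & HP); now apply HP, closure_closed.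
- intros n y Hn Hy Hx; destruct (HQ1 _ Hx) as (P & Hx' & HP).
  apply HP; now apply (closure_closed P) with n.
Qed.

(** Independence of the pivots from [G0], by induction along [R]. With [T] the hull of the earlier
    pivots, a multiple n g equals t plus a multiple of [x]. If that coefficient is invertible, [x]
    is in the closed set showing that it is a pivot, which is absurd; otherwise the multiple of [x]
    lies in [K0], so n g is in [T] and the induction hypothesis applies. *)
Lemma closure_pivot_le x g : x ∈ car X → g ∈ G0 → in_closure (pivot_le x) g → g = zero.
Proof.
destruct hR as (hR1 & hR2 & hR3); revert g.
induction (hR3 x) as [x _ IH]; intros g Hx Hg [Hg' Hgx].
destruct (@sep _ _ ZF (λ y, rel E R y x) (car X)) as [L HL]; [def|].
destruct (chain_closed L) as (T & HT & HTx).
assert (HTG : ∀ h, h ∈ G0 → h ∈ T → h = zero).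
{ intros h Hh HhT; apply HTx in HhT; destruct HhT as [HhT|(y & Hy & Hy' & HhT)].
  - now apply closure_none.
  - apply HL in Hy; now apply (IH y). }
assert (HTp : ∀ y, pivot y → rel E R y x → y ∈ T).
{ intros y Hp Hy; apply HTx; right; exists y; pose proof (proj1 Hp) as Hy'.
  rewrite HL; repeat split; auto; intros T' _ H; apply H; split; auto. }
destruct (classic (pivot x)) as [Hp|Hp].
- destruct Hp as (_ & T1 & HT1 & HG1 & Hlt & HxT1).
  (* [T1] contains all predecessors of [x], in particular the earlier pivots that generate [T]. *)
  assert (HTT1 : ∀ y, y ∈ T → y ∈ T1).
  { intros y Hy; apply HTx in Hy; destruct Hy as [[_ Hy]|(z & Hz & Hz' & [_ Hy])];
      (apply Hy; [exact HT1|]); [tauto|].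
    apply HL in Hz; destruct Hz as [_ Hz].
    intros w [Hw [->|Hw']]; apply Hlt; eauto; apply Hw. }
  destruct (@adjoin_closed T x) as (T2 & HT2 & H1 & H2 & H3); trivial; [apply HT|apply HT|].
  assert (HgT : g ∈ T2).
  { apply Hgx; trivial; intros y [Hy [->|Hy']]; auto. }
  destruct (H3 g HgT) as (n & a & b & t & Hn & Ht & H).
  pose proof (proj1 (proj1 HT) t Ht) as Ht'.
  assert (Hng : !n • g ∈ G0) by now apply subgrp_mul.
  (* The coefficient is split into absolute value and sign because [hdich] speaks of natural
     numbers. *)
  assert (Hm : ∃ m : nat, ∃ s : Z, (s = 1 ∨ s = -1)%Z ∧ (!a - !b)%Z = (s * !m)%Z).
  { destruct (Nat.le_ge_cases a b); [exists (b - a), (-1)%Z|exists (a - b), 1%Z]; lia. }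
  destruct Hm as (m & s & Hs & Hm).
  assert (Heq : add (!n • g) ((s * !m)%Z • x) = t).
  { rewrite <- Hm; transitivity (add (add (!n • g) (!a • x)) (opp (!b • x)));
      [replace (!a - !b)%Z with (!a + - !b)%Z by lia; grp ZF HX|rewrite H; grp ZF HX]. }
  destruct (hdich m) as [Hm'|Hm'].
  + exfalso; apply HxT1, (proj2 (proj2 HT1) m); trivial.
    replace (!m • x) with (s • add t (opp (!n • g))).
    * apply closed_mul; trivial; apply closed_add; auto; apply closed_opp; auto.
    * rewrite <- Heq; replace (!m) with (s * s * !m)%Z at 2 by (destruct Hs; subst; lia).
      grp ZF HX.
  + apply (htors Hn Hg), HTG; trivial.
    replace (!n • g) with (add t (opp (s • (!m • x)))); [|rewrite <- Heq; grp ZF HX].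
    apply closed_add, closed_opp, closed_mul; trivial; apply HT; auto.
- apply HTG; trivial; apply Hgx; trivial; intros y [Hy [->|Hy']]; [contradiction|auto].
Qed.

(** Gaussian elimination: the pivots are the elements not in the closed subgroup
    generated by [G0] and their predecessors; they generate a complement. *)
Theorem complement_ex : ∃ K, subgrp K ∧ (∀ x, x ∈ K → x ∈ G0 → x = zero) ∧
  ∀ x, x ∈ car X → ∃ g k, g ∈ G0 ∧ k ∈ K ∧ x = add g k.
Proof.
destruct (closure_ex (P := pivot)) as (K & HK & HKx); [apply Def_pivot|].
exists K; split; [apply HK|split].
- intros g Hg HgG; destruct (chain_closed (car X)) as (T & HT & HTx).
  apply HKx in Hg; destruct Hg as [_ Hg]; specialize (Hg T HT).
  destruct (proj1 (HTx g)) as [H|(y & _ & Hy & H)].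
  + apply Hg; intros y Hy; apply HTx; right; exists y.
    pose proof (proj1 Hy) as Hy'; repeat split; trivial.
    intros T' _ H; apply H; split; auto.
  + now apply closure_none.
  + now apply (closure_pivot_le Hy).
- destruct (sum_closed HK) as (T & HT & HTx).
  intros x Hx; apply HTx; destruct hR as (_ & _ & hR3).
  pose proof (gzero_car ZF HX) as H0.
  assert (HG : ∀ g, g ∈ G0 → g ∈ T).
  { intros g Hg; apply HTx; exists g, zero; repeat split; trivial; [exact (proj1 (proj2 (proj1 HK)))|].
    apply (proj1 hG0) in Hg; grp ZF HX. }
  assert (HKT : ∀ k, k ∈ K → k ∈ T).
  { intros k Hk; apply HTx; exists zero, k; repeat split; trivial; [exact (proj1 (proj2 hG0))|].
    apply (proj1 (proj1 HK)) in Hk; grp ZF HX. }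
  (* If [x] were outside [T], which is G0 + K and contains its predecessors by induction, then [T]
     would witness that [x] is a pivot; but pivots lie in [K]. *)
  induction (hR3 x) as [x _ IH]; apply NNPP; intros HxT; apply HxT, HKT, HKx.
  split; trivial; intros T' _ H; apply H; split; trivial; exists T; auto.
Qed.

End Complement.

(** * Cotorsion groups *)

Section Homomorphisms.

Context {S : Type} {E : S → S → Prop} (ZF : Zermelo E).
Local Infix "∈" := E (at level 70).

Lemma sep_function (Q : S → S → Prop) X Y : Def E (λ e, Q (e 0) (e 1)) →
  (∀ x, x ∈ X → ∃ y, y ∈ Y ∧ ∀ z, z ∈ Y → Q x z ↔ z = y) →
  ∃ f, is_function E f X Y ∧ ∀ x y, rel E f x y ↔ x ∈ X ∧ y ∈ Y ∧ Q x y.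
Proof.
intros HQ H; destruct (sep2 ZF X Y HQ) as (f & Hf1 & Hf2).
assert (Hf : ∀ x y, rel E f x y ↔ x ∈ X ∧ y ∈ Y ∧ Q x y).
{ intros x y; now rewrite (relE ZF). }
exists f; split; [split; [split|]|exact Hf].
- intros p Hp; destruct (Hf2 p Hp) as (x & y & Hx & Hy & ->).
  exists x; split; trivial; exists y; apply pr_is.
- intros x Hx; destruct (H x Hx) as (y & Hy & Hy').
  exists y; split; [apply Hf; repeat split; trivial; now apply Hy'|].
  intros z Hz; apply Hf in Hz; symmetry; now apply Hy'.
- intros x y Hxy; now apply Hf in Hxy.
Qed.

Definition additive (G H : gstr S) (φ : S → S) : Prop :=
  (∀ x, x ∈ car G → φ x ∈ car H) ∧
  ∀ x y, x ∈ car G → y ∈ car G → φ (gadd ZF G x y) = gadd ZF H (φ x) (φ y).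

Section Additive.

Variables (G H : gstr S) (HG : is_abgroup E G) (HH : is_abgroup E H).
Add Ring sqH : (gel_ring ZF HH).

Lemma idempotent_zero x : x ∈ car H → gadd ZF H x x = x → x = gzero ZF H.
Proof.
intros Hx Hxx; transitivity (gadd ZF H (gadd ZF H x x) (gopp ZF H x)); [grp ZF HH|].
rewrite Hxx; grp ZF HH.
Qed.

Lemma opp_eq x y : x ∈ car H → y ∈ car H →
  gadd ZF H x y = gzero ZF H → y = gopp ZF H x.
Proof.
intros Hx Hy Hxy.
transitivity (gadd ZF H (gadd ZF H x y) (gopp ZF H x)); [grp ZF HH|].
rewrite Hxy; grp ZF HH.
Qed.

Lemma gmul_gmul k l x : x ∈ car H → gmul ZF H k (gmul ZF H l x) = gmul ZF H (k * l) x.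
Proof. intros Hx; grp ZF HH. Qed.

Lemma gmul_plus k l x : x ∈ car H →
  gmul ZF H (k + l) x = gadd ZF H (gmul ZF H k x) (gmul ZF H l x).
Proof. intros Hx; grp ZF HH. Qed.

Lemma gmul_add k x y : x ∈ car H → y ∈ car H →
  gmul ZF H k (gadd ZF H x y) = gadd ZF H (gmul ZF H k x) (gmul ZF H k y).
Proof. intros Hx Hy; grp ZF HH. Qed.

Lemma gmul_opp k x : x ∈ car H → gmul ZF H k (gopp ZF H x) = gopp ZF H (gmul ZF H k x).
Proof. intros Hx; grp ZF HH. Qed.

Lemma gmul_zero k : gmul ZF H k (gzero ZF H) = gzero ZF H.
Proof. pose proof (gzero_car ZF HH); grp ZF HH. Qed.

Lemma gmul_one x : x ∈ car H → gmul ZF H 1 x = x.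
Proof. intros Hx; grp ZF HH. Qed.

Lemma sub_zero x y : x ∈ car H → y ∈ car H →
  gadd ZF H x (gopp ZF H y) = gzero ZF H → x = y.
Proof.
intros Hx Hy Hxy.
transitivity (gadd ZF H (gadd ZF H x (gopp ZF H y)) y); [grp ZF HH|].
rewrite Hxy; grp ZF HH.
Qed.

Variables (φ : S → S) (Hφ : additive G H φ).

Lemma additive_zero : φ (gzero ZF G) = gzero ZF H.
Proof.
destruct Hφ as [H1 H2]; pose proof (gzero_car ZF HG).
apply idempotent_zero; auto; rewrite <- H2 by assumption; now rewrite (gadd0 ZF HG).
Qed.

Lemma additive_opp x : x ∈ car G → φ (gopp ZF G x) = gopp ZF H (φ x).
Proof.
destruct Hφ as [H1 H2]; intros Hx; pose proof (gopp_car ZF HG Hx).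
apply opp_eq; auto; rewrite <- H2 by assumption.
rewrite (gaddN ZF HG) by assumption; apply additive_zero.
Qed.

Lemma additive_mul k x : x ∈ car G → φ (gmul ZF G k x) = gmul ZF H k (φ x).
Proof.
destruct Hφ as [H1 H2]; intros Hx.
assert (Hn : ∀ n, Nat.iter n (gadd ZF G x) (gzero ZF G) ∈ car G ∧
  φ (Nat.iter n (gadd ZF G x) (gzero ZF G)) =
  Nat.iter n (gadd ZF H (φ x)) (gzero ZF H)).
{ induction n as [|n [IH1 IH2]]; simpl.
  - split; [exact (gzero_car ZF HG)|exact additive_zero].
  - split; [now apply gadd_car|rewrite H2 by assumption; now rewrite IH2]. }
destruct k; simpl; [exact additive_zero|apply Hn|].
rewrite additive_opp by apply Hn; f_equal; apply Hn.
Qed.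

End Additive.

Definition value (f x : S) : S := the ZF (λ y, rel E f x y).

Lemma valueE f X Y x y : is_function E f X Y → x ∈ X → rel E f x y ↔ y = value f x.
Proof.
intros Hf Hx; destruct (is_function_val Hf Hx) as (z & _ & Hz).
assert (H : rel E f x (value f x)).
{ apply (@theP _ _ ZF (λ y, rel E f x y)); exists z; now apply Hz. }
rewrite Hz in *; split; congruence.
Qed.

Lemma value_in f X Y x : is_function E f X Y → x ∈ X → value f x ∈ Y.
Proof. intros Hf Hx; apply (proj2 Hf x); now apply (valueE _ Hf). Qed.

Lemma hom_additive f G H : is_abgroup E G → is_abgroup E H → is_hom E f G H →
  additive G H (value f).
Proof.
intros HG HH [Hf Hh]; split; [intros x; apply (value_in Hf)|].
intros x y Hx Hy; apply (gopE ZF HH); try now apply (value_in Hf).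
apply (Hh x y (gadd ZF G x y)); [now apply (gopE ZF HG)|..];
  apply (valueE _ Hf); trivial; now apply gadd_car.
Qed.

(** The function of multiples mentioned in [torsionfree] is obtained from [mulr] by separation, with
    no recursion theorem on ω. *)
Lemma torsionfreeE J W n x : is_omega E W → is_abgroup E J → torsionfree E J →
  n ≠ 0 → x ∈ car J → gmul ZF J (Z.of_nat n) x = gzero ZF J → x = gzero ZF J.
Proof.
intros HW HJ HT Hn Hx H; pose proof (omegaE ZF HW) as HW'.
destruct (@sep_function (λ n v, mulr E J n x v) W (car J)) as (m & Hm1 & Hm2).
- def.
- intros k Hk; apply HW' in Hk; destruct Hk as [k' ->].
  exists (gmul ZF J (Z.of_nat k') x); split; [now apply gmul_car|].
  intros z _; now apply mulrE.
- apply (HT W x m) with (num ZF n); trivial.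
  + split; [|split; [|split]]; trivial.
    * intros k e Hk He; replace k with (num ZF 0) by exact (empty_fun ZF (@num0 _ _ ZF) Hk).
      apply Hm2; split; [apply HW'; eauto|]; split; [apply He|].
      apply mulrE; trivial; apply (is_zeroE ZF HJ) in He; now subst.
    * intros k Hk k' y z Hk' Hy Hz; apply HW' in Hk; destruct Hk as [j ->].
      apply num_succ in Hk'; subst k'.
      apply Hm2 in Hy; destruct Hy as (_ & Hy & Hyx); apply mulrE in Hyx; trivial.
      apply (gopE ZF HJ) in Hz; trivial.
      apply Hm2; split; [apply HW'; eauto|]; split; [subst; now apply gadd_car|].
      apply mulrE; trivial; subst; rewrite Nat2Z.inj_succ.
      unfold Z.succ; rewrite gmul_plus by assumption; now rewrite (gmul_one HJ).
  + apply HW'; eauto.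
  + now rewrite (num_empty ZF).
  + apply gzero_is, HJ.
  + apply Hm2; split; [apply HW'; eauto|]; split; [exact (gzero_car ZF HJ)|].
    now apply mulrE.
Qed.

End Homomorphisms.

Section Cotorsion.

Context {S : Type} {E : S → S → Prop} (ZF : Zermelo E) (Hord : orderable E).
Context {W : S} (HW : is_omega E W).
Local Infix "∈" := E (at level 70).
Local Notation "! n" := (Z.of_nat n) (at level 5).
Local Notation add := (gadd ZF).
Local Notation mul := (gmul ZF).
Local Notation opp := (gopp ZF).
Local Notation zero := (gzero ZF).

(** Its negation says that [n] acts injectively on [G]; such numbers form the set [NN] of the
    elimination. *)
Definition annihilates (G : gstr S) (n : nat) : Prop :=
  ∃ x, x ∈ car G ∧ x ≠ zero G ∧ mul G !n x = zero G.

(** The common criterion for the bounded and the divisible case. Numbers acting injectively on [G]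
    are also surjective on it, all others send [X] into [K0], so elimination yields a complement of
    the image of [i]. The projection is bijective on this complement, and its inverse is the
    section. *)
Lemma cotorsion_of G : is_abgroup E G →
  (∀ n g, ¬ annihilates G n → g ∈ car G → ∃ h, h ∈ car G ∧ mul G !n h = g) →
  (∀ X J i p, is_abgroup E X → is_abgroup E J → torsionfree E J →
     is_short_exact E i p G X J →
     ∃ K0, subgrp ZF X K0 ∧
       (∀ g x, g ∈ car G → rel E i g x → x ∈ K0 → g = zero G) ∧
       ∀ n x, annihilates G n → x ∈ car X → mul X !n x ∈ K0) →
  cotorsion E G.
Proof.
intros HG Hdiv HK0; split; trivial; intros J HJ Htf X i p HX Hse.
destruct (HK0 X J i p HX HJ Htf Hse) as (K0 & HK & HK0i & HK0n); clear HK0.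
destruct Hse as (Hi & Hp & Hinj & Hsurj & Hker).
pose proof (omegaE ZF HW) as HW'.
pose proof (hom_additive ZF HG HX Hi) as Hi'; pose proof (hom_additive ZF HX HJ Hp) as Hp'.
destruct Hi as [Hi _], Hp as [Hp Hph].
set (ι := value ZF i) in *; set (π := value ZF p) in *.
assert (Hι : ∀ x y, x ∈ car G → y ∈ car G → ι x = ι y → x = y).
{ intros x y Hx Hy Hxy; apply (Hinj x y (ι x)); apply (valueE ZF _ Hi); auto. }
destruct (@sep _ _ ZF (λ x, ∃ g, rel E i g x) (car X)) as [G0 HG0]; [def|].
assert (HG0' : ∀ x, x ∈ G0 ↔ ∃ g, g ∈ car G ∧ x = ι g).
{ intros x; rewrite HG0; split.
  - intros (_ & g & Hg); destruct (is_function_dom ZF Hi Hg) as [Hg' _].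
    exists g; split; trivial; now apply (valueE ZF _ Hi).
  - intros (g & Hg & ->); split; [now apply Hi'|].
    exists g; now apply (valueE ZF _ Hi). }
assert (Hπ : ∀ x, x ∈ car X → x ∈ G0 ↔ π x = zero J).
{ intros x Hx; rewrite HG0, Hker; split.
  - intros (_ & e & He & H); apply (is_zeroE ZF HJ) in He; subst e.
    symmetry; now apply (valueE ZF _ Hp).
  - intros H; split; trivial; exists (zero J); split; [apply gzero_is, HJ|].
    now apply (valueE ZF _ Hp). }
destruct (@sep _ _ ZF (λ n, ∀ x v, x ∈ car G → mulr E G n x v →
  is_zero E G v → x = v) W) as [NN HNN]; [def|].
assert (HNN' : ∀ n, num ZF n ∈ NN ↔ ¬ annihilates G n).
{ intros n; rewrite HNN; split.
  - intros [_ H] (x & Hx & Hx0 & Hn); apply Hx0, (H x (zero G)); trivial.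
    + now apply mulrE.
    + apply gzero_is, HG.
  - intros H; split; [apply HW'; eauto|].
    intros x v Hx Hn Hv; apply mulrE in Hn; trivial.
    apply (is_zeroE ZF HG) in Hv; subst v; apply NNPP; intros Hx0.
    apply H; exists x; repeat split; congruence. }
assert (Hsub : subgrp ZF X G0).
{ repeat split; setoid_rewrite HG0'.
  - intros x (g & Hg & ->); now apply Hi'.
  - exists (zero G); split; [exact (gzero_car ZF HG)|symmetry].
    now apply additive_zero.
  - intros x y (g & Hg & ->) (h & Hh & ->); exists (add G g h).
    split; [now apply gadd_car|symmetry; now apply Hi'].
  - intros x (g & Hg & ->); exists (opp G g); split; [now apply gopp_car|symmetry].
    now apply (additive_opp HG HX Hi'). }
destruct (Hord (car X)) as [R HR].
destruct (@complement_ex _ _ ZF X HX W NN G0 K0 R) as (K & HKs & HKd & HKsum);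
  trivial.
- intros n Hn; apply HNN in Hn; now apply HW'.
- apply HNN'; intros (x & Hx & Hx0 & H); apply Hx0; rewrite <- H.
  symmetry; now apply (gmul_one ZF HG).
- intros m n; rewrite !HNN'; intros Hm Hn (x & Hx & Hx0 & H); apply Hm.
  exists (mul G !n x); repeat split; [now apply gmul_car|..].
  + intros H'; apply Hn; now exists x.
  + now rewrite (gmul_gmul ZF HG), <- Nat2Z.inj_mul.
- intros n x; rewrite HNN'; intros Hn Hx; apply HG0' in Hx; destruct Hx as (g & Hg & ->).
  destruct (Hdiv n g Hn Hg) as (h & Hh & <-); exists (ι h); rewrite HG0'; split; eauto.
  symmetry; now apply (additive_mul HG HX Hi').
- intros n x; rewrite HNN'; intros Hn Hx; apply HG0' in Hx; destruct Hx as (g & Hg & ->).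
  intros H; rewrite <- (additive_zero HG HX Hi').
  rewrite <- (additive_mul HG HX Hi'), <- (additive_zero HG HX Hi') in H by trivial.
  f_equal; apply NNPP; intros Hg0; apply Hn; exists g; repeat split; trivial.
  apply Hι; trivial; [now apply gmul_car|exact (gzero_car ZF HG)].
- intros x Hx Hx0; apply HG0' in Hx; destruct Hx as (g & Hg & ->).
  rewrite (HK0i g (ι g)); trivial; [now apply additive_zero|now apply (valueE ZF _ Hi)].
- intros n; rewrite HNN'; destruct (classic (annihilates G n)); auto.
- pose proof HKs as (HK1 & HK2 & HK3 & HK4).
  assert (Hsec : ∀ j, j ∈ car J → ∃ k, k ∈ K ∧ π k = j).
  { intros j Hj; destruct (Hsurj j Hj) as [x Hx].
    destruct (is_function_dom ZF Hp Hx) as [Hx' _].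
    destruct (HKsum x Hx') as (g & k & Hg & Hk & ->); exists k; split; trivial.
    apply (valueE ZF _ Hp) in Hx; trivial; fold π in Hx; rewrite Hx.
    apply (proj1 Hsub) in Hg as Hg'; apply HK1 in Hk as Hk'; apply Hπ in Hg; trivial.
    rewrite (proj2 Hp'), Hg by trivial; apply (proj1 Hp') in Hk'; fold π in Hk'.
    rewrite (gaddC ZF HJ); trivial; [now rewrite (gadd0 ZF HJ)|exact (gzero_car ZF HJ)]. }
  assert (Huniq : ∀ k l, k ∈ K → l ∈ K → π k = π l → k = l).
  { intros k l Hk Hl H; apply HK1 in Hk as Hk'; apply HK1 in Hl as Hl'.
    apply (sub_zero (ZF := ZF) HX); trivial; apply HKd; auto.
    apply Hπ; [apply gadd_car; auto; now apply gopp_car|].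
    rewrite (proj2 Hp') by (auto; now apply gopp_car).
    rewrite (additive_opp HX HJ Hp'), H by trivial; apply gaddN; trivial.
    now apply Hp'. }
  destruct (@sep_function _ _ ZF (λ j k, k ∈ K ∧ rel E p k j) (car J) (car X))
    as (s & Hs1 & Hs2).
  + def.
  + intros j Hj; destruct (Hsec j Hj) as (k & Hk & Hkj); exists k; split; auto.
    intros z Hz; split; [|intros ->; split; trivial; apply (valueE ZF _ Hp); auto].
    intros [Hz' H]; apply Huniq; trivial; apply (valueE ZF _ Hp) in H; trivial.
    fold π in H; congruence.
  + exists s; split; [split; trivial|intros j x H; now apply Hs2 in H].
    intros j j' j'' k k' k'' Hj Hk Hk' Hk''; apply Hs2 in Hk, Hk', Hk''.
    destruct Hk as (Hj1 & Hk1 & Hk2 & Hk3), Hk' as (Hj1' & Hk1' & Hk2' & Hk3'),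
      Hk'' as (Hj1'' & Hk1'' & Hk2'' & Hk3'').
    apply (gopE ZF HX); trivial; apply Huniq; auto.
    rewrite (proj2 Hp') by trivial.
    apply (gopE ZF HJ) in Hj; trivial.
    apply (valueE ZF _ Hp) in Hk3, Hk3', Hk3''; trivial; fold π in Hk3, Hk3', Hk3''.
    congruence.
Qed.

Lemma prime_multiple_or_bezout p n : Znumtheory.prime !p →
  (∃ m, !n = (m * !p)%Z) ∨ ∃ u v, (u * !n + v * !p = 1)%Z.
Proof.
intros Hp; destruct (Znumtheory.Zdivide_dec !p !n) as [[m Hm]|Hn]; [eauto|right].
destruct (Znumtheory.rel_prime_bezout _ _ (Znumtheory.prime_rel_prime _ Hp !n Hn))
  as [u v Huv].
exists v, u; lia.
Qed.

(** Here [K0] is pX. If p y comes from [G], then p kills the image of [y] in the torsionfree group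
    [J], so [y] comes from [G] and p y = 0; hence pX meets the image of [G] trivially. *)
Lemma bounded_cotorsion G p : is_abgroup E G → Znumtheory.prime !p →
  (∀ x, x ∈ car G → mul G !p x = zero G) → cotorsion E G.
Proof.
intros HG Hp HpG.
(* On a group killed by [p], the Bézout coefficient [u] inverts multiplication by [n]. *)
assert (Hbez : ∀ n u v x, (u * !n + v * !p = 1)%Z → x ∈ car G →
  x = mul G u (mul G !n x)).
{ intros n u v x Huv Hx; rewrite <- (gmul_one ZF HG Hx) at 1.
  rewrite <- Huv, (gmul_plus ZF HG) by trivial.
  rewrite <- !(gmul_gmul ZF HG), HpG, (gmul_zero ZF HG) by trivial.
  apply gadd0; trivial; do 2 (apply gmul_car; trivial). }
apply cotorsion_of; trivial.
- intros n g Hn Hg; destruct (prime_multiple_or_bezout n Hp) as [[m Hm]|(u & v & Huv)].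
  + exists g; split; trivial; apply NNPP; intros H; apply Hn; exists g.
    assert (H0 : mul G !n g = zero G).
    { now rewrite Hm, <- (gmul_gmul ZF HG), HpG, (gmul_zero ZF HG). }
    repeat split; trivial; congruence.
  + exists (mul G u g); split; [now apply gmul_car|].
    rewrite (gmul_gmul ZF HG), Z.mul_comm, <- (gmul_gmul ZF HG) by trivial.
    symmetry; now apply Hbez with v.
- intros X J i q HX HJ Htf (Hi & Hq & Hinj & _ & Hker).
  pose proof (hom_additive ZF HG HX Hi) as Hi'; pose proof (hom_additive ZF HX HJ Hq) as Hq'.
  destruct Hi as [Hi _], Hq as [Hq _].
  destruct (@sep _ _ ZF (λ x, ∃ y, y ∈ car X ∧ mulr E X (num ZF p) y x) (car X))
    as [K0 HK0]; [def|].
  assert (HK0' : ∀ x, x ∈ K0 ↔ ∃ y, y ∈ car X ∧ x = mul X !p y).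
  { intros x; rewrite HK0; split.
    - intros (_ & y & Hy & H); exists y; split; trivial; now apply mulrE in H.
    - intros (y & Hy & ->); split; [now apply gmul_car|].
      exists y; split; trivial; now apply mulrE. }
  exists K0; split; [|split].
  + repeat split; setoid_rewrite HK0'.
    * intros x (y & Hy & ->); now apply gmul_car.
    * exists (zero X); split; [exact (gzero_car ZF HX)|]; symmetry; now apply gmul_zero.
    * intros x y (x' & Hx & ->) (y' & Hy & ->); exists (add X x' y').
      split; [now apply gadd_car|symmetry; now apply gmul_add].
    * intros x (y & Hy & ->); exists (opp X y).
      split; [now apply gopp_car|symmetry; now apply gmul_opp].
  + intros g x Hg Hgx Hx; apply HK0' in Hx; destruct Hx as (y & Hy & ->).
    assert (Hqx : value ZF q (mul X !p y) = zero J).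
    { destruct (proj1 (Hker (mul X !p y))) as (e & He & H); [eauto|].
      apply (is_zeroE ZF HJ) in He; subst e; symmetry; apply (valueE ZF _ Hq); trivial.
      now apply gmul_car. }
    rewrite (additive_mul HX HJ Hq') in Hqx by trivial.
    assert (Hp0 : p ≠ 0) by (intros ->; destruct Hp; simpl in *; lia).
    apply (torsionfreeE HW HJ Htf Hp0) in Hqx; [|now apply Hq'].
    destruct (proj2 (Hker y)) as (h & Hh).
    { exists (zero J); split; [apply gzero_is, HJ|now apply (valueE ZF _ Hq)]. }
    destruct (is_function_dom ZF Hi Hh) as [Hh' _].
    apply (Hinj g (zero G) (mul X !p y)); trivial.
    apply (valueE ZF _ Hi) in Hh; trivial; subst y.
    rewrite <- (additive_mul HG HX Hi'), HpG by trivial.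
    apply (valueE ZF _ Hi); trivial; exact (gzero_car ZF HG).
  + intros n x (g & Hg & Hg0 & Hng) Hx; apply HK0'.
    destruct (prime_multiple_or_bezout n Hp) as [[m Hm]|(u & v & Huv)].
    * exists (mul X m x); split; [now apply gmul_car|].
      now rewrite (gmul_gmul ZF HX), Z.mul_comm, <- Hm.
    * exfalso; apply Hg0; rewrite (Hbez n u v g Huv Hg), Hng; now apply gmul_zero.
Qed.

(** Here [K0] is zero: only 0 can kill a nonzero element of [G], and 0 kills all of [X]. *)
Lemma divisible_cotorsion G : is_abgroup E G →
  (∀ n x, n ≠ 0 → x ∈ car G → mul G !n x = zero G → x = zero G) →
  (∀ n x, n ≠ 0 → x ∈ car G → ∃ y, y ∈ car G ∧ mul G !n y = x) →
  cotorsion E G.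
Proof.
intros HG Htf Hdiv; apply cotorsion_of; trivial.
(* If 0 annihilates no nonzero element, then [G] is trivial, and [g] is 0 times itself. *)
- intros n g Hn Hg; destruct (Nat.eq_dec n 0) as [->|Hn0]; [|now apply Hdiv].
  exists g; split; trivial; apply NNPP; intros H; apply Hn; exists g.
  repeat split; trivial; intros H'; apply H; now rewrite H'.
- intros X J i q HX HJ _ (Hi & _ & Hinj & _ & _).
  pose proof (hom_additive ZF HG HX Hi) as Hi'; destruct Hi as [Hi _].
  destruct (@sep _ _ ZF (λ x, x = zero X) (car X)) as [K0 HK0]; [def|].
  pose proof (gzero_car ZF HX) as HX0.
  assert (HK0' : ∀ x, x ∈ K0 ↔ x = zero X).
  { intros x; rewrite HK0; split; [tauto|intros ->; auto]. }
  exists K0; split; [|split].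
  + repeat split; setoid_rewrite HK0'; trivial.
    * now intros x ->.
    * intros x y -> ->; now apply gadd0.
    * intros x ->; symmetry; apply opp_eq; trivial; now apply gadd0.
  + intros g x Hg Hgx Hx; apply HK0' in Hx; subst x.
    apply (Hinj g (zero G) (zero X)); trivial; apply (valueE ZF _ Hi).
    * exact (gzero_car ZF HG).
    * symmetry; now apply additive_zero.
  + intros n x (g & Hg & Hg0 & Hng) Hx; apply HK0'.
    destruct (Nat.eq_dec n 0) as [->|Hn]; [reflexivity|].
    destruct Hg0; now apply (Htf n).
Qed.

Lemma subgroup_agrees H G : is_abgroup E G → is_subgroup E H G →
  (∀ x y, x ∈ car H → y ∈ car H → add H x y = add G x y) ∧
  (∀ k x, x ∈ car H → mul H k x = mul G k x) ∧ zero H = zero G ∧ subgrp ZF G (car H).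
Proof.
intros HG (HH & Hsub & Hop).
assert (Hφ : additive ZF H G (λ x, x)).
{ split; trivial; intros x y Hx Hy; apply (gopE ZF HG); auto.
  now apply Hop, (gopE ZF HH). }
split; [apply Hφ|split; [intros k x Hx; now apply (additive_mul HH HG Hφ)|]].
pose proof (additive_zero HH HG Hφ) as H0; split; trivial; repeat split; trivial.
- rewrite <- H0; exact (gzero_car ZF HH).
- intros x y Hx Hy; pose proof (proj2 Hφ x y Hx Hy) as Hxy; simpl in Hxy.
  rewrite <- Hxy; now apply gadd_car.
- intros x Hx; rewrite <- (additive_opp HH HG Hφ Hx); now apply gopp_car.
Qed.

Lemma subgroup_ex G T : is_abgroup E G → subgrp ZF G T →
  ∃ H, car H = T ∧ is_subgroup E H G.
Proof.
intros HG (HT1 & HT2 & HT3 & HT4).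
destruct (product_ex ZF T T) as [Q HQ]; pose proof (is_productE HQ) as HQ'.
destruct (@sep_function _ _ ZF (λ q z, rel E (gop G) q z) Q T) as (f & Hf1 & Hf2).
- def.
- intros q Hq; apply HQ in Hq; destruct Hq as (x & y & Hx & Hy & ->).
  exists (add G x y); split; auto; intros z _.
  rewrite (relE ZF), <- (rel2E ZF); apply (gopE ZF HG); auto.
- assert (Hop : ∀ x y z, rel2 E f x y z ↔ x ∈ T ∧ y ∈ T ∧ z = add G x y).
  { intros x y z; rewrite (rel2E ZF), <- (relE ZF), Hf2, HQ; split.
    - intros ((x' & y' & Hx & Hy & H) & _ & Hz); apply pr_inj in H.
      destruct H as [-> ->]; repeat split; trivial.
      rewrite (relE ZF), <- (rel2E ZF) in Hz; apply (gopE ZF HG); auto.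
    - intros (Hx & Hy & ->); repeat split; eauto.
      rewrite (relE ZF), <- (rel2E ZF); apply (gopE ZF HG); auto. }
  exists (Gstr T f); split; trivial; split; [|split; trivial].
  + split; [exists Q; now split|split; [|split]]; simpl; setoid_rewrite Hop.
    * intros x y z u v w (Hx & Hy & ->) (_ & Hz & ->) (_ & _ & ->).
      repeat split; auto; apply gaddA; auto.
    * intros x y z (Hx & Hy & ->); repeat split; trivial; apply gaddC; auto.
    * exists (zero G); split; [split; trivial|].
      -- intros x Hx; apply Hop; repeat split; trivial; symmetry.
         rewrite (gaddC ZF HG) by auto; apply gadd0; auto.
      -- intros x Hx; exists (opp G x); repeat split; auto.
         symmetry; apply gaddN; auto.
  + simpl; intros x y z Hz; apply Hop in Hz; destruct Hz as (Hx & Hy & ->).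
    apply (gopE ZF HG); auto.
Qed.

(** Strong induction on [n] peels off factors. For a prime, the elements it kills form a cotorsion
    subgroup by [bounded_cotorsion], which must be zero. *)
Lemma cotorsionfree_torsionfree G n x : cotorsionfree E G → n ≠ 0 → x ∈ car G →
  mul G !n x = zero G → x = zero G.
Proof.
intros [HG Hfree]; revert x; induction (lt_wf n) as [n _ IH]; intros x Hn Hx Hnx.
destruct (Nat.eq_dec n 1) as [->|Hn1]; [now rewrite (gmul_one ZF HG) in Hnx|].
destruct (Znumtheory.prime_dec !n) as [Hp|Hp].
- destruct (@sep _ _ ZF (λ y, mulr E G (num ZF n) y (zero G)) (car G)) as [T HT]; [def|].
  assert (HT' : ∀ y, y ∈ T ↔ y ∈ car G ∧ mul G !n y = zero G).
  { intros y; rewrite HT; split; intros [Hy H]; split; trivial.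
    - apply mulrE in H; auto.
    - now apply mulrE. }
  destruct (@subgroup_ex G T) as (H & <- & HH); trivial.
  { repeat split; setoid_rewrite HT'.
    - tauto.
    - split; [exact (gzero_car ZF HG)|now apply gmul_zero].
    - intros y z [Hy Hy'] [Hz Hz']; split; [now apply gadd_car|].
      rewrite (gmul_add ZF HG), Hy', Hz' by trivial; apply gadd0; trivial.
      exact (gzero_car ZF HG).
    - intros y [Hy Hy']; split; [now apply gopp_car|].
      rewrite (gmul_opp ZF HG), Hy' by trivial; symmetry; apply opp_eq; trivial;
        try exact (gzero_car ZF HG).
      apply gadd0; trivial; exact (gzero_car ZF HG). }
  destruct (subgroup_agrees HG HH) as (_ & Hm & H0 & _); rewrite <- H0.
  apply (is_zeroE ZF (proj1 HH)), (Hfree H); trivial; [|now apply HT'].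
  apply (@bounded_cotorsion H n); trivial; [apply HH|].
  intros y Hy; rewrite Hm, H0 by trivial; now apply HT' in Hy.
- apply Znumtheory.not_prime_divide in Hp; [|lia].
  destruct Hp as (a & Ha & [b Hb]).
  assert (Hab : ∃ a' b' : nat, !n = (!b' * !a')%Z ∧ a' ≠ 0 ∧ b' ≠ 0 ∧ a' < n ∧ b' < n).
  { exists (Z.to_nat a), (Z.to_nat b); nia. }
  destruct Hab as (a' & b' & H & H1 & H2 & H3 & H4).
  apply (IH a'); trivial; apply (IH b'); trivial; [now apply gmul_car|].
  now rewrite (gmul_gmul ZF HG), <- H.
Qed.

(** The elements divisible by every nonzero n form a subgroup, which torsionfreeness makes
    divisible; it is then cotorsion, hence zero. *)
Lemma cotorsionfree_reduced G x : cotorsionfree E G → x ∈ car G →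
  (∀ n, n ≠ 0 → ∃ y, y ∈ car G ∧ mul G !n y = x) → x = zero G.
Proof.
intros Hfree Hx Hdiv; pose proof (λ n x, @cotorsionfree_torsionfree G n x Hfree) as Htf.
destruct Hfree as [HG Hfree]; pose proof (omegaE ZF HW) as HW'.
destruct (@sep _ _ ZF (λ x, ∀ n, n ∈ W → ¬ is_empty E n →
  ∃ y, y ∈ car G ∧ mulr E G n y x) (car G)) as [T HT]; [def|].
assert (HT' : ∀ x, x ∈ T ↔ x ∈ car G ∧
  ∀ n, n ≠ 0 → ∃ y, y ∈ car G ∧ mul G !n y = x).
{ intros z; rewrite HT; split; intros [Hz H]; split; trivial; intros n Hn.
  - destruct (H (num ZF n)) as (y & Hy & Hy'); [apply HW'; eauto|now rewrite num_empty|].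
    exists y; split; trivial; apply mulrE in Hy'; auto.
  - intros Hn0; apply HW' in Hn; destruct Hn as [k ->]; rewrite num_empty in Hn0.
    destruct (H k Hn0) as (y & Hy & Hy'); exists y; split; trivial; now apply mulrE. }
destruct (@subgroup_ex G T) as (H & HHT & HH); trivial.
{ repeat split; setoid_rewrite HT'.
  - tauto.
  - split; [exact (gzero_car ZF HG)|].
    intros n _; exists (zero G); split; [exact (gzero_car ZF HG)|now apply gmul_zero].
  - intros y z [Hy Hy'] [Hz Hz']; split; [now apply gadd_car|].
    intros n Hn; destruct (Hy' n Hn) as (u & Hu & <-), (Hz' n Hn) as (v & Hv & <-).
    exists (add G u v); split; [now apply gadd_car|now apply gmul_add].
  - intros y [Hy Hy']; split; [now apply gopp_car|].
    intros n Hn; destruct (Hy' n Hn) as (u & Hu & <-).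
    exists (opp G u); split; [now apply gopp_car|now apply gmul_opp]. }
destruct (subgroup_agrees HG HH) as (_ & Hm & H0 & Hsub).
rewrite <- H0; apply (is_zeroE ZF (proj1 HH)), (Hfree H); trivial;
  [|rewrite HHT; apply HT'; auto].
rewrite HHT in *; apply divisible_cotorsion; [apply HH|..]; rewrite HHT.
- intros n y Hn Hy Hny; rewrite Hm, H0 in * by trivial; apply (Htf n); trivial.
  now apply HT in Hy.
- intros n y Hn Hy; apply HT' in Hy as Hy'; destruct Hy' as [Hy1 Hy2].
  destruct (Hy2 n Hn) as (z & Hz & Hnz); exists z.
  assert (HzT : z ∈ T); [|split; trivial; now rewrite Hm].
  apply HT'; split; trivial; intros m Hmn.
  (* To divide [z] by [m], divide [y] by [n * m]: then n kills m w - z, so m w = z. *)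
  destruct (Hy2 (n * m)) as (w & Hw & Hnw); [lia|]; exists w; split; trivial.
  rewrite Nat2Z.inj_mul, <- (gmul_gmul ZF HG), <- Hnz in Hnw by trivial.
  apply (sub_zero (ZF := ZF) HG); trivial; [now apply gmul_car|].
  apply (Htf n); trivial.
  + apply gadd_car; trivial; [now apply gmul_car|now apply gopp_car].
  + rewrite (gmul_add ZF HG), Hnw, (gmul_opp ZF HG); trivial;
      [|now apply gmul_car|now apply gopp_car].
    apply gaddN; trivial; now apply gmul_car.
Qed.

End Cotorsion.

(** * Forcing *)

Lemma set_wf : well_founded mem.
Proof.
assert (H : ∀ t x, cls x t → Acc mem x).
{ induction t as [I f IH]; intros x Hx; constructor; intros y (t & u & Ht & Hu & Htu).
  destruct (clsP x) as [t0 H0], (clsP y) as [t1 H1]; rewrite H0 in Hx, Hu; rewrite H1 in Ht.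
  assert (Hb : bisim u (node f)) by (apply bisim_trans with t0; trivial; now apply bisim_sym).
  destruct u as [J g]; destruct Htu as [j Hj], Hb as [Hb _], (Hb j) as [i Hi].
  apply (IH i); rewrite H1; apply bisim_trans with t; trivial; now apply bisim_trans with (g j). }
intros x; destruct (clsP x) as [t Ht]; apply (H t); rewrite Ht; apply bisim_refl.
Qed.

Section Forcing.

Context {S : Type} {E : S → S → Prop} (ZF : Zermelo E).
Local Infix "∈" := E (at level 70).

(** The filter and the evaluation are external to the ground structure; [V] enters only through its
    recursion equation [hV]. *)
Variables (P le : S) (G : S → Prop) (V : S → set).

Definition leq (q p : S) : Prop := q ∈ P ∧ p ∈ P ∧ rel E le q p.
(** This makes sense for all sets, not only names; as [G] is contained in [P], pairs with second
    component outside [P] would not affect the value. *)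
Definition el (σ π q : S) : Prop := q ∈ P ∧ rel E σ π q.

Hypothesis hle : is_preorder E P le.
Hypothesis hGP : ∀ p, G p → p ∈ P.
Hypothesis hGne : ∃ p, G p.
Hypothesis hGup : ∀ p q, G p → leq p q → G q.
Hypothesis hGdir : ∀ p q, G p → G q → ∃ r, G r ∧ leq r p ∧ leq r q.
Hypothesis hGgen : ∀ D, (∀ p, p ∈ D → p ∈ P) →
  (∀ p, p ∈ P → ∃ q, q ∈ D ∧ leq q p) → ∃ p, p ∈ D ∧ G p.
Hypothesis hTC : ∀ x, ∃ T, x ∈ T ∧ is_transitive E T.
Hypothesis hV : ∀ τ z, mem z (V τ) ↔ ∃ π q, el τ π q ∧ G q ∧ z = V π.

Lemma leq_refl p : p ∈ P → leq p p.
Proof. intros Hp; repeat split; trivial; now apply hle. Qed.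

Lemma leq_trans p q r : leq p q → leq q r → leq p r.
Proof.
intros (H1 & H2 & H3) (_ & H4 & H5); repeat split; trivial.
destruct hle as [_ H]; now apply (H p q r).
Qed.

Lemma generic_dense (Q : S → Prop) : Def E (λ e, Q (e 0)) →
  (∀ p, p ∈ P → ∃ q, leq q p ∧ Q q) → ∃ p, G p ∧ Q p.
Proof.
intros HQ H; destruct (sep ZF P HQ) as [D HD].
destruct (hGgen (D := D)) as (p & Hp & HpG).
- intros p Hp; now apply HD in Hp.
- intros p Hp; destruct (H p Hp) as (q & Hq & HqQ); exists q; split; trivial.
  apply HD; split; trivial; apply Hq.
- apply HD in Hp; exists p; tauto.
Qed.

(** Adding the conditions incompatible with [p] makes [Q] dense everywhere; as [G] is directed, none
    of the added ones lies in [G]. *)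
Lemma generic_below (Q : S → Prop) p : Def E (λ e, Q (e 0)) → G p →
  (∀ q, leq q p → ∃ r, leq r q ∧ Q r) → ∃ q, G q ∧ Q q.
Proof.
intros HQ Hp H.
destruct (@generic_dense (λ q, Q q ∨ ∀ r, leq r q → ¬ leq r p)) as (q & Hq & Hq').
- unfold leq; def.
- intros q Hq; destruct (classic (∃ r, leq r q ∧ leq r p)) as [(r & Hrq & Hrp)|Hn].
  + destruct (H r Hrp) as (s & Hs & HsQ); exists s; split; [now apply leq_trans with r|auto].
  + exists q; split; [now apply leq_refl|right]; intros r Hr Hr'; apply Hn; eauto.
- destruct (hGdir Hp Hq) as (r & _ & Hrp & Hrq); destruct Hq' as [Hq'|Hq']; [eauto|].
  now destruct (Hq' r).
Qed.

(** * The forcing relation for equality *)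

Lemma dom_wf : well_founded (λ π σ, ∃ q, rel E σ π q).
Proof.
apply wf_incl with (Relation_Operators.clos_trans _ E);
  [|apply wf_clos_trans, (z_wf ZF)].
intros π σ (q & w & (u & v & Hu & Hv & Hw) & H).
apply Relation_Operators.t_trans with w; [|now apply Relation_Operators.t_step].
apply Relation_Operators.t_trans with u; apply Relation_Operators.t_step.
- apply Hu; auto.
- apply Hw; auto.
Qed.

(** A set-sized approximation to the relation that p forces σ = τ. Each clause treats one inclusion
    and asks for a match only at some condition below any given [r], that is, densely. *)
Definition bisimulation (R : S) : Prop := ∀ p σ τ, rel2 E R p σ τ →
  (∀ π q r, el σ π q → leq r p → leq r q →
     ∃ s, leq s r ∧ ∃ π' q', el τ π' q' ∧ leq s q' ∧ rel2 E R s π π') ∧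
  (∀ π' q' r, el τ π' q' → leq r p → leq r q' →
     ∃ s, leq s r ∧ ∃ π q, el σ π q ∧ leq s q ∧ rel2 E R s π π').

(** Being a greatest fixed point, the forcing relation for equality is
    definable without recursion. *)
Definition forces_eq (p σ τ : S) : Prop :=
  ∃ R p0, bisimulation R ∧ leq p p0 ∧ rel2 E R p0 σ τ.

Lemma Def_forces_eq : Def E (λ e, forces_eq (e 0) (e 1) (e 2)).
Proof. unfold forces_eq, bisimulation, el, leq; def. Qed.

Hint Resolve Def_forces_eq : defs.

Lemma forces_eq_mono p q σ τ : leq q p → forces_eq p σ τ → forces_eq q σ τ.
Proof.
intros H (R & p0 & HR & Hp & Hst); exists R, p0; repeat split; try apply HR; trivial;
  now apply (leq_trans H Hp).
Qed.

(** A member of one value has matching names densely often; genericity puts a matching condition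
    into [G], and the matched pair is again in the bisimulation, so induction on [σ] applies. *)
Lemma forces_eq_sound σ : ∀ τ p, G p → forces_eq p σ τ → V σ = V τ.
Proof.
induction (dom_wf σ) as [σ _ IH]; intros τ p Hp (R & p0 & HR & Hpp & Hst).
apply (hGup Hp) in Hpp; clear p Hp; rename Hpp into Hp.
destruct (HR _ _ _ Hst) as [H1 H2]; apply set_ext; intros z; rewrite !hV; split.
- intros (π & q & Hπ & Hq & ->); destruct (hGdir Hp Hq) as (r & Hr & Hrp & Hrq).
  destruct (@generic_below (λ s, ∃ π' q', el τ π' q' ∧ leq s q' ∧ rel2 E R s π π') r)
    as (s & Hs & π' & q' & Hπ' & Hsq & HsR); trivial.
  + unfold el, leq; def.
  + intros r' Hr'; apply (H1 π q); trivial; now apply leq_trans with r.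
  + exists π', q'; repeat split; try apply Hπ'; [now apply hGup with s|].
    apply (IH π (ex_intro _ q (proj2 Hπ)) π' s Hs); exists R, s; split; trivial.
    split; trivial; apply leq_refl; auto.
- intros (π' & q' & Hπ' & Hq' & ->); destruct (hGdir Hp Hq') as (r & Hr & Hrp & Hrq).
  destruct (@generic_below (λ s, ∃ π q, el σ π q ∧ leq s q ∧ rel2 E R s π π') r)
    as (s & Hs & π & q & Hπ & Hsq & HsR); trivial.
  + unfold el, leq; def.
  + intros r' Hr'; apply (H2 π' q'); trivial; now apply leq_trans with r.
  + exists π, q; repeat split; try apply Hπ; [now apply hGup with s|symmetry].
    apply (IH π (ex_intro _ q (proj2 Hπ)) π' s Hs); exists R, s; split; trivial.
    split; trivial; apply leq_refl; auto.
Qed.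

(** A reason for p to force σ ≠ τ: some π that p puts into σ is never forced equal to a member of
    τ. *)
Definition refutes_left (p σ τ : S) : Prop :=
  ∃ π q, el σ π q ∧ leq p q ∧
    ∀ s π' q', leq s p → el τ π' q' → leq s q' → ¬ forces_eq s π π'.

Definition refutes_right (p σ τ : S) : Prop :=
  ∃ π' q', el τ π' q' ∧ leq p q' ∧
    ∀ s π q, leq s p → el σ π q → leq s q → ¬ forces_eq s π π'.

Lemma pair_trans T σ π q : is_transitive E T → σ ∈ T → rel E σ π q → π ∈ T.
Proof.
intros HT Hσ (w & (u & v & Hu & Hv & Hw) & H).
apply (HT u); [apply (HT w); [now apply (HT σ)|]|]; [apply Hw|apply Hu]; auto.
Qed.

(** Adding the triple [(p, σ, τ)] to the forced equalities again gives a bisimulation, because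
    failure of a clause at [r] is exactly a refutation by [r]. Restricting to a transitive set [T]
    around σ and τ makes it a set. *)
Lemma forces_eq_or_refutes p σ τ : p ∈ P →
  (∀ r, leq r p → ¬ refutes_left r σ τ ∧ ¬ refutes_right r σ τ) → forces_eq p σ τ.
Proof.
intros Hp Href.
destruct (z_pair ZF σ τ) as [x Hx], (hTC x) as (T & HxT & HT).
assert (Hσ : σ ∈ T) by (apply (HT x); trivial; apply Hx; auto).
assert (Hτ : τ ∈ T) by (apply (HT x); trivial; apply Hx; auto).
destruct (product_ex ZF P T) as [PT HPT].
destruct (@sep2 _ _ ZF (λ u π', ∃ r π, is_opair E u r π ∧
  (forces_eq r π π' ∨ r = p ∧ π = σ ∧ π' = τ)) PT T) as (R & HR & _); [def|].
assert (HR' : ∀ r π π', rel2 E R r π π' ↔ r ∈ P ∧ π ∈ T ∧ π' ∈ T ∧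
  (forces_eq r π π' ∨ r = p ∧ π = σ ∧ π' = τ)).
{ intros r π π'; rewrite (rel2E ZF), HR, HPT; split.
  - intros ((r1 & π1 & Hr & Hπ & H1) & Hπ' & r2 & π2 & H2 & H).
    apply pr_inj in H1; apply (opairE ZF), pr_inj in H2.
    destruct H1 as [-> ->], H2 as [-> ->]; auto.
  - intros (Hr & Hπ & Hπ' & H); repeat split; eauto.
    exists r, π; split; trivial; apply pr_is. }
assert (Hgo : ∀ r, leq r p →
  (∀ π q, el σ π q → leq r q →
     ∃ s, leq s r ∧ ∃ π' q', el τ π' q' ∧ leq s q' ∧ rel2 E R s π π') ∧
  (∀ π' q', el τ π' q' → leq r q' →
     ∃ s, leq s r ∧ ∃ π q, el σ π q ∧ leq s q ∧ rel2 E R s π π')).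
{ intros r Hr; destruct (Href r Hr) as [Hl Hrr]; split.
  - intros π q Hπ Hrq; apply NNPP; intros Hn; apply Hl; exists π, q.
    repeat split; trivial; try apply Hπ; try apply Hrq.
    intros s π' q' Hs Hπ' Hsq Hf; apply Hn; exists s; split; trivial.
    exists π', q'; repeat split; try apply Hπ'; try apply Hsq.
    apply HR'; split; [apply Hs|]; split; [apply (pair_trans HT Hσ (proj2 Hπ))|].
    split; [apply (pair_trans HT Hτ (proj2 Hπ'))|auto].
  - intros π' q' Hπ' Hrq; apply NNPP; intros Hn; apply Hrr; exists π', q'.
    repeat split; trivial; try apply Hπ'; try apply Hrq.
    intros s π q Hs Hπ Hsq Hf; apply Hn; exists s; split; trivial.
    exists π, q; repeat split; try apply Hπ; try apply Hsq.
    apply HR'; split; [apply Hs|]; split; [apply (pair_trans HT Hσ (proj2 Hπ))|].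
    split; [apply (pair_trans HT Hτ (proj2 Hπ'))|auto]. }
exists R, p; split; [|split; [now apply leq_refl|apply HR'; repeat split; auto]].
intros r π π' H; apply HR' in H; destruct H as (Hr & Hπ & Hπ' & [H|(-> & -> & ->)]).
(* A triple that was already forced: the matches provided by its own bisimulation [R0] are forced
   equalities, and their names stay in [T]. *)
- destruct H as (R0 & r0 & HR0 & Hr0 & H0); destruct (HR0 _ _ _ H0) as [H1 H2].
  assert (HRR : ∀ s ρ ρ', s ∈ P → rel2 E R0 s ρ ρ' → ρ ∈ T → ρ' ∈ T → rel2 E R s ρ ρ').
  { intros s ρ ρ' Hs H Hρ Hρ'; apply HR'; repeat split; trivial; left.
    exists R0, s; split; [exact HR0|split; [now apply leq_refl|exact H]]. }
  split.
  + intros ρ q s Hρ Hsr Hsq.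
    destruct (H1 ρ q s) as (t & Ht & ρ' & q' & Hρ' & Htq & HtR); trivial;
      [now apply leq_trans with r|].
    exists t; split; trivial; exists ρ', q'; repeat split; try apply Hρ'; try apply Htq.
    apply HRR; trivial; [apply Ht|apply (pair_trans HT Hπ (proj2 Hρ))|apply (pair_trans HT Hπ' (proj2 Hρ'))].
  + intros ρ' q' s Hρ' Hsr Hsq.
    destruct (H2 ρ' q' s) as (t & Ht & ρ & q & Hρ & Htq & HtR); trivial;
      [now apply leq_trans with r|].
    exists t; split; trivial; exists ρ, q; repeat split; try apply Hρ; try apply Htq.
    apply HRR; trivial; [apply Ht|apply (pair_trans HT Hπ (proj2 Hρ))|apply (pair_trans HT Hπ' (proj2 Hρ'))].
- split; intros ρ q s Hρ Hs; [apply (proj1 (Hgo s Hs))|apply (proj2 (Hgo s Hs))]; trivial.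
Qed.

(** Conditions that force or refute the equality are dense, so [G] contains one. A refutation in [G]
    conflicts with the equality of the values, since the induction hypothesis forces the equality of
    members it excludes. *)
Lemma forces_eq_complete σ : ∀ τ, V σ = V τ → ∃ p, G p ∧ forces_eq p σ τ.
Proof.
induction (dom_wf σ) as [σ _ IH]; intros τ Hst.
destruct (@generic_dense (λ p, forces_eq p σ τ ∨ refutes_left p σ τ ∨
  refutes_right p σ τ)) as (p & Hp & [H|[H|H]]); [unfold refutes_left, refutes_right, leq, el; def|..].
- intros p Hp.
  destruct (classic (∃ r, leq r p ∧ (refutes_left r σ τ ∨ refutes_right r σ τ)))
    as [(r & Hr & H)|H]; [exists r; tauto|].
  exists p; split; [now apply leq_refl|left].
  apply forces_eq_or_refutes; trivial; intros r Hr; split; intros H'; apply H; eauto.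
- eauto.
- exfalso; destruct H as (π & q & Hπ & Hpq & H).
  assert (Hz : mem (V π) (V τ)).
  { rewrite <- Hst; apply hV; exists π, q; repeat split; try apply Hπ.
    now apply hGup with p. }
  apply hV in Hz; destruct Hz as (π' & q' & Hπ' & Hq' & Heq).
  destruct (IH π (ex_intro _ q (proj2 Hπ)) π' Heq) as (p' & Hp' & Hf).
  destruct (hGdir Hp Hp') as (r & Hr & Hrp & Hrp'), (hGdir Hr Hq') as (s & Hs & Hsr & Hsq).
  apply (H s π' q'); trivial; [now apply leq_trans with r|].
  apply forces_eq_mono with p'; trivial; now apply leq_trans with r.
- exfalso; destruct H as (π' & q' & Hπ' & Hpq & H).
  assert (Hz : mem (V π') (V σ)).
  { rewrite Hst; apply hV; exists π', q'; repeat split; try apply Hπ'.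
    now apply hGup with p. }
  apply hV in Hz; destruct Hz as (π & q & Hπ & Hq & Heq); symmetry in Heq.
  destruct (IH π (ex_intro _ q (proj2 Hπ)) π' Heq) as (p' & Hp' & Hf).
  destruct (hGdir Hp Hp') as (r & Hr & Hrp & Hrp'), (hGdir Hr Hq) as (s & Hs & Hsr & Hsq).
  apply (H s π q); trivial; [now apply leq_trans with r|].
  apply forces_eq_mono with p'; trivial; now apply leq_trans with r.
Qed.

(** * Names and the forcing relation for formulas *)

Inductive name (τ : S) : Prop :=
  Name : (∀ w, w ∈ τ → ∃ π p, is_opair E w π p ∧ name π ∧ p ∈ P) → name τ.

Definition hereditary (T : S) : Prop := ∀ σ, σ ∈ T → ∀ π q, rel E σ π q → π ∈ T.

(** The hereditary closure of τ consists of names: an element other than τ lies in the closure of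
    some π in the domain of τ, for τ together with these closures is already hereditary. *)
Lemma name_hereditary τ : name τ → ∀ σ,
  (∀ T, τ ∈ T → hereditary T → σ ∈ T) → name σ.
Proof.
induction (dom_wf τ) as [τ _ IH]; intros Hτ σ Hσ.
destruct (classic (σ = τ)) as [->|Hne]; trivial.
destruct (classic (∃ π q, rel E τ π q ∧ ∀ T, π ∈ T → hereditary T → σ ∈ T))
  as [(π & q & Hπ & Hσπ)|Hn].
{ apply (IH π); [now exists q| |trivial].
  destruct Hτ as [Hτ], Hπ as (w & Hw & H), (Hτ w H) as (π' & p & Hw' & Hn & _).
  destruct (opair_inj Hw Hw') as [e _]; now rewrite e. }
exfalso; destruct (hTC τ) as (U & HτU & HU).
destruct (@sep _ _ ZF (λ ρ, ρ = τ ∨ ∃ π q, rel E τ π q ∧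
  ∀ T, π ∈ T → hereditary T → ρ ∈ T) U) as [T HT]; [unfold hereditary; def|].
assert (H : σ ∈ T).
{ apply Hσ; [apply HT; auto|].
  intros ρ Hρ π q Hπ; apply HT in Hρ; destruct Hρ as [HρU Hρ].
  apply HT; split; [now apply (pair_trans HU HρU Hπ)|right].
  destruct Hρ as [->|(π' & q' & Hπ' & H)].
  - exists π, q; split; trivial.
  - exists π', q'; split; trivial; intros T' H1 H2; apply (H2 ρ) with q; auto. }
apply HT in H; destruct H as [_ [H|(π & q & Hπ & H)]]; [easy|].
apply Hn; eauto.
Qed.

(** The inductive predicate is replaced by membership in some set closed under passing to subnames;
    well-foundedness makes the two agree. *)
Lemma Def_name : Def E (λ e, name (e 0)).
Proof.
apply Def_ext with (λ e, ∃ T, e 0 ∈ T ∧ ∀ σ, σ ∈ T → ∀ w, w ∈ σ →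
  ∃ π p, is_opair E w π p ∧ π ∈ T ∧ p ∈ P); [|def].
intros e; generalize (e 0); clear e; intros τ; split.
- intros (T & Hτ & HT); revert Hτ; induction (dom_wf τ) as [τ _ IH]; intros Hτ.
  constructor; intros w Hw; destruct (HT τ Hτ w Hw) as (π & p & Hwp & Hπ & Hp).
  exists π, p; repeat split; trivial; apply IH; trivial; exists p, w; auto.
- intros Hτ; destruct (hTC τ) as (U & HτU & HU).
  destruct (@sep _ _ ZF (λ σ, ∀ T, τ ∈ T → hereditary T → σ ∈ T) U) as [T HT];
    [unfold hereditary; def|].
  exists T; split; [apply HT; auto|].
  intros σ Hσ w Hw; apply HT in Hσ; destruct Hσ as [HσU Hσ].
  destruct (name_hereditary Hτ Hσ) as [Hn], (Hn w Hw) as (π & p & Hwp & _ & Hp).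
  exists π, p; repeat split; trivial; apply HT.
  assert (Hπ : rel E σ π p) by (exists w; auto).
  split; [now apply (pair_trans HU HσU Hπ)|].
  intros T' H1 H2; apply (H2 σ) with p; auto.
Qed.

Hint Resolve Def_name : defs.

Lemma name_el τ π q : name τ → rel E τ π q → name π ∧ el τ π q.
Proof.
intros [H] Hπ; pose proof Hπ as (w & Hw & Hwτ).
destruct (H w Hwτ) as (π' & p & Hw' & Hn & Hp); destruct (opair_inj Hw Hw') as [e1 e2].
subst π' p; split; [exact Hn|now split].
Qed.

Lemma name_ex (Q : S → S → Prop) A : Def E (λ e, Q (e 0) (e 1)) →
  (∀ π, π ∈ A → name π) →
  ∃ θ, name θ ∧ (∀ π p, el θ π p ↔ π ∈ A ∧ p ∈ P ∧ Q π p) ∧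
    ∀ w, w ∈ θ → ∃ π p, π ∈ A ∧ p ∈ P ∧ w = pr ZF π p.
Proof.
intros HQ HA; destruct (sep2 ZF A P HQ) as (θ & H1 & H2); exists θ; split; [|split; trivial].
- constructor; intros w Hw; destruct (H2 w Hw) as (π & p & Hπ & Hp & ->).
  exists π, p; split; [apply pr_is|auto].
- intros π p; unfold el; rewrite (relE ZF), H1; tauto.
Qed.

Definition forces_mem (p σ τ : S) : Prop :=
  ∃ π q, el τ π q ∧ leq p q ∧ forces_eq p σ π.

(** A strong form of forcing: membership asks for a witness at [p] itself, while implication and
    quantifier ask for density below [p]. It suffices that truth means being forced by some
    condition in [G]. *)
Fixpoint forces (φ : formula) (p : S) (ν : nat → S) : Prop :=
  match φ with
  | FMem i j => forces_mem p (ν i) (ν j)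
  | FEq i j => forces_eq p (ν i) (ν j)
  | FFalse => False
  | FImp φ ψ => ∀ q, leq q p → forces φ q ν → ∃ r, leq r q ∧ forces ψ r ν
  | FAll φ => ∀ σ, name σ → ∀ q, leq q p → ∃ r, leq r q ∧ forces φ r (scons σ ν)
  end.

Lemma Def_forces φ : Def E (λ e, forces φ (e 0) (λ n, e (Datatypes.S n))).
Proof.
induction φ as [i j|i j| |φ IH1 ψ IH2|φ IH]; cbn [forces].
- unfold forces_mem, el, leq; def.
- def.
- def.
- unfold leq; refine (Def_all _); refine (Def_imp _ _); [def|refine (Def_imp _ _)].
  (* Under the quantifier, [e 0] is the new condition and [e 1] the old one, so the assignment
     starts at index 2; each further binder shifts it by one. *)
  + refine (Def_subst (u := λ e n, match n with 0 => e 0 | Datatypes.S n => e (2 + n) end)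
      _ IH1); intros [|n]; tm.
  + refine (Def_ex _); refine (Def_and _ _); [def|].
    refine (Def_subst (u := λ e n, match n with 0 => e 0 | Datatypes.S n => e (3 + n) end)
      _ IH2); intros [|n]; tm.
- unfold leq; refine (Def_all _); refine (Def_imp _ _); [def|].
  refine (Def_all _); refine (Def_imp _ _); [def|].
  refine (Def_ex _); refine (Def_and _ _); [def|].
  apply Def_ext with (λ e, forces φ (e 0) (λ n, match n with 0 => e 2 | Datatypes.S n => e (4 + n) end)).
  { intros e; match goal with |- forces φ _ ?u ↔ forces φ _ ?v => replace v with u end;
      [tauto|apply functional_extensionality; now intros [|n]]. }
  refine (Def_subst (u := λ e n, match n with 0 => e 0 | 1 => e 2 | Datatypes.S (Datatypes.S n) => e (4 + n) end)
      _ IH); intros [|[|n]]; tm.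
Qed.

Lemma forces_mono φ : ∀ p q ν, leq q p → forces φ p ν → forces φ q ν.
Proof.
induction φ as [i j|i j| |φ IH1 ψ IH2|φ IH]; cbn [forces]; intros p q ν Hqp H; trivial.
- destruct H as (π & r & Hπ & Hr & H); exists π, r; repeat split; try apply Hπ;
    try now apply (leq_trans Hqp Hr).
  now apply forces_eq_mono with p.
- now apply forces_eq_mono with p.
- intros r Hr; apply H; now apply leq_trans with q.
- intros σ Hσ r Hr; apply H; trivial; now apply leq_trans with q.
Qed.

Lemma Def_forces_at φ t u : Tm t → (∀ n, Tm (λ e, u e n)) →
  Def E (λ e, forces φ (t e) (u e)).
Proof.
intros Ht Hu.
refine (Def_subst (u := λ e n, match n with 0 => t e | Datatypes.S n => u e n end)
  _ (Def_forces φ)); now intros [|n].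
Qed.

Variables (T : Type) (ev : T → set).
Let ET (x y : T) : Prop := mem (ev x) (ev y).

Hypothesis ev_inj : ∀ x y, ev x = ev y → x = y.
Hypothesis ev_name : ∀ x, ∃ τ, name τ ∧ ev x = V τ.
Hypothesis name_ev : ∀ τ, name τ → ∃ x, ev x = V τ.

Definition named (ρ : nat → T) (ν : nat → S) : Prop :=
  ∀ n, name (ν n) ∧ ev (ρ n) = V (ν n).

Lemma named_scons ρ ν x σ : named ρ ν → name σ → ev x = V σ →
  named (scons x ρ) (scons σ ν).
Proof. intros H H1 H2 [|n]; [now split|apply H]. Qed.

(** In the implication and quantifier steps, the conditions that force the formula or carry a
    counterexample to it are dense; a counterexample in [G] contradicts truth by the induction
    hypothesis. *)
Theorem forcing_theorem φ : ∀ ρ ν, named ρ ν →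
  sat ET ρ φ ↔ ∃ p, G p ∧ forces φ p ν.
Proof.
induction φ as [i j|i j| |φ IH1 ψ IH2|φ IH]; intros ρ ν Hν; cbn [sat forces].
- unfold ET; destruct (Hν i) as [_ ->], (Hν j) as [_ ->]; split.
  + intros H; apply hV in H; destruct H as (π & q & Hπ & Hq & H).
    destruct (forces_eq_complete H) as (p & Hp & Hf), (hGdir Hp Hq) as (r & Hr & Hrp & Hrq).
    exists r; split; trivial; exists π, q; split; trivial; split; trivial.
    now apply forces_eq_mono with p.
  + intros (p & Hp & π & q & Hπ & Hpq & H); apply hV; exists π, q; split; trivial.
    split; [now apply hGup with p|now apply forces_eq_sound with p].
- assert (H : ρ i = ρ j ↔ V (ν i) = V (ν j)).
  { destruct (Hν i) as [_ <-], (Hν j) as [_ <-]; split; [congruence|apply ev_inj]. }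
  rewrite H; split; [apply forces_eq_complete|].
  intros (p & Hp & Hf); now apply forces_eq_sound with p.
- split; [tauto|intros (p & _ & [])].
- rewrite (IH1 ρ ν Hν), (IH2 ρ ν Hν); split.
  + intros H.
    destruct (@generic_dense (λ p, (∀ q, leq q p → forces φ q ν → ∃ r, leq r q ∧ forces ψ r ν) ∨
      forces φ p ν ∧ ∀ r, leq r p → ¬ forces ψ r ν)) as (p & Hp & [Hf|[H1 H2]]).
    * unfold leq; refine (Def_or _ _); [refine (Def_all _); refine (Def_imp _ _); [def|];
        refine (Def_imp _ _); [apply Def_forces_at; intros; tm|];
        refine (Def_ex _); refine (Def_and _ _); [def|]
       |refine (Def_and _ _); [|refine (Def_all _); refine (Def_imp _ _); [def|];
        refine (Def_not _)]]; apply Def_forces_at; intros; tm.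
    * intros p Hp.
      destruct (classic (∃ q, leq q p ∧ forces φ q ν ∧ ∀ r, leq r q → ¬ forces ψ r ν))
        as [(q & Hq & Hq')|Hn]; [exists q; auto|].
      exists p; split; [now apply leq_refl|left]; intros q Hq Hf.
      apply NNPP; intros Hn'; apply Hn; exists q; split; trivial; split; trivial.
      intros r Hr Hr'; apply Hn'; eauto.
    * eauto.
    * exfalso; destruct H as (q & Hq & Hf); [eauto|].
      destruct (hGdir Hp Hq) as (r & _ & Hrp & Hrq); apply (H2 r); trivial.
      now apply forces_mono with q.
  + intros (p & Hp & H) (q & Hq & Hf); destruct (hGdir Hp Hq) as (r & Hr & Hrp & Hrq).
    apply (@generic_below (λ s, forces ψ s ν) r); trivial.
    * apply Def_forces_at; intros; tm.
    * intros s Hs; apply H; [now apply leq_trans with r|].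
      apply forces_mono with q; trivial; now apply leq_trans with r.
- split.
  + intros H.
    destruct (@generic_dense (λ p,
      (∀ σ, name σ → ∀ q, leq q p → ∃ r, leq r q ∧ forces φ r (scons σ ν)) ∨
      ∃ σ, name σ ∧ ∀ r, leq r p → ¬ forces φ r (scons σ ν))) as (p & Hp & [Hf|(σ & Hσ & Hf)]).
    * unfold leq; refine (Def_or _ _).
      -- refine (Def_all _); refine (Def_imp _ _); [def|].
         refine (Def_all _); refine (Def_imp _ _); [def|].
         refine (Def_ex _); refine (Def_and _ _); [def|].
         apply Def_forces_at; [tm|intros [|n]; tm].
      -- refine (Def_ex _); refine (Def_and _ _); [def|].
         refine (Def_all _); refine (Def_imp _ _); [def|refine (Def_not _)].
         apply Def_forces_at; [tm|intros [|n]; tm].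
    * intros p Hp.
      destruct (classic (∃ q, leq q p ∧ ∃ σ, name σ ∧
        ∀ r, leq r q → ¬ forces φ r (scons σ ν))) as [(q & Hq & Hq')|Hn]; [exists q; auto|].
      exists p; split; [now apply leq_refl|left]; intros σ Hσ q Hq.
      apply NNPP; intros Hn'; apply Hn; exists q; split; trivial; exists σ; split; trivial.
      intros r Hr Hr'; apply Hn'; eauto.
    * eauto.
    * exfalso; destruct (name_ev Hσ) as [x Hx].
      destruct (proj1 (IH _ _ (named_scons Hν Hσ Hx)) (H x)) as (q & Hq & Hq').
      destruct (hGdir Hp Hq) as (r & _ & Hrp & Hrq); apply (Hf r); trivial.
      now apply forces_mono with q.
  + intros (p & Hp & H) x; destruct (ev_name x) as (σ & Hσ & Hx).
    apply (IH _ _ (named_scons Hν Hσ Hx)).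
    apply (@generic_below (λ s, forces φ s (scons σ ν)) p); trivial; [|auto].
    apply Def_forces_at; intros; tm.
Qed.

(** * Axioms and well-orderings in the extension *)

Lemma mem_ev x τ : ev x = V τ → name τ → ∀ y, ET y x ↔
  ∃ π q, el τ π q ∧ G q ∧ name π ∧ ev y = V π.
Proof.
intros Hx Hτ y; unfold ET; rewrite Hx, hV; split.
- intros (π & q & Hπ & Hq & H); exists π, q; repeat split; try apply Hπ; trivial.
  now apply (name_el Hτ (proj2 Hπ)).
- intros (π & q & Hπ & Hq & _ & H); eauto.
Qed.

Lemma name_domain τ : name τ → ∃ D, (∀ π, π ∈ D → name π) ∧ ∀ π q, el τ π q → π ∈ D.
Proof.
intros Hτ; destruct (hTC τ) as (U & HτU & HU).
destruct (@sep _ _ ZF (λ π, ∃ q, rel E τ π q) U) as [D HD]; [def|].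
exists D; split.
- intros π Hπ; apply HD in Hπ; destruct Hπ as (_ & q & Hπ); now apply (name_el Hτ Hπ).
- intros π q [_ Hπ]; apply HD; split; [now apply (pair_trans HU HτU Hπ)|eauto].
Qed.

(** The name collects the pairs [(π, p)] such that [p] puts π into τ and forces φ of π. That it lies
    within D × P is what later bounds the names needed for power sets. *)
Lemma separation_name φ (ρ : nat → T) τ D : name τ → (∀ π, π ∈ D → name π) →
  (∀ π q, el τ π q → π ∈ D) →
  ∃ θ, name θ ∧ (∀ w, w ∈ θ → ∃ π p, π ∈ D ∧ p ∈ P ∧ w = pr ZF π p) ∧
    ∀ x, mem (ev x) (V θ) ↔ mem (ev x) (V τ) ∧ sat ET (scons x ρ) φ.
Proof.
intros Hτ HD HτD.
assert (Hν : ∃ ν, named ρ ν).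
{ exists (λ n, proj1_sig (constructive_indefinite_description _ (ev_name (ρ n)))).
  intros n; exact (proj2_sig (constructive_indefinite_description _ (ev_name (ρ n)))). }
destruct Hν as [ν Hν].
destruct (@name_ex (λ π p, (∃ q, el τ π q ∧ leq p q) ∧ forces φ p (scons π ν)) D)
  as (θ & Hθ & Hel & HθD); trivial.
{ refine (Def_and _ _); [unfold el, leq; def|].
  apply Def_forces_at; [tm|intros [|n]; tm]. }
exists θ; split; [|split]; trivial; intros x; rewrite !hV; split.
- intros (π & p & Hπ & Hp & Hx); apply Hel in Hπ.
  destruct Hπ as (HπD & HpP & (q & Hπ & Hpq) & Hf); split.
  + exists π, q; split; trivial; split; trivial; now apply hGup with p.
  + apply (forcing_theorem φ (named_scons Hν (HD π HπD) Hx)); eauto.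
- intros [(π & q & Hπ & Hq & Hx) Hs].
  pose proof (name_el Hτ (proj2 Hπ)) as [Hn _].
  apply (forcing_theorem φ (named_scons Hν Hn Hx)) in Hs; destruct Hs as (p & Hp & Hf).
  destruct (hGdir Hp Hq) as (r & Hr & Hrp & Hrq); exists π, r.
  split; [|auto]; apply Hel; split; [eauto|]; split; [auto|].
  split; [eauto|now apply forces_mono with p].
Qed.

(** Each axiom is witnessed by an explicit name. A set [A] of names gives the name A × P, whose
    value consists of the values of all members of [A] because [G] is nonempty. *)
Lemma extension_zermelo : Zermelo ET.
Proof.
assert (Hext : ∀ x y, (∀ z, ET z x ↔ ET z y) → x = y).
{ intros x y H; apply ev_inj, set_ext; intros z.
  destruct (ev_name x) as (τ & Hτ & Hx), (ev_name y) as (τ' & Hτ' & Hy).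
  split; intros Hz.
  - assert (Hz' : ∃ z', ev z' = z).
    { rewrite Hx in Hz; apply hV in Hz; destruct Hz as (π & q & Hπ & _ & ->).
      apply name_ev, (name_el Hτ (proj2 Hπ)). }
    destruct Hz' as [z' <-]; now apply H.
  - assert (Hz' : ∃ z', ev z' = z).
    { rewrite Hy in Hz; apply hV in Hz; destruct Hz as (π & q & Hπ & _ & ->).
      apply name_ev, (name_el Hτ' (proj2 Hπ)). }
    destruct Hz' as [z' <-]; now apply H. }
constructor; trivial.
- destruct (empty_ex ZF) as [o Ho].
  destruct (@name_ev o) as [x _]; [|now constructor].
  constructor; intros w Hw; destruct (Ho w Hw).
- apply (wf_inverse_image _ _ mem ev), set_wf.
- intros a b; destruct (ev_name a) as (τ & Hτ & Ha), (ev_name b) as (τ' & Hτ' & Hb).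
  destruct (z_pair ZF τ τ') as [A HA]; unfold is_upair in HA.
  destruct (@name_ex (λ _ _, True) A) as (θ & Hθ & Hel & _); [def| |].
  { intros π Hπ; apply HA in Hπ; destruct Hπ as [-> | ->]; trivial. }
  destruct (name_ev Hθ) as [z Hz]; exists z; intros w; rewrite (mem_ev Hz Hθ); split.
  + intros (π & q & Hπ & Hq & _ & Hw); apply Hel in Hπ; destruct Hπ as [Hπ _].
    apply HA in Hπ; destruct Hπ as [-> | ->]; [left|right]; apply ev_inj; congruence.
  + destruct hGne as [p Hp]; intros [-> | ->]; [exists τ, p|exists τ', p];
      rewrite Hel, HA; auto.
- intros x; destruct (ev_name x) as (τ & Hτ & Hx), (hTC τ) as (U & HτU & HU).
  destruct (@sep _ _ ZF name U) as [A HA]; [def|].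
  destruct (@name_ex (λ ρ p, ∃ π q q', el τ π q ∧ el π ρ q' ∧ leq p q ∧ leq p q') A)
    as (θ & Hθ & Hel & _); [unfold el, leq; def|intros π Hπ; now apply HA in Hπ|].
  destruct (name_ev Hθ) as [u Hu]; exists u; intros z; rewrite (mem_ev Hu Hθ); split.
  + intros (ρ & p & Hρ & Hp & Hn & Hz); apply Hel in Hρ.
    destruct Hρ as (_ & _ & π & q & q' & Hπ & Hρ & Hpq & Hpq').
    destruct (name_el Hτ (proj2 Hπ)) as [Hnπ _], (name_ev Hnπ) as [y Hy].
    exists y; rewrite (mem_ev Hx Hτ), (mem_ev Hy Hnπ); split; eauto 8.
  + intros (y & Hyx & Hzy); apply (mem_ev Hx Hτ) in Hyx.
    destruct Hyx as (π & q & Hπ & Hq & Hnπ & Hy); apply (mem_ev Hy Hnπ) in Hzy.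
    destruct Hzy as (ρ & q' & Hρ & Hq' & Hnρ & Hz).
    destruct (hGdir Hq Hq') as (r & Hr & Hrq & Hrq').
    exists ρ, r; rewrite Hel, HA; split; [|auto].
    split; [split; trivial; apply (pair_trans HU (pair_trans HU HτU (proj2 Hπ)) (proj2 Hρ))|].
    split; [auto|exists π, q, q'; auto].
- intros x; destruct (ev_name x) as (τ & Hτ & Hx), (name_domain Hτ) as (D & HD & HτD).
  destruct (product_ex ZF D P) as [DP HDP], (z_power ZF DP) as [PDP HPDP].
  destruct (@sep _ _ ZF (λ σ, (∀ w, w ∈ σ → w ∈ DP) ∧ name σ) PDP) as [A HA]; [def|].
  destruct (@name_ex (λ _ _, True) A) as (θ & Hθ & Hel & _);
    [def|intros σ Hσ; now apply HA in Hσ|].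
  destruct (name_ev Hθ) as [p0 Hp0].
  (* A subset [y] of [x] equals the set of z in x with z in y, so [separation_name] gives it a name
     inside D × P, that is, a member of [A]. *)
  assert (Hsub : ∀ y, (∀ z, ET z y → ET z x) → ET y p0).
  { intros y Hy; destruct (ev_name y) as (σ & Hσ & Hyσ).
    destruct (@separation_name (FMem 0 1) (λ _, y) τ D) as (σ' & Hσ' & HσD & Hmem); trivial.
    assert (Hyσ' : ev y = V σ').
    { apply set_ext; intros z; split; intros Hz.
      - assert (Hz' : ∃ z', ev z' = z).
        { rewrite Hyσ in Hz; apply hV in Hz; destruct Hz as (π & q & Hπ & _ & ->).
          apply name_ev, (name_el Hσ (proj2 Hπ)). }
        destruct Hz' as [z' <-]; apply Hmem; split; [|exact Hz].
        rewrite <- Hx; now apply Hy.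
      - assert (Hz' : ∃ z', ev z' = z).
        { apply hV in Hz; destruct Hz as (π & q & Hπ & _ & ->).
          apply name_ev, (name_el Hσ' (proj2 Hπ)). }
        destruct Hz' as [z' <-]; now apply Hmem in Hz. }
    apply (mem_ev Hp0 Hθ); destruct hGne as [p Hp]; exists σ', p; rewrite Hel, HA, HPDP.
    assert (Hw : ∀ w, w ∈ σ' → w ∈ DP).
    { intros w Hw; destruct (HσD w Hw) as (π & q & Hπ & Hq & ->); apply HDP; eauto. }
    split; [split; [split; [exact Hw|split; trivial]|auto]|auto]. }
  (* The value of θ may also contain sets that are not subsets of [x]; they are removed by
     separation. Under the binder, index 1 is the tested set and index 2 is [x]. *)
  destruct (@separation_name (FAll (FImp (FMem 0 1) (FMem 0 2))) (λ _, x) θ A)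
    as (θ' & Hθ' & _ & Hmem); trivial;
    [intros σ Hσ; now apply HA in Hσ|intros π q Hπ; now apply Hel in Hπ|].
  destruct (name_ev Hθ') as [p1 Hp1]; exists p1; intros y.
  unfold ET at 1; rewrite Hp1, Hmem, <- Hp0; simpl; split; [tauto|].
  intros H; split; [now apply Hsub|exact H].
- intros φ ρ a; destruct (ev_name a) as (τ & Hτ & Ha).
  destruct (name_domain Hτ) as (D & HD & HτD).
  destruct (separation_name φ ρ Hτ HD HτD) as (θ & Hθ & _ & Hmem).
  destruct (name_ev Hθ) as [b Hb]; exists b; intros x; unfold ET at 1 2.
  rewrite Hb, Ha; apply Hmem.
Qed.

(** The values of the initial segments of a well-ordered set of names form a
    chain in the extension, from which the order is recovered. *)
Lemma extension_orderable : orderable E → orderable ET.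
Proof.
intros Hord X; pose proof extension_zermelo as ZT.
destruct (ev_name X) as (τ & Hτ & HX), (name_domain Hτ) as (D & HD & HτD).
destruct (Hord D) as (R & HR1 & HR2 & HR3).
destruct (product_ex ZF D P) as [DP HDP], (z_power ZF DP) as [PDP HPDP].
(* The members of [A] are the names (initial segment of [D] below σ) × P; their values are the links
   of the chain [W]. *)
destruct (@sep _ _ ZF (λ s, ∃ σ, σ ∈ D ∧ ∀ w, w ∈ s ↔ ∃ π q, is_opair E w π q ∧
  π ∈ D ∧ q ∈ P ∧ rel E R π σ) PDP) as [A HA]; [def|].
assert (HAn : ∀ s, s ∈ A → name s).
{ intros s Hs; apply HA in Hs; destruct Hs as (_ & σ & _ & Hs).
  constructor; intros w Hw; apply Hs in Hw; destruct Hw as (π & q & Hw & Hπ & Hq & _).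
  exists π, q; auto. }
destruct (@name_ex (λ _ _, True) A) as (θ & Hθ & Hel & _); [def|exact HAn|].
destruct (name_ev Hθ) as [W HW].
set (before := λ x σ, ∃ π, π ∈ D ∧ rel E R π σ ∧ ev x = V π).
(* An element may have several names in [D]; the first one along [R] decides its place. *)
set (least := λ x σ, σ ∈ D ∧ ev x = V σ ∧ ¬ before x σ).
(* The left side mentions only [W], so it is definable in the extension, where neither [R] nor the
   evaluation need be available. *)
assert (Hseg : ∀ x y, (∃ w, ET w W ∧ ET x w ∧ ¬ ET y w) ↔
  ∃ σ, σ ∈ D ∧ before x σ ∧ ¬ before y σ).
{ assert (Hs : ∀ s σ w, s ∈ A → (∀ w, w ∈ s ↔ ∃ π q, is_opair E w π q ∧
    π ∈ D ∧ q ∈ P ∧ rel E R π σ) → ev w = V s → ∀ x, ET x w ↔ before x σ).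
  { intros s σ w HsA Hs Hw x; rewrite (mem_ev Hw (HAn s HsA)); split.
    - intros (π & q & [_ (u & Hu & Hus)] & _ & _ & Hx); apply Hs in Hus.
      destruct Hus as (π' & q' & Hu' & Hπ' & _ & HR); destruct (opair_inj Hu Hu') as [e _].
      subst π'; exists π; auto.
    - intros (π & Hπ & HR & Hx); destruct hGne as [q Hq]; exists π, q.
      assert (Hel' : el s π q).
      { split; [auto|]; apply (relE ZF), Hs; exists π, q; split; [apply pr_is|auto]. }
      auto. }
  intros x y; split.
  - intros (w & Hw & Hx & Hy); apply (mem_ev HW Hθ) in Hw.
    destruct Hw as (s & q & Hsq & _ & _ & Hw); apply Hel in Hsq; destruct Hsq as [HsA _].
    pose proof HsA as HsA'; apply HA in HsA'; destruct HsA' as (_ & σ & Hσ & Hsσ).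
    exists σ; rewrite <- (Hs s σ w HsA Hsσ Hw x), <- (Hs s σ w HsA Hsσ Hw y); auto.
  - intros (σ & Hσ & Hx & Hy).
    destruct (@sep _ _ ZF (λ w, ∃ π q, is_opair E w π q ∧ π ∈ D ∧ q ∈ P ∧ rel E R π σ) DP)
      as [s Hsep]; [def|].
    assert (Hsσ : ∀ w, w ∈ s ↔ ∃ π q, is_opair E w π q ∧ π ∈ D ∧ q ∈ P ∧ rel E R π σ).
    { intros w; rewrite Hsep; split; [tauto|intros Hw; split; trivial].
      destruct Hw as (π & q & Hw & Hπ & Hq & _); apply HDP; exists π, q.
      rewrite <- opairE; auto. }
    assert (HsA : s ∈ A).
    { apply HA; split; [apply HPDP; intros w Hw; now apply Hsep in Hw|eauto]. }
    destruct (name_ev (HAn s HsA)) as [w Hw]; exists w; rewrite (Hs s σ w HsA Hsσ Hw x), (Hs s σ w HsA Hsσ Hw y).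
    split; auto; apply (mem_ev HW Hθ); destruct hGne as [q Hq]; exists s, q.
    rewrite Hel; auto 8. }
assert (Hleast : ∀ x, ET x X → ∃ σ, least x σ).
{ intros x Hx; apply (mem_ev HX Hτ) in Hx; destruct Hx as (σ & q & Hσ & _ & _ & Hx).
  apply HτD in Hσ; clear q; induction (HR3 σ) as [σ _ IH].
  destruct (classic (before x σ)) as [(π & Hπ & HR & Hxπ)|Hb]; [now apply (IH π)|].
  now exists σ. }
assert (Hlt : ∀ x y σ σ', least x σ → least y σ' →
  (∃ ρ, ρ ∈ D ∧ before x ρ ∧ ¬ before y ρ) ↔ rel E R σ σ').
{ intros x y σ σ' (Hσ & Hx & Hbx) (Hσ' & Hy & Hby); split.
  - intros (ρ & Hρ & (π & Hπ & HR & Hxπ) & Hyρ).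
    assert (Hσρ : rel E R σ ρ).
    { destruct (HR1 σ π Hσ Hπ) as [H|[H|H]]; [now apply HR2 with π|now subst|].
      destruct Hbx; exists π; auto. }
    destruct (HR1 ρ σ' Hρ Hσ') as [H|[H|H]]; [now apply HR2 with ρ|now subst|].
    destruct Hyρ; exists σ'; auto.
  - intros HR; exists σ'; repeat split; trivial; exists σ; auto. }
destruct (@sep2 _ _ ZT (λ x y, ∃ w, ET w W ∧ ET x w ∧ ¬ ET y w) X X) as (Q & HQ & _); [def|].
assert (HQ' : ∀ x y, rel ET Q x y ↔ ET x X ∧ ET y X ∧
  ∀ σ σ', least x σ → least y σ' → rel E R σ σ').
{ intros x y; rewrite (relE ZT), HQ, Hseg; split.
  - intros (Hx & Hy & H); repeat split; trivial; intros σ σ' H1 H2.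
    now apply (Hlt x y).
  - intros (Hx & Hy & H); repeat split; trivial.
    destruct (Hleast x Hx) as [σ H1], (Hleast y Hy) as [σ' H2].
    apply (Hlt x y σ σ'); auto. }
assert (Huniq : ∀ x σ σ', least x σ → least x σ' → σ = σ').
{ intros x σ σ' (Hσ & Hx & Hb) (Hσ' & Hx' & Hb').
  destruct (HR1 σ σ' Hσ Hσ') as [H|[H|H]]; trivial;
    [destruct Hb'; exists σ|destruct Hb; exists σ']; auto. }
exists Q; split; [|split].
- intros x y Hx Hy; destruct (Hleast x Hx) as [σ H1], (Hleast y Hy) as [σ' H2].
  rewrite !HQ'; destruct (HR1 σ σ' (proj1 H1) (proj1 H2)) as [H|[H|H]].
  + left; repeat split; trivial; intros ρ ρ' H3 H4.
    now rewrite (Huniq x ρ σ), (Huniq y ρ' σ').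
  + right; left; apply ev_inj; destruct H1 as (_ & -> & _), H2 as (_ & -> & _).
    congruence.
  + right; right; repeat split; trivial; intros ρ ρ' H3 H4.
    now rewrite (Huniq y ρ σ'), (Huniq x ρ' σ).
- intros x y z; rewrite !HQ'; intros (Hx & Hy & H) (_ & Hz & H'); repeat split; trivial.
  intros σ σ' H1 H2; destruct (Hleast y Hy) as [ρ H3]; apply HR2 with ρ; auto.
- assert (Hacc : ∀ σ x, least x σ → Acc (rel ET Q) x).
  { intros σ; induction (HR3 σ) as [σ _ IH]; intros x Hx; constructor; intros y Hy.
    apply HQ' in Hy; destruct Hy as (Hy & _ & H), (Hleast y Hy) as [ρ Hρ].
    apply (IH ρ); auto. }
  intros x; destruct (classic (ET x X)) as [Hx|Hx].
  + destruct (Hleast x Hx) as [σ Hσ]; now apply (Hacc σ).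
  + constructor; intros y Hy; apply HQ' in Hy; tauto.
Qed.

End Forcing.

(** * Consequences of replacement and choice *)

Section Replacement.

Context {S : Type} {E : S → S → Prop}.
Local Infix "∈" := E (at level 70).
Hypothesis hZFC : ZFC E.
Hypothesis hwf : well_founded E.

Lemma ZFC_zermelo : Zermelo E.
Proof.
constructor; try apply hZFC; trivial.
destruct (zfc_infinity hZFC) as [w _]; now constructor.
Qed.

Let ZF := ZFC_zermelo.

Lemma replacement (Q : S → S → Prop) a : Def E (λ e, Q (e 0) (e 1)) →
  (∀ x y y', x ∈ a → Q x y → Q x y' → y = y') →
  ∃ b, ∀ y, y ∈ b ↔ ∃ x, x ∈ a ∧ Q x y.
Proof.
intros (φ & t & Ht) HQ.
set (f := λ n, match t n with inl O => 0 | inl _ => 1 | inr _ => 2 + n end).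
set (ρ := λ n, match t n with inl _ => a | inr c => c end).
assert (Hs : ∀ x y, sat E (scons x (scons y ρ)) (ren f φ) ↔ Q x y).
{ intros x y; rewrite sat_ren.
  specialize (Ht (λ n, match n with 0 => x | _ => y end)); cbv beta iota in Ht; rewrite Ht.
  match goal with |- sat E ?r φ ↔ sat E ?s φ => replace r with s; [tauto|] end.
  apply functional_extensionality; intros n; unfold f, ρ.
  destruct (t n) as [[|i]|c] eqn:Et; simpl; rewrite ?Et; reflexivity. }
destruct (zfc_replacement hZFC (φ := ren f φ) (ρ := ρ) (a := a)) as [b Hb].
- intros x Hx y y'; rewrite !Hs; now apply HQ.
- exists b; intros y; rewrite Hb; setoid_rewrite Hs; reflexivity.
Qed.

(** Replacement needs a functional relation, so each member of [x] is assigned the least transitive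
    set containing it. *)
Lemma transitive_superset x : ∃ T, x ∈ T ∧ is_transitive E T.
Proof.
induction (hwf x) as [x _ IH].
set (Q := λ y T, y ∈ T ∧ is_transitive E T ∧
  ∀ T', y ∈ T' → is_transitive E T' → ∀ z, z ∈ T → z ∈ T').
destruct (@replacement Q x) as [B HB].
- unfold Q; def.
- intros y T T' _ (H1 & H2 & H3) (H4 & H5 & H6); apply (z_ext ZF); split; auto.
- destruct (z_union ZF B) as [U HU], (adjoin_ex ZF U x) as [T HT].
  exists T; split; [apply HT; auto|].
  intros y Hy z Hz; apply HT in Hy; apply HT; left; apply HU; destruct Hy as [Hy| ->].
  + apply HU in Hy; destruct Hy as (T' & HT' & Hy); exists T'; split; trivial.
    apply HB in HT'; destruct HT' as (w & _ & _ & HT' & _); now apply (HT' y).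
  + destruct (IH z Hz) as (T' & H1 & H2).
    destruct (@sep _ _ ZF (λ w, ∀ T'', z ∈ T'' → is_transitive E T'' → w ∈ T'') T')
      as [T0 HT0]; [def|].
    exists T0; split; [|apply HT0; auto]; apply HB; exists z; split; trivial.
    split; [apply HT0; auto|split].
    * intros w Hw v Hv; apply HT0 in Hw; destruct Hw as [Hw Hw'].
      apply HT0; split; [now apply (H2 w)|].
      intros T'' H3 H4; apply (H4 w); auto.
    * intros T'' H3 H4 w Hw; apply HT0 in Hw; destruct Hw; auto.
Qed.

(** The axiom concerns disjoint families, so [s] is replaced by {s} × s. The selector is then a
    choice function, provided its values are read only inside [s]. *)
Lemma choice_function D : ∃ c, ∀ s, (∀ d, d ∈ s → d ∈ D) → ¬ is_empty E s →
  ∃ d, d ∈ s ∧ ∀ d', d' ∈ s → rel E c s d' ↔ d' = d.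
Proof.
destruct (z_power ZF D) as [PD HPD], (product_ex ZF PD D) as [U HU], (z_power ZF U) as [PU HPU].
set (graph := λ t s, ∀ w, w ∈ t ↔ ∃ d, d ∈ s ∧ is_opair E w s d).
destruct (@sep _ _ ZF (λ t, ∃ s, s ∈ PD ∧ ¬ is_empty E s ∧ graph t s) PU) as [a Ha];
  [unfold graph; def|].
destruct (zfc_choice hZFC (a := a)) as [c Hc].
- intros t Ht He; apply Ha in Ht; destruct Ht as (_ & s & _ & Hs & Ht).
  apply Hs; intros d Hd; apply (He (pr ZF s d)), Ht; exists d; split; trivial; apply pr_is.
- intros t Ht t' Ht' Hne w [Hw Hw']; apply Hne.
  apply Ha in Ht, Ht'; destruct Ht as (_ & s & _ & _ & Ht), Ht' as (_ & s' & _ & _ & Ht').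
  apply Ht in Hw as Hw1; apply Ht' in Hw' as Hw2.
  destruct Hw1 as (d & _ & H1), Hw2 as (d' & _ & H2).
  destruct (opair_inj H1 H2) as [<- _].
  apply (z_ext ZF); intros z; now rewrite (Ht z), (Ht' z).
- exists c; intros s HsD Hs.
  destruct (@sep _ _ ZF (λ w, ∃ d, d ∈ s ∧ is_opair E w s d) U) as [t Ht]; [def|].
  assert (HtU : ∀ w, w ∈ t ↔ ∃ d, d ∈ s ∧ is_opair E w s d).
  { intros w; rewrite Ht; split; [tauto|intros H; split; trivial].
    destruct H as (d & Hd & H); apply HU; exists s, d; rewrite HPD, <- (opairE ZF); auto. }
  destruct (Hc t) as (y & [Hy Hyc] & Huniq).
  { apply Ha; split; [apply HPU; intros w Hw; now apply Ht in Hw|].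
    exists s; repeat split; trivial; try apply HtU; now apply HPD. }
  apply HtU in Hy; destruct Hy as (d & Hd & Hy); exists d; split; trivial.
  intros d' Hd'; split.
  + intros (w & Hw & Hwc).
    assert (H : y = w) by (apply Huniq; split; trivial; apply HtU; eauto).
    subst w; now destruct (opair_inj Hy Hw).
  + intros ->; now exists y.
Qed.

Theorem well_ordering : orderable E.
Proof.
intros D; destruct (choice_function D) as [c Hc].
set (chosen := λ g β d, ∀ s,
  (∀ z, z ∈ s ↔ z ∈ D ∧ ¬ ∃ γ, γ ∈ β ∧ rel E g γ z) → d ∈ s ∧ rel E c s d).
(* Enumerations of length α obeying the choice rule. They agree where both are defined and are
   injective, since the rule skips used elements. *)
set (att := λ α g, is_ordinal E α ∧ (∀ β d, rel E g β d → β ∈ α) ∧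
  (∀ β, β ∈ α → ∃ d, rel E g β d) ∧ ∀ β d, rel E g β d → chosen g β d).
assert (Hrest : ∀ g β, ∃ s, ∀ z, z ∈ s ↔ z ∈ D ∧ ¬ ∃ γ, γ ∈ β ∧ rel E g γ z).
{ intros g β; apply (sep ZF); def. }
assert (HD : ∀ g β d, chosen g β d → d ∈ D ∧ ¬ ∃ γ, γ ∈ β ∧ rel E g γ d).
{ intros g β d H; destruct (Hrest g β) as [s Hs]; now apply Hs, H. }
assert (Hchosen : ∀ g g' β d d', (∀ γ z, γ ∈ β → rel E g γ z ↔ rel E g' γ z) →
  chosen g β d → chosen g' β d' → d = d').
{ intros g g' β d d' Hg H H'; destruct (Hrest g β) as [s Hs].
  destruct (H s Hs) as [H1 H2], (H' s) as [H3 H4].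
  - intros z; rewrite Hs; split; intros [Hz Hn]; split; trivial; intros (γ & Hγ & Hz');
      apply Hn; exists γ; split; trivial; now apply Hg.
  - destruct (Hc s) as (e & _ & He); [intros z Hz; now apply Hs in Hz|now intros He; destruct (He d)|].
    apply He in H2, H4; trivial; congruence. }
assert (Hagree : ∀ β α α' g g' d d', att α g → att α' g' → rel E g β d → rel E g' β d' → d = d').
{ intros β; induction (hwf β) as [β _ IH]; intros α α' g g' d d' Ha Ha' Hd Hd'.
  apply (Hchosen g g' β); [|now apply Ha|now apply Ha'].
  pose proof Ha as (HO & H1 & H2 & _); pose proof Ha' as (HO' & H1' & H2' & _).
  intros γ z Hγ; split; intros Hz.
  - destruct (H2' γ) as [z' Hz']; [apply (ord_trans HO' Hγ); eauto|].
    now rewrite (IH γ Hγ α α' g g' z z').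
  - destruct (H2 γ) as [z' Hz']; [apply (ord_trans HO Hγ); eauto|].
    now rewrite (IH γ Hγ α' α g' g z z'). }
assert (Hinj : ∀ α g β γ d, att α g → rel E g β d → rel E g γ d → β = γ).
{ intros α g β γ d (HO & H1 & _ & H2) Hβ Hγ.
  destruct (ord_trichotomy ZF (ord_mem HO (H1 _ _ Hβ)) (ord_mem HO (H1 _ _ Hγ)))
    as [H|[H|H]]; trivial; exfalso.
  - apply (HD g γ d (H2 _ _ Hγ)); eauto.
  - apply (HD g β d (H2 _ _ Hβ)); eauto. }
assert (Hsurj : ∃ α g, att α g ∧ ∀ d, d ∈ D → ∃ β, rel E g β d).
{ apply NNPP; intros Hn.
  assert (Hext : ∀ β g, att β g → ∃ β' g' d, is_succ E β' β ∧ att β' g' ∧ rel E g' β d).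
  { intros β g Hg; pose proof Hg as (HO & H1 & H2 & H3).
    destruct (Hrest g β) as [s Hs].
    destruct (Hc s) as (d & Hd & Hd').
    - intros z Hz; now apply Hs in Hz.
    - intros He; apply Hn; exists β, g; split; trivial; intros d Hd.
      apply NNPP; intros Hd'; apply (He d), Hs; split; trivial.
      intros (γ & _ & Hγ); apply Hd'; now exists γ.
    - destruct (adjoin_ex ZF β β) as [β' Hβ'], (adjoin_ex ZF g (pr ZF β d)) as [g' Hg'].
      assert (Hr : ∀ γ z, rel E g' γ z ↔ rel E g γ z ∨ γ = β ∧ z = d).
      { intros γ z; now rewrite !(relE ZF), Hg', pr_eq. }
      assert (Hr' : ∀ γ z, γ ∈ β → rel E g' γ z ↔ rel E g γ z).
      { intros γ z Hγ; rewrite Hr; split; [intros [H|[-> _]]; trivial|auto].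
        destruct (mem_irrefl ZF Hγ). }
      assert (Hch : ∀ γ z, (γ ∈ β ∨ γ = β) → chosen g γ z → chosen g' γ z).
      { intros γ z Hγ H s' Hs'; apply H; intros w; rewrite Hs'.
        assert (Hδ : ∀ δ, δ ∈ γ → δ ∈ β).
        { intros δ Hδ; destruct Hγ as [Hγ|<-]; [now apply (ord_trans HO Hδ)|trivial]. }
        split; intros [Hw Hw']; split; trivial; intros (δ & Hδ' & H'); apply Hw';
          exists δ; split; trivial; apply Hr'; auto. }
      exists β', g', d; split; [exact Hβ'|split; [|apply Hr; auto]].
      split; [now apply (succ_ord HO)|split; [|split]].
      + intros γ z H; apply Hr in H; apply Hβ'; destruct H as [H|[-> _]]; eauto.
      + intros γ Hγ; apply Hβ' in Hγ; setoid_rewrite Hr; destruct Hγ as [Hγ| ->]; [|eauto].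
        destruct (H2 γ Hγ); eauto.
      + intros γ z H; apply Hr in H; destruct H as [H|[-> ->]]; [apply Hch; eauto|].
        apply Hch; auto; intros s' Hs'.
        replace s' with s by (apply (z_ext ZF); intros w; now rewrite Hs, Hs').
        split; trivial; now apply Hd'. }
  assert (Hall : ∀ α, is_ordinal E α → ∃ g, att α g).
  { intros α; induction (hwf α) as [α _ IH]; intros HO.
    (* The union of all enumerations, cut down to α, treats successors and limits alike: every β
       below α is reached by extending an enumeration of length β. *)
    destruct (@sep2 _ _ ZF (λ β d, ∃ α' g', att α' g' ∧ rel E g' β d) α D) as (g & Hg & _);
      [unfold att, chosen; def|].
    assert (Hr : ∀ β d, rel E g β d ↔ β ∈ α ∧ d ∈ D ∧ ∃ α' g', att α' g' ∧ rel E g' β d).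
    { intros β d; now rewrite (relE ZF), Hg. }
    exists g; split; [exact HO|split; [|split]].
    - intros β d H; now apply Hr in H.
    - intros β Hβ; destruct (IH β Hβ (ord_mem HO Hβ)) as [g' Hg'].
      destruct (Hext β g' Hg') as (β' & g'' & d & _ & Ha & Hd); exists d; apply Hr.
      split; [trivial|split; [|now exists β', g'']].
      apply (HD g'' β); now apply Ha.
    - intros β d H; apply Hr in H; destruct H as (Hβ & _ & α' & g' & Ha & Hd).
      pose proof Ha as (HO' & H1 & H2 & H3).
      intros s Hs; apply (H3 β d Hd); intros z; rewrite Hs.
      split; intros [Hz Hz']; split; trivial; intros (γ & Hγ & H); apply Hz'; exists γ;
        split; trivial.
      + apply Hr; split; [now apply (ord_trans HO Hγ)|split; trivial; now exists α', g'].
      + apply Hr in H; destruct H as (_ & _ & α'' & g'' & Ha'' & H).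
        destruct (H2 γ) as [z' H']; [apply (ord_trans HO' Hγ); eauto|].
        now rewrite (Hagree γ α'' α' g'' g' z z'). }
  destruct (@replacement (λ d β, ∃ α g, att α g ∧ rel E g β d) D) as [O HOr].
  { unfold att, chosen; def. }
  { intros d β γ Hd (α & g & Ha & Hβ) (α' & g' & Ha' & Hγ).
    pose proof Ha as (HO & H1 & H2 & _); pose proof Ha' as (HO' & H1' & H2' & _).
    pose proof (H1 _ _ Hβ) as Hβα; pose proof (H1' _ _ Hγ) as Hγα.
    destruct (ord_trichotomy ZF (ord_mem HO Hβα) (ord_mem HO' Hγα)) as [H|[H|H]]; trivial.
    - destruct (H2' β) as [d' Hd']; [now apply (ord_trans HO' H)|].
      rewrite (Hagree β α' α g' g d' d) in Hd' by trivial.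
      now apply (Hinj α' g' β γ d).
    - destruct (H2 γ) as [d' Hd']; [now apply (ord_trans HO H)|].
      rewrite (Hagree γ α α' g g' d' d) in Hd' by trivial.
      now apply (Hinj α g β γ d). }
  (* The Burali-Forti contradiction: [O] would be an ordinal, hence a member of itself. *)
  assert (HOO : ∀ β, β ∈ O ↔ is_ordinal E β).
  { intros β; rewrite HOr; split.
    - intros (d & _ & α & g & Ha & Hβ); apply (@ord_mem _ E α); [apply Ha|].
      destruct Ha as (_ & H1 & _); eauto.
    - intros HO; destruct (Hall β HO) as [g Ha].
      destruct (Hext β g Ha) as (β' & g' & d & _ & Ha' & Hd).
      exists d; split; [|now exists β', g']; apply (HD g' β); now apply Ha'. }
  apply (mem_irrefl ZF (x := O)), HOO; split.
  - intros β Hβ γ Hγ; apply HOO; apply HOO in Hβ; now apply (ord_mem Hβ).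
  - intros β Hβ; apply HOO in Hβ; exact (proj1 Hβ). }
destruct Hsurj as (α & g & Ha & Hsurj); pose proof Ha as (HO & H1 & _ & _).
destruct (@sep2 _ _ ZF (λ d d', ∃ β γ, rel E g β d ∧ rel E g γ d' ∧ β ∈ γ) D D)
  as (R & HR & _); [def|].
assert (HR' : ∀ d d', rel E R d d' ↔ d ∈ D ∧ d' ∈ D ∧
  ∃ β γ, rel E g β d ∧ rel E g γ d' ∧ β ∈ γ).
{ intros d d'; now rewrite (relE ZF), HR. }
exists R; split; [|split].
- intros d d' Hd Hd'; destruct (Hsurj d Hd) as [β Hβ], (Hsurj d' Hd') as [γ Hγ].
  rewrite !HR'.
  destruct (ord_trichotomy ZF (ord_mem HO (H1 _ _ Hβ)) (ord_mem HO (H1 _ _ Hγ)))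
    as [H|[H|H]]; [left; eauto 8|right; left|right; right; eauto 8].
  subst γ; now apply (Hagree β α α g g).
- intros d d' d''; rewrite !HR'; intros (Hd & Hd' & β & γ & Hβ & Hγ & H)
    (_ & Hd'' & γ' & δ & Hγ' & Hδ & H'); repeat split; trivial; exists β, δ.
  rewrite (Hinj α g γ γ' d') in H by trivial; repeat split; trivial.
  apply (ord_trans (ord_mem HO (H1 _ _ Hδ)) H H').
- assert (Hacc : ∀ β d, rel E g β d → Acc (rel E R) d).
  { intros β; induction (hwf β) as [β _ IH]; intros d Hd; constructor; intros d' H.
    apply HR' in H; destruct H as (_ & _ & β' & γ & Hβ' & Hγ & H).
    rewrite (Hinj α g γ β d) in H by trivial; now apply (IH β'). }
  intros d; constructor; intros d' H; apply HR' in H.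
  destruct H as (_ & _ & β & _ & Hβ & _); now apply (Hacc β).
Qed.

End Replacement.

(** * Integer sequences *)

Section Sequences.

Context {S : Type} {E : S → S → Prop} (ZF : Zermelo E).
Local Infix "∈" := E (at level 70).
Local Notation num := (num ZF).
Local Notation pr := (pr ZF).

Lemma binop_fun f X x y z z' : is_binop E f X →
  rel2 E f x y z → rel2 E f x y z' → z = z'.
Proof.
intros (Q & _ & (H1 & H2) & _) (p & Hp & Hz) (p' & Hp' & Hz').
rewrite (opair_fun ZF Hp' Hp) in Hz'.
assert (HpQ : p ∈ Q).
{ destruct Hz as (w & Hw & Hwf), (H1 w Hwf) as (p0 & Hp0 & y' & Hw').
  now destruct (opair_inj Hw Hw') as [-> _]. }
destruct (H2 p HpQ) as (v & _ & Hv); transitivity v; [symmetry|]; auto.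
Qed.

Lemma binop_ex f X x y : is_binop E f X → x ∈ X → y ∈ X →
  ∃ z, z ∈ X ∧ rel2 E f x y z.
Proof.
intros (Q & HQ & Hf) Hx Hy.
destruct (is_function_val Hf (x := pr x y)) as (z & Hz & Hz').
- apply HQ; exists x; split; trivial; exists y; split; trivial; apply pr_is.
- exists z; split; trivial; rewrite (rel2E ZF), <- (relE ZF); now apply Hz'.
Qed.

Lemma nat_addE w a m n v : is_nat_add E w a →
  rel2 E a (num m) (num n) v ↔ v = num (m + n).
Proof.
intros (Hw & Ha & H0 & HS); pose proof (omegaE ZF Hw) as Hw'.
assert (H : rel2 E a (num m) (num n) (num (m + n))).
{ induction n as [|n IH].
  - rewrite Nat.add_0_r; apply H0; [apply Hw'; eauto|exact (@num0 _ _ ZF)].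
  - rewrite Nat.add_succ_r; apply (HS (num m) (num n) (num (m + n))); trivial; apply numS. }
split; [intros H'; exact (binop_fun Ha H' H)|intros ->; exact H].
Qed.

(** Truncation by [Z.to_nat] makes at least one component 0, as the coding of integers demands. *)
Definition zc (k : Z) : S := pr (num (Z.to_nat k)) (num (Z.to_nat (- k))).

Lemma zc_inj k l : zc k = zc l → k = l.
Proof. intros H; apply pr_inj in H; destruct H as [H1 H2]; apply num_inj in H1, H2; lia. Qed.

Section Integers.

Context {Zs : gstr S} (HZ : is_integers E Zs).

Lemma integers_car z : z ∈ car Zs ↔ ∃ k, z = zc k.
Proof.
destruct HZ as (w & a & Ha & Hcar & _); pose proof (omegaE ZF (proj1 Ha)) as Hw.
rewrite Hcar; split.
- intros (m & Hm & n & Hn & Hz & H0); apply Hw in Hm, Hn.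
  destruct Hm as [i ->], Hn as [j ->]; rewrite !(num_empty ZF) in H0.
  exists (Z.of_nat i - Z.of_nat j)%Z; apply (opairE ZF) in Hz; rewrite Hz; unfold zc.
  f_equal; f_equal; lia.
- intros [k ->]; exists (num (Z.to_nat k)); split; [apply Hw; eauto|].
  exists (num (Z.to_nat (- k))); split; [apply Hw; eauto|split; [apply pr_is|]].
  rewrite !(num_empty ZF); lia.
Qed.

Lemma integers_add k l v : rel2 E (gop Zs) (zc k) (zc l) v ↔ v = zc (k + l).
Proof.
assert (H : ∀ v, rel2 E (gop Zs) (zc k) (zc l) v → v = zc (k + l)).
{ intros u Hu; destruct HZ as (w & a & Ha & _ & Hop & H).
  assert (Hv : u ∈ car Zs).
  { destruct Hop as (Q & _ & Hf), Hu as (p & _ & Hu); now apply (proj2 Hf p). }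
  apply integers_car in Hv; destruct Hv as [j ->].
  destruct (H _ _ _ (num (Z.to_nat k)) (num (Z.to_nat (- k))) (num (Z.to_nat l))
    (num (Z.to_nat (- l))) (num (Z.to_nat j)) (num (Z.to_nat (- j))) Hu)
    as (s & t & u & H1 & H2 & H3 & H4); try apply pr_is.
  apply (nat_addE _ _ _ Ha) in H1, H3; subst s t.
  apply (nat_addE _ _ _ Ha) in H2, H4; subst u; apply num_inj in H4.
  f_equal; lia. }
split; [apply H|intros ->].
destruct HZ as (_ & _ & _ & _ & Hop & _).
destruct (binop_ex (x := zc k) (y := zc l) Hop) as (z & _ & Hz);
  [apply integers_car; eauto..|].
now rewrite <- (H z Hz).
Qed.

Lemma integers_mulr n k v :
  mulr E Zs (num n) (zc k) v ↔ v = zc (Z.of_nat n * k).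
Proof.
apply (iteratedE (ZF := ZF) (t := λ n, zc (Z.of_nat n * k))).
- intros u; split.
  + intros [Hu H]; apply integers_car in Hu; destruct Hu as [j ->].
    specialize (H (zc j)); rewrite integers_add in H.
    replace (Z.of_nat 0 * k)%Z with j; trivial.
    assert (H' : j = (j + j)%Z); [apply zc_inj, H, integers_car; eauto|lia].
  + intros ->; split; [apply integers_car; eauto|].
    intros x Hx; apply integers_car in Hx; destruct Hx as [j ->].
    apply integers_add; f_equal; lia.
- intros j y; rewrite integers_add.
  now replace (Z.of_nat (Datatypes.S j) * k)%Z with (Z.of_nat j * k + k)%Z by lia.
Qed.

(** This is z = i! u in relational form: starting from [u], step [k] multiplies by k + 1. *)
Definition fact_mul (i u z : S) : Prop :=
  iterated E (λ v, v = u)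
    (λ k y y', ∃ k', is_succ E k' k ∧ mulr E Zs k' y y') i z.

Lemma fact_mulE i k v : fact_mul (num i) (zc k) v ↔ v = zc (Z.of_nat (fact i) * k).
Proof.
apply (iteratedE (ZF := ZF) (t := λ i, zc (Z.of_nat (fact i) * k))).
- intros u; now replace (Z.of_nat (fact 0) * k)%Z with k by (simpl fact; lia).
- intros j y.
  replace (Z.of_nat (fact (Datatypes.S j)) * k)%Z
    with (Z.of_nat (Datatypes.S j) * (Z.of_nat (fact j) * k))%Z
    by (change (fact (Datatypes.S j)) with (Datatypes.S j * fact j); lia).
  split.
  + intros (k' & Hk' & H); apply num_succ in Hk'; subst k'; now apply integers_mulr in H.
  + intros ->; exists (num (Datatypes.S j)); split; [apply numS|now apply integers_mulr].
Qed.

End Integers.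

Definition codes (x : S) (f : nat → Z) : Prop :=
  ∀ z, z ∈ x ↔ ∃ n, z = pr (num n) (zc (f n)).

Lemma codes_rel x f n v : codes x f → rel E x (num n) v ↔ v = zc (f n).
Proof.
intros H; rewrite (relE ZF), (H (pr (num n) v)); split; [|intros ->; eauto].
intros (m & Hm); apply pr_inj in Hm; destruct Hm as [Hm ->].
now rewrite (num_inj Hm).
Qed.

Lemma codes_inj x y f g : codes x f → codes y g → (∀ n, f n = g n) → x = y.
Proof.
intros Hf Hg H; apply (z_ext ZF); intros z; rewrite (Hf z), (Hg z).
split; intros [n Hn]; exists n; [now rewrite <- H|now rewrite H].
Qed.

Lemma sequence_codes x : is_integer_sequence E x → ∃ f, codes x f.
Proof.
intros (w & Zs & Hw & HZ & Hx); pose proof (omegaE ZF Hw) as Hw'.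
assert (H : ∀ n, ∃ k, ∀ v, rel E x (num n) v ↔ v = zc k).
{ intros n; destruct (is_function_val Hx (x := num n)) as (y & Hy & Hy').
  - apply Hw'; eauto.
  - apply (integers_car HZ) in Hy; destruct Hy as [k ->]; eauto. }
exists (λ n, proj1_sig (constructive_indefinite_description _ (H n))).
assert (H' : ∀ n v, rel E x (num n) v ↔
  v = zc (proj1_sig (constructive_indefinite_description _ (H n)))).
{ intros n; exact (proj2_sig (constructive_indefinite_description _ (H n))). }
intros z; split.
- intros Hz; destruct (proj1 (proj1 Hx) z Hz) as (i & Hi & y & Hy).
  apply Hw' in Hi; destruct Hi as [n ->]; exists n; rewrite <- (opairE ZF).
  assert (Hn : rel E x (num n) y) by (exists z; auto).
  apply H' in Hn; now subst y.
- intros [n ->]; now apply (relE ZF), H'.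
Qed.

Lemma codes_sequence w Zs x f : is_omega E w → is_integers E Zs → codes x f →
  is_integer_sequence E x.
Proof.
intros Hw HZ Hx; exists w, Zs; split; trivial; split; trivial.
pose proof (omegaE ZF Hw) as Hw'; repeat split.
- intros p Hp; apply Hx in Hp; destruct Hp as [n ->]; exists (num n).
  split; [apply Hw'; eauto|exists (zc (f n)); apply pr_is].
- intros i Hi; apply Hw' in Hi; destruct Hi as [n ->]; exists (zc (f n)).
  split; [now apply (codes_rel n _ Hx)|].
  intros v Hv; now apply (codes_rel n _ Hx) in Hv.
- intros i v Hv; apply (integers_car HZ); apply (relE ZF), Hx in Hv.
  destruct Hv as [n Hn]; apply pr_inj in Hn; destruct Hn as [_ ->]; eauto.
Qed.

Section Closure.

Context {w : S} {Zs : gstr S} (Hw : is_omega E w) (HZ : is_integers E Zs).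

Lemma codes_ex (Q : S → S → Prop) f : Def E (λ e, Q (e 0) (e 1)) →
  (∀ i k, Q (num i) (zc k) ↔ k = f i) → ∃ x, codes x f.
Proof.
intros HQ H; destruct (sep2 ZF w (car Zs) HQ) as (x & Hx1 & Hx2).
pose proof (omegaE ZF Hw) as Hw'; pose proof (integers_car HZ) as HZ'.
exists x; intros z; split.
- intros Hz; destruct (Hx2 z Hz) as (i & v & Hi & Hv & ->); apply Hx1 in Hz.
  apply Hw' in Hi; apply HZ' in Hv; destruct Hi as [n ->], Hv as [k ->].
  exists n; do 2 f_equal; now apply H.
- intros [n ->]; apply Hx1; rewrite Hw', HZ'; repeat split; eauto; now apply H.
Qed.

Lemma codes_fact x f : codes x f → ∃ y, codes y (λ i, (Z.of_nat (fact i) * f i)%Z).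
Proof.
intros Hx; apply (@codes_ex (λ i z, ∃ u, rel E x i u ∧ @fact_mul Zs i u z)).
- unfold fact_mul; def.
- intros i k; split.
  + intros (u & Hu & H); apply (codes_rel i u Hx) in Hu; subst u.
    apply (fact_mulE HZ), zc_inj in H; exact H.
  + intros ->; exists (zc (f i)); rewrite (codes_rel i _ Hx); split; trivial.
    now apply (fact_mulE HZ).
Qed.

(** Division by i! is definable from [y] alone. Applied in [M], this recovers the real from its
    multiple. *)
Lemma codes_of_fact y f : codes y (λ i, (Z.of_nat (fact i) * f i)%Z) → ∃ x, codes x f.
Proof.
intros Hy; apply (@codes_ex (λ i u, ∃ z, rel E y i z ∧ @fact_mul Zs i u z)).
- unfold fact_mul; def.
- intros i k; pose proof (lt_O_fact i) as Hi; split.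
  + intros (z & Hz & H); apply (codes_rel i z Hy) in Hz; subst z.
    apply (fact_mulE HZ), zc_inj in H; nia.
  + intros ->; eexists; rewrite (codes_rel i _ Hy); split; [reflexivity|].
    now apply (fact_mulE HZ).
Qed.

Lemma codes_div x f g n : codes x f → n ≠ 0 →
  (∀ i, n ≤ i → (f i = Z.of_nat n * g i)%Z) →
  ∃ y, codes y (λ i, if i <? n then 0%Z else g i).
Proof.
intros Hx Hn Hf.
apply (@codes_ex (λ i z, (i ∈ num n ∧ z = zc 0) ∨
  ¬ i ∈ num n ∧ ∃ u, rel E x i u ∧ mulr E Zs (num n) z u)); [def|].
intros i k; rewrite (num_lt ZF); destruct (Nat.ltb_spec i n) as [Hi|Hi]; split.
- intros [[_ H]|[H _]]; [now apply zc_inj in H|lia].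
- intros ->; auto.
- intros [[H _]|(_ & u & Hu & H)]; [lia|].
  apply (codes_rel i u Hx) in Hu; subst u; apply (integers_mulr HZ), zc_inj in H.
  rewrite Hf in H by trivial; nia.
- intros ->; right; split; [lia|]; exists (zc (f i)); rewrite (codes_rel i _ Hx).
  split; trivial; apply (integers_mulr HZ); now rewrite Hf.
Qed.

(** The sequence [f] is external and may be missing from the structure; a finite truncation needs
    only finitely many of its values as parameters. *)
Lemma codes_finite (f : nat → Z) n : ∃ a, codes a (λ i, if i <? n then f i else 0%Z).
Proof.
induction n as [|n [a Ha]].
- apply (@codes_ex (λ _ z, z = zc 0)); [def|].
  intros i k; simpl; split; [apply zc_inj|now intros ->].
- apply (@codes_ex (λ i z, (i = num n ∧ z = zc (f n)) ∨ i ≠ num n ∧ rel E a i z)); [def|].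
  intros i k; rewrite (codes_rel i _ Ha).
  destruct (Nat.ltb_spec i (Datatypes.S n)) as [Hi|Hi], (Nat.ltb_spec i n) as [Hi'|Hi'];
    try lia; split.
  + intros [[H _]|[_ H]]; [apply num_inj in H; lia|now apply zc_inj].
  + intros ->; right; split; trivial; intros H; apply num_inj in H; lia.
  + replace i with n by lia; intros [[_ H]|[H _]]; [now apply zc_inj|easy].
  + replace i with n by lia; intros ->; auto.
  + intros [[H _]|[_ H]]; [apply num_inj in H; lia|now apply zc_inj].
  + intros ->; right; split; trivial; intros H; apply num_inj in H; lia.
Qed.

End Closure.

Lemma is_subgroup_mono H H' G : is_binop E (gop G) (car G) → is_subgroup E H G →
  is_subgroup E H' G → (∀ x, x ∈ car H → x ∈ car H') → is_subgroup E H H'.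
Proof.
intros HG (H1 & H2 & H3) (H1' & H2' & H3') Hsub; split; [|split]; trivial.
intros x y z Hz; destruct (gop_dom ZF H1 Hz) as (Hx & Hy & _).
apply Hsub in Hx, Hy; destruct (gop_ex ZF H1' Hx Hy) as (v & _ & Hv).
assert (Hv' : rel2 E (gop H') x y v) by now apply Hv.
now rewrite (binop_fun HG (H3 _ _ _ Hz) (H3' _ _ _ Hv')).
Qed.

(** Composing the coset map with the isomorphism reduces a filtration step to an additive map into
    [C] with kernel [H]. *)
Lemma quotient_map G H Q C : is_abgroup E G → is_abgroup E C → is_subgroup E H G →
  is_quotient E G H Q → isomorphic E Q C →
  ∃ q, additive ZF G C q ∧ ∀ x, x ∈ car G → q x = gzero ZF C ↔ x ∈ car H.
Proof.
intros HG HC HH (HQ1 & HQ2 & HQ3) (f & [Hf Hfh] & Hinj & _).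
destruct (subgroup_agrees ZF HG HH) as (Hadd & _ & H0 & HH1 & HH2 & HH3 & HH4).
assert (Hcs : ∃ cs, ∀ x, x ∈ car G → is_coset E G H x (cs x)).
{ exists (λ x, the ZF (is_coset E G H x)); intros x Hx.
  apply (@theP _ _ ZF (is_coset E G H x)).
  destruct (@sep _ _ ZF (λ y, ∃ h, h ∈ car H ∧ rel2 E (gop G) x h y) (car G)) as [c Hc];
    [def|].
  exists c; intros y; rewrite Hc; split; [tauto|intros Hy; split; trivial].
  destruct Hy as (h & _ & Hy); now apply (gop_dom ZF HG) in Hy. }
destruct Hcs as [cs Hcs].
assert (HcsQ : ∀ x, x ∈ car G → cs x ∈ car Q) by (intros x Hx; apply HQ1; eauto).
assert (Hmul : ∀ x y, x ∈ car G → y ∈ car G →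
  rel2 E (gop Q) (cs x) (cs y) (cs (gadd ZF G x y))).
{ intros x y Hx Hy; apply (HQ3 x y (gadd ZF G x y)); [now apply (gopE ZF HG)|..];
    apply Hcs; trivial; now apply gadd_car. }
set (q := λ x, value ZF f (cs x)).
assert (Hq : additive ZF G C q).
{ split; [intros x Hx; apply (value_in ZF Hf); auto|].
  intros x y Hx Hy; apply (gopE ZF HC); try (apply (value_in ZF Hf); auto).
  apply (Hfh _ _ _ _ _ _ (Hmul x y Hx Hy)); apply (valueE ZF _ Hf); auto.
  apply HcsQ; now apply gadd_car. }
pose proof (gzero_car ZF HG) as HG0.
assert (Hself : ∀ x, x ∈ car G → x ∈ cs x).
{ intros x Hx; apply (Hcs x Hx); exists (gzero ZF G); split; trivial.
  apply (gopE ZF HG); trivial; symmetry; now apply gadd0. }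
exists q; split; trivial; intros x Hx; rewrite <- (additive_zero HG HC Hq); split.
- intros Hqx; assert (Hc : cs x = cs (gzero ZF G)).
  { apply (Hinj _ _ (q x)); apply (valueE ZF _ Hf); auto. }
  pose proof (Hself x Hx) as Hxc; rewrite Hc in Hxc; apply (Hcs _ HG0) in Hxc.
  destruct Hxc as (h & Hh & Hxc); apply HH1 in Hh as Hh'; apply (gopE ZF HG) in Hxc; trivial.
  rewrite (gaddC ZF HG), (gadd0 ZF HG) in Hxc by trivial; now subst.
- intros HxH; unfold q; f_equal; apply (z_ext ZF); intros y.
  rewrite (Hcs x Hx y), (Hcs _ HG0 y); split; intros (h & Hh & Hy);
    apply HH1 in Hh as Hh'; apply (gopE ZF HG) in Hy; trivial; subst y.
  + exists (gadd ZF G x h); split; [now apply HH3|]; apply (gopE ZF HG); trivial.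
    * now apply gadd_car.
    * rewrite (gaddC ZF HG HG0), (gadd0 ZF HG); trivial; now apply gadd_car.
  + exists (gadd ZF G (gopp ZF G x) h); split; [apply HH3; auto|].
    pose proof (gopp_car ZF HG Hx) as Hx'.
    apply (gopE ZF HG); trivial; [now apply gadd_car|].
    rewrite <- (gaddA ZF HG), (gaddN ZF HG) by trivial; reflexivity.
Qed.

End Sequences.

(** * Filtrations by cotorsionfree groups *)

Section Filtrations.

Context {S : Type} {E : S → S → Prop} (ZF : Zermelo E) (Hord : orderable E).
Context {W : S} (HW : is_omega E W).
Local Infix "∈" := E (at level 70).
Local Notation "! n" := (Z.of_nat n) (at level 5).
Local Notation add := (gadd ZF).
Local Notation mul := (gmul ZF).

Lemma ordinal_cases γ β : is_ordinal E γ → β ∈ γ →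
  is_limit E γ ∨ ∃ α, is_succ E γ α.
Proof.
intros Hγ Hβ; destruct (classic (is_limit E γ)) as [|Hn]; [auto|right].
apply NNPP; intros Hs; apply Hn; split; trivial; split; [intros He; exact (He β Hβ)|].
intros α Hα; destruct (adjoin_ex ZF α α) as [α' Hα']; exists α'; split; [|exact Hα'].
destruct (ord_trichotomy ZF (succ_ord (ord_mem Hγ Hα) Hα') Hγ) as [H|[H|H]]; trivial.
- destruct Hs; exists α; now subst.
- apply Hα' in H; destruct H as [H|H]; [destruct (mem_asym ZF H Hα)|].
  subst; destruct (mem_irrefl ZF Hα).
Qed.

(** Consider the least stage containing [x]. Continuity excludes a limit, and at a successor the
    class of [x] in the step is divisible by every n, hence zero, which puts [x] into an earlier
    stage. *)
Lemma filtration_reduced A B δ F : is_binop E (gop B) (car B) →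
  is_filtration E (cotorsionfree E) A B δ F →
  ∃ G, is_subgroup E G B ∧ car G = car B ∧ ∀ x, x ∈ car B →
    (∀ n, n ≠ 0 → ∃ y a, y ∈ car B ∧ a ∈ A ∧ x = add G (mul G !n y) a) → x ∈ A.
Proof.
intros HB (Hδ & (δ' & Hδ' & HF) & Hsub & Hmono & Hlim & H0 & Htop & Hstep).
destruct (Hsub δ (car B) Htop) as (G & HGB & HG); exists G; split; trivial; split; trivial.
pose proof (proj1 HG) as HGa.
assert (HδO : is_ordinal E δ') by exact (succ_ord Hδ Hδ').
assert (Hex : ∀ α, α ∈ δ' → ∃ X, rel E F α X).
{ intros α Hα; destruct HF as [_ HF], (HF α Hα) as (X & HX & _); eauto. }
assert (Hfun : ∀ α X Y, rel E F α X → rel E F α Y → X = Y).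
{ intros α X Y HX HY; destruct HF as [HF1 HF2].
  assert (Hα : α ∈ δ').
  { destruct HX as (p & Hp & HpF), (HF1 p HpF) as (α' & Hα & y & Hp').
    now destruct (opair_inj Hp Hp') as [-> _]. }
  destruct (HF2 α Hα) as (Z & _ & HZ); transitivity Z; [symmetry|]; auto. }
assert (Hle : ∀ α β X Y, rel E F α X → rel E F β Y → α ∈ β ∨ α = β → ∀ x, x ∈ X → x ∈ Y).
{ intros α β X Y HX HY [H|H] x Hx; [now apply (Hmono α β X Y)|].
  subst β; now rewrite <- (Hfun α X Y). }
assert (HmG : ∀ H, is_subgroup E H B → is_subgroup E H G).
{ intros H HH; apply (is_subgroup_mono ZF HB HH HG); rewrite HGB; apply HH. }
assert (Hmap : ∀ β γ X Y, β ∈ δ → is_succ E γ β → rel E F β X → rel E F γ Y →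
  ∃ C q, cotorsionfree E C ∧ (∀ x, x ∈ Y → q x ∈ car C) ∧
    (∀ x, x ∈ Y → q x = gzero ZF C ↔ x ∈ X) ∧
    (∀ n x y a, x ∈ Y → y ∈ Y → a ∈ X → x = add G (mul G !n y) a → q x = mul C !n (q y))).
{ intros β γ X Y Hβ Hγ HX HY.
  destruct (Hstep β γ X Y Hβ Hγ HX HY) as (H & H' & Q & C & <- & HH & <- & HH' & HQ & HQC & HC).
  pose proof (proj1 HH') as HHa; pose proof (proj1 HC) as HCa.
  assert (Hsub' : ∀ x, x ∈ car H → x ∈ car H').
  { apply (Hle β γ); trivial; left; apply Hγ; auto. }
  pose proof (is_subgroup_mono ZF HB HH HH' Hsub') as HHH.
  destruct (quotient_map ZF HHa HCa HHH HQ HQC) as (q & Hq & Hker).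
  exists C, q; split; trivial; split; [apply Hq|split; trivial].
  destruct (subgroup_agrees ZF HGa (HmG H' HH')) as (Hadd & Hmul & _ & _).
  intros n x y a Hx Hy Ha ->; apply Hsub' in Ha as Ha'.
  rewrite <- Hmul, <- Hadd by (trivial; now apply gmul_car).
  rewrite (proj2 Hq) by (trivial; now apply gmul_car).
  rewrite (proj2 (Hker a Ha') Ha), (additive_mul HHa HCa Hq) by trivial.
  apply gadd0; trivial; apply gmul_car; trivial; now apply Hq. }
assert (HsubF : ∀ α X, rel E F α X → subgrp ZF G X).
{ intros α X HX; destruct (Hsub α X HX) as (H & <- & HH).
  apply (subgroup_agrees ZF HGa (HmG H HH)). }
(* A_γ/A_α is torsionfree, by induction on γ. At γ = β + 1, the step map sends n x to 0 and its
   target is torsionfree, so [x] already lies in A_β. *)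
assert (Htf : ∀ γ α X Y n x, γ ∈ δ' → rel E F α X → rel E F γ Y → α ∈ γ ∨ α = γ →
  n ≠ 0 → x ∈ Y → mul G !n x ∈ X → x ∈ X).
{ intros γ; induction (z_wf ZF γ) as [γ _ IH]; intros α X Y n x Hγ HX HY Hαγ Hn Hx Hnx.
  destruct Hαγ as [Hαγ|<-]; [|now rewrite (Hfun α X Y)].
  destruct (ordinal_cases (ord_mem HδO Hγ) Hαγ) as [Hl|[β Hβ]].
  - apply (Hlim γ Y Hl HY) in Hx; destruct Hx as (ζ & Hζ & Z & HZ & Hx).
    assert (Hζδ : ζ ∈ δ') by exact (ord_trans HδO Hζ Hγ).
    pose proof (ord_mem HδO Hγ) as HγO.
    destruct (ord_trichotomy ZF (ord_mem HγO Hζ) (ord_mem HγO Hαγ)) as [H|[H|H]].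
    + apply (Hle ζ α Z X); auto.
    + apply (Hle ζ α Z X); auto.
    + apply (IH ζ Hζ α X Z n); auto.
  - assert (Hβγ : β ∈ γ) by (apply Hβ; auto).
    assert (Hβδ : β ∈ δ).
    { apply Hδ' in Hγ; destruct Hγ as [Hγ| ->]; trivial; exact (ord_trans Hδ Hβγ Hγ). }
    assert (Hβδ' : β ∈ δ') by (apply Hδ'; auto).
    destruct (Hex β Hβδ') as [Z HZ]; apply Hβ in Hαγ.
    destruct (Hmap β γ Z Y Hβδ Hβ HZ HY) as (C & q & HC & Hq & Hker & Hqm).
    pose proof (HsubF γ Y HY) as HYs; pose proof (HsubF β Z HZ) as HZs.
    assert (HnxZ : mul G !n x ∈ Z) by (apply (Hle α β X Z); trivial).
    assert (HnxY : mul G !n x ∈ Y) by now apply subgrp_mul.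
    apply (IH β Hβγ α X Z n); trivial; apply Hker; trivial.
    apply (cotorsionfree_torsionfree Hord HW (n := n) HC); auto.
    rewrite <- (Hqm n (mul G !n x) x (gzero ZF G)); trivial; [now apply Hker|apply HZs|].
    symmetry; apply gadd0; trivial; now apply HZs. }
intros x Hx Hdiv.
assert (Hγ : ∃ γ Y, γ ∈ δ' ∧ rel E F γ Y ∧ x ∈ Y ∧
  ∀ β Z, β ∈ γ → rel E F β Z → ¬ x ∈ Z).
{ assert (Hind : ∀ γ Y, γ ∈ δ' → rel E F γ Y → x ∈ Y → ∃ γ Y, γ ∈ δ' ∧ rel E F γ Y ∧ x ∈ Y ∧
    ∀ β Z, β ∈ γ → rel E F β Z → ¬ x ∈ Z).
  { intros γ; induction (z_wf ZF γ) as [γ _ IH]; intros Y Hγ HY HxY.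
    destruct (classic (∃ β Z, β ∈ γ ∧ rel E F β Z ∧ x ∈ Z)) as [(β & Z & Hβ & HZ & HxZ)|Hn].
    - apply (IH β Hβ Z); trivial; exact (ord_trans HδO Hβ Hγ).
    - exists γ, Y; repeat split; trivial; intros β Z Hβ HZ HxZ; apply Hn; eauto. }
  apply (Hind δ (car B)); trivial; apply Hδ'; auto. }
destruct Hγ as (γ & Y & Hγ & HY & HxY & Hmin).
destruct (classic (is_empty E γ)) as [He|He]; [now rewrite (Hfun γ A Y (H0 γ He) HY)|].
assert (Hne : ∃ β, β ∈ γ).
{ apply NNPP; intros Hn; apply He; intros β Hβ; eauto. }
destruct Hne as [β0 Hβ0]; exfalso.
destruct (ordinal_cases (ord_mem HδO Hγ) Hβ0) as [Hl|[β Hβ]].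
{ apply (Hlim γ Y Hl HY) in HxY; destruct HxY as (ζ & Hζ & Z & HZ & HxZ).
  exact (Hmin ζ Z Hζ HZ HxZ). }
assert (Hβγ : β ∈ γ) by (apply Hβ; auto).
assert (Hβδ : β ∈ δ).
{ apply Hδ' in Hγ; destruct Hγ as [Hγ| ->]; trivial; exact (ord_trans Hδ Hβγ Hγ). }
destruct (Hex β) as [X HX]; [apply Hδ'; auto|].
destruct (Hmap β γ X Y Hβδ Hβ HX HY) as (C & q & HC & Hq & Hker & Hqm).
apply (Hmin β X Hβγ HX), Hker; trivial.
apply (cotorsionfree_reduced Hord HW HC); auto; intros n Hn.
destruct (Hdiv n Hn) as (y & a & Hy & Ha & Hxy).
assert (HAX : ∀ z, z ∈ A → z ∈ X).
{ destruct (empty_ex ZF) as [o Ho]; apply (Hle o β A X); [now apply H0|trivial|].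
  pose proof (ord_mem Hδ Hβδ) as HβO.
  destruct (ord_trichotomy ZF (x := o) (y := β)) as [H|[H|H]]; auto; [|now destruct (Ho β)].
  split; intros z Hz; now destruct (Ho z). }
assert (HaY : a ∈ Y) by (apply (Hle β γ X Y); auto).
pose proof (HsubF γ Y HY) as (HY1 & HY2 & HY3 & HY4); rewrite <- HGB in Hy.
(* The divisor [y] is given only in [B]. As n y = x - a lies in A_γ and B/A_γ is torsionfree, [y]
   lies in A_γ, so the division takes place inside the step. *)
assert (HyY : y ∈ Y).
{ apply (Htf δ γ Y (car B) n y); trivial; [apply Hδ'; auto| |now rewrite <- HGB|].
  - now apply Hδ' in Hγ.
  - replace (mul G !n y) with (add G x (gopp ZF G a)); [auto|].
    apply HY1 in HaY; pose proof (gmul_car ZF HGa !n Hy) as Hny.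
    rewrite Hxy, (gaddA ZF HGa), (gaddN ZF HGa), (gadd0 ZF HGa); trivial.
    now apply gopp_car. }
exists (q y); split; [auto|symmetry; apply (Hqm n x y a); auto].
Qed.

End Filtrations.

(** * Transitive classes and valuations *)

Definition set_of (t : tree) : set := Set_ (ex_intro _ t eq_refl).

Lemma set_eq x y : cls x = cls y → x = y.
Proof.
destruct x as [p Hp], y as [q Hq]; simpl; intros <-; f_equal; apply proof_irrelevance.
Qed.

Definition rep (x : set) : tree := proj1_sig (constructive_indefinite_description _ (clsP x)).

Lemma set_of_rep x : set_of (rep x) = x.
Proof.
apply set_eq; symmetry; simpl.
exact (proj2_sig (constructive_indefinite_description _ (clsP x))).
Qed.

Lemma mem_node (I : Type) (f : I → tree) z :
  mem z (set_of (node f)) ↔ ∃ i, z = set_of (f i).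
Proof.
split.
- intros (t & u & Ht & Hu & Htu); destruct u as [J g], Htu as [j Hj].
  destruct (proj2 Hu j) as [i Hi]; exists i; apply set_eq; simpl.
  destruct (clsP z) as [t0 Ht0]; rewrite Ht0 in *; apply bisim_cls.
  apply bisim_trans with t; trivial; apply bisim_trans with (g j); trivial.
  now apply bisim_sym.
- intros [i ->]; exists (f i), (node f); repeat split; try apply bisim_refl.
  + intros j; exists j; apply bisim_refl.
  + intros j; exists j; apply bisim_refl.
  + exists i; apply bisim_refl.
Qed.

(** The image is indexed by those branches of a representing tree at which [F] has a value. *)
Lemma set_replacement (x : set) (F : set → set → Prop) :
  (∀ w z z', F w z → F w z' → z = z') →
  ∃ y, ∀ z, mem z y ↔ ∃ w, mem w x ∧ F w z.
Proof.
intros HF; rewrite <- (set_of_rep x); destruct (rep x) as [I f].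
set (J := {i : I | ∃ z, F (set_of (f i)) z}).
set (g := λ j : J, rep (proj1_sig (constructive_indefinite_description _ (proj2_sig j)))).
exists (set_of (node g)); intros z; rewrite mem_node; split.
- intros [[i Hi] ->]; exists (set_of (f i)); split; [apply mem_node; eauto|].
  unfold g; rewrite set_of_rep; simpl.
  exact (proj2_sig (constructive_indefinite_description _ Hi)).
- intros (w & Hw & Hz); apply mem_node in Hw; destruct Hw as [i ->].
  exists (exist _ i (ex_intro _ z Hz)); unfold g; rewrite set_of_rep; simpl.
  apply (HF (set_of (f i))); trivial.
  exact (proj2_sig (constructive_indefinite_description _ (ex_intro _ z Hz))).
Qed.

Lemma set_upair_fun z z' a b : is_upair mem z a b → is_upair mem z' a b → z = z'.
Proof. intros H H'; apply set_ext; intros w; now rewrite (H w), (H' w). Qed.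

Lemma set_opair_fun z z' a b : is_opair mem z a b → is_opair mem z' a b → z = z'.
Proof.
intros (u & v & H1 & H2 & H3) (u' & v' & H1' & H2' & H3').
rewrite (set_upair_fun H1' H1), (set_upair_fun H2' H2) in H3'.
exact (set_upair_fun H3 H3').
Qed.

Lemma set_dom_wf : well_founded (λ σ τ, ∃ w p, is_opair mem w σ p ∧ mem w τ).
Proof.
apply wf_incl with (Relation_Operators.clos_trans _ mem);
  [|apply wf_clos_trans, set_wf].
intros π σ (w & q & (u & v & Hu & Hv & Hw) & H).
apply Relation_Operators.t_trans with w; [|now apply Relation_Operators.t_step].
apply Relation_Operators.t_trans with u; apply Relation_Operators.t_step.
- apply Hu; auto.
- apply Hw; auto.
Qed.

Lemma is_val_fun G τ : ∀ y y', is_val G τ y → is_val G τ y' → y = y'.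
Proof.
induction (set_dom_wf τ) as [τ _ IH]; intros y y' [H1 H2] [H1' H2'].
apply set_ext; intros z; split; intros Hz.
- destruct (H1 z Hz) as (σ & p & w & Hw & Hwτ & Hp & Hσ).
  destruct (H2' σ p w Hw Hwτ Hp) as (z' & Hz' & Hσ').
  rewrite (IH σ (ex_intro _ w (ex_intro _ p (conj Hw Hwτ))) z z'); trivial.
- destruct (H1' z Hz) as (σ & p & w & Hw & Hwτ & Hp & Hσ).
  destruct (H2 σ p w Hw Hwτ Hp) as (z' & Hz' & Hσ').
  rewrite (IH σ (ex_intro _ w (ex_intro _ p (conj Hw Hwτ))) z z'); trivial.
Qed.

(** Every set has a value, name or not, so evaluation can be used as a total function. *)
Lemma is_val_ex G τ : ∃ y, is_val G τ y.
Proof.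
induction (set_dom_wf τ) as [τ _ IH].
destruct (@set_replacement τ (λ w z, ∃ σ p, is_opair mem w σ p ∧ mem p G ∧ is_val G σ z))
  as [y Hy].
- intros w z z' (σ & p & Hw & _ & Hz) (σ' & p' & Hw' & _ & Hz').
  (* The first component is common to all members of a Kuratowski pair; since {σ'} is one of them, σ
     = σ'. *)
  assert (Hσ : σ = σ').
  { destruct Hw as (u & v & Hu & Hv & Hw), Hw' as (u' & v' & Hu' & Hv' & Hw').
    assert (Hin : ∀ x, mem x w → mem σ x).
    { intros x Hx; apply Hw in Hx; destruct Hx as [-> | ->]; [apply Hu|apply Hv]; auto. }
    assert (Hu'' : mem u' w) by (apply Hw'; auto).
    apply Hin, Hu' in Hu''; tauto. }
  subst σ'; exact (is_val_fun Hz Hz').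
- exists y; constructor.
  + intros z Hz; apply Hy in Hz; destruct Hz as (w & Hw & σ & p & Hσ & Hp & Hz).
    exists σ, p, w; auto.
  + intros σ p w Hw Hwτ Hp.
    destruct (IH σ (ex_intro _ w (ex_intro _ p (conj Hw Hwτ)))) as [z Hz].
    exists z; split; trivial; apply Hy; exists w; split; trivial; now exists σ, p.
Qed.

Definition valuation (G τ : set) : set :=
  proj1_sig (constructive_indefinite_description _ (is_val_ex G τ)).

Lemma valuationE G τ y : is_val G τ y ↔ y = valuation G τ.
Proof.
assert (H : is_val G τ (valuation G τ)).
{ exact (proj2_sig (constructive_indefinite_description _ (is_val_ex G τ))). }
split; [intros H'; exact (is_val_fun H' H)|intros ->; exact H].
Qed.

Lemma mem_valuation G τ z : mem z (valuation G τ) ↔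
  ∃ σ p w, is_opair mem w σ p ∧ mem w τ ∧ mem p G ∧ z = valuation G σ.
Proof.
destruct (proj2 (valuationE G τ (valuation G τ)) eq_refl) as [H1 H2]; split.
- intros Hz; destruct (H1 z Hz) as (σ & p & w & Hw & Hwτ & Hp & Hσ).
  exists σ, p, w; repeat split; trivial; now apply valuationE.
- intros (σ & p & w & Hw & Hwτ & Hp & ->).
  destruct (H2 σ p w Hw Hwτ Hp) as (z & Hz & Hσ); apply valuationE in Hσ; now subst.
Qed.

Section TransitiveClass.

Variables (M : set → Prop) (hM : ∀ x y, M y → mem x y → M x).

Definition in_elt (x : set) (H : M x) : elt M := exist _ x H.

Lemma elt_eq (x y : elt M) : elt_set x = elt_set y → x = y.
Proof.
destruct x as [x p], y as [y q]; simpl; intros <-; f_equal; apply proof_irrelevance.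
Qed.

Lemma elt_mem (x : set) (y : elt M) : mem x (elt_set y) → ∃ x', x = elt_set x' ∧ emem x' y.
Proof. intros H; exists (in_elt (hM (proj2_sig y) H)); auto. Qed.

Lemma emem_wf : well_founded (@emem M).
Proof. apply (wf_inverse_image _ _ mem (@elt_set M)), set_wf. Qed.

Lemma upair_elt (z a b : elt M) :
  is_upair (@emem M) z a b ↔ is_upair mem (elt_set z) (elt_set a) (elt_set b).
Proof.
split; intros H w.
- split.
  + intros Hw; apply elt_mem in Hw; destruct Hw as (w' & -> & Hw).
    apply H in Hw; destruct Hw as [-> | ->]; auto.
  + intros [-> | ->]; apply H; auto.
- unfold emem; rewrite (H (elt_set w)).
  split; (intros [Hw|Hw]; [left|right]; [try (now apply elt_eq); congruence..]).
Qed.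

Lemma opair_elt (z a b : elt M) :
  is_opair (@emem M) z a b ↔ is_opair mem (elt_set z) (elt_set a) (elt_set b).
Proof.
split.
- intros (u & v & H1 & H2 & H3); exists (elt_set u), (elt_set v).
  now rewrite <- !upair_elt.
- intros (u & v & H1 & H2 & H3).
  destruct (@elt_mem u z) as (u' & -> & _); [apply H3; auto|].
  destruct (@elt_mem v z) as (v' & -> & _); [apply H3; auto|].
  exists u', v'; now rewrite !upair_elt.
Qed.

Lemma opair_parts (z : elt M) a b : is_opair mem (elt_set z) a b →
  ∃ a' b', a = elt_set a' ∧ b = elt_set b' ∧ is_opair (@emem M) z a' b'.
Proof.
intros H; pose proof H as (u & v & H1 & H2 & H3).
destruct (@elt_mem v z) as (v' & -> & _); [apply H3; auto|].
destruct (@elt_mem a v') as (a' & -> & _); [apply H2; auto|].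
destruct (@elt_mem b v') as (b' & -> & _); [apply H2; auto|].
exists a', b'; repeat split; now apply opair_elt.
Qed.

Lemma rel_elt (r a b : elt M) :
  rel (@emem M) r a b ↔ rel mem (elt_set r) (elt_set a) (elt_set b).
Proof.
split.
- intros (p & Hp & H); exists (elt_set p); now rewrite <- opair_elt.
- intros (p & Hp & H); apply elt_mem in H; destruct H as (p' & -> & H).
  exists p'; now rewrite opair_elt.
Qed.

End TransitiveClass.

Section Absoluteness.

Variables (M N : set → Prop).
Hypothesis hM : ∀ x y, M y → mem x y → M x.
Hypothesis hN : ∀ x y, N y → mem x y → N x.
Variables (ZM : Zermelo (@emem M)) (ZN : Zermelo (@emem N)).

Lemma num_absolute n : elt_set (num ZM n) = elt_set (num ZN n).
Proof.
induction (lt_wf n) as [n _ IH]; apply set_ext; intros z; split; intros Hz.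
- apply (elt_mem hM) in Hz; destruct Hz as (z' & -> & Hz); apply num_mem in Hz.
  destruct Hz as (m & Hm & ->); rewrite (IH m Hm); now apply (num_lt ZN).
- apply (elt_mem hN) in Hz; destruct Hz as (z' & -> & Hz); apply num_mem in Hz.
  destruct Hz as (m & Hm & ->); rewrite <- (IH m Hm); now apply (num_lt ZM).
Qed.

Lemma pr_absolute a b a' b' : elt_set a = elt_set a' → elt_set b = elt_set b' →
  elt_set (pr ZM a b) = elt_set (pr ZN a' b').
Proof.
intros Ha Hb; apply (@set_opair_fun _ _ (elt_set a) (elt_set b)).
- apply (opair_elt hM), pr_is.
- rewrite Ha, Hb; apply (opair_elt hN), pr_is.
Qed.

Lemma code_absolute (f : nat → Z) n :
  elt_set (pr ZM (num ZM n) (zc ZM (f n))) = elt_set (pr ZN (num ZN n) (zc ZN (f n))).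
Proof. apply pr_absolute; [|apply pr_absolute]; apply num_absolute. Qed.

(** Numerals and pairs are absolute between transitive classes, so a sequence of integers is the
    same set in both models. *)
Lemma codes_elt_eq x y f : codes ZM x f → codes ZN y f → elt_set x = elt_set y.
Proof.
intros Hx Hy; pose proof (code_absolute f) as H.
apply set_ext; intros z; split; intros Hz.
- apply (elt_mem hM) in Hz; destruct Hz as (z' & -> & Hz); apply Hx in Hz.
  destruct Hz as [n ->]; rewrite H; apply Hy; eauto.
- apply (elt_mem hN) in Hz; destruct Hz as (z' & -> & Hz); apply Hy in Hz.
  destruct Hz as [n ->]; rewrite <- H; apply Hx; eauto.
Qed.

Lemma codes_absolute x y f : elt_set x = elt_set y → codes ZM x f → codes ZN y f.
Proof.
intros Hxy Hx z; pose proof (code_absolute f) as H.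
unfold emem; rewrite <- Hxy; split.
- intros Hz; apply (elt_mem hM) in Hz; destruct Hz as (z' & Hz & Hz').
  apply Hx in Hz'; destruct Hz' as [n ->]; exists n; apply elt_eq; now rewrite <- H.
- intros [n ->]; rewrite <- H; apply Hx; eauto.
Qed.

End Absoluteness.

Section GenericExtension.

Variables (M : set → Prop) (hM : transitive_model_ZFC M) (P le : elt M).
Hypothesis hP : forcing_notion P le.
Variables (G : set) (hG : generic M (elt_set P) (elt_set le) G).
Local Notation N := (generic_extension M (elt_set P) G).

Let ZM : Zermelo (@emem M) := ZFC_zermelo (proj2 hM) (@emem_wf M).
Let V (τ : elt M) : set := valuation G (elt_set τ).
Let Gen (p : elt M) : Prop := mem (elt_set p) G.

Lemma generic_in p : mem p G → ∃ p', p = elt_set p' ∧ emem p' P ∧ Gen p'.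
Proof.
intros Hp; destruct hG as [[H _] _]; apply H in Hp as Hp'.
apply (elt_mem (proj1 hM)) in Hp'; destruct Hp' as (p' & -> & Hp'); eauto.
Qed.

Lemma leq_elt q p : leq (E := @emem M) P le q p ↔
  mem (elt_set q) (elt_set P) ∧ mem (elt_set p) (elt_set P) ∧
  rel mem (elt_set le) (elt_set q) (elt_set p).
Proof. unfold leq; now rewrite (rel_elt (proj1 hM)). Qed.

Lemma mem_V τ z : mem z (V τ) ↔ ∃ π q, el (E := @emem M) P τ π q ∧ Gen q ∧ z = V π.
Proof.
unfold V; rewrite mem_valuation; split.
- intros (σ & p & w & Hw & Hwτ & Hp & ->).
  apply (elt_mem (proj1 hM)) in Hwτ; destruct Hwτ as (w' & -> & Hwτ).
  destruct (opair_parts (proj1 hM) Hw) as (σ' & p' & -> & -> & Hw').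
  destruct (generic_in Hp) as (p'' & Hpp & Hp'' & _); apply elt_eq in Hpp; subst p''.
  exists σ', p'; repeat split; trivial; now exists w'.
- intros (π & q & [Hq (w & Hw & Hwτ)] & Hg & ->).
  exists (elt_set π), (elt_set q), (elt_set w); repeat split; trivial.
  now apply (opair_elt (proj1 hM)).
Qed.

Lemma name_elt τ : name (E := @emem M) P τ ↔ is_name (elt_set P) (elt_set τ).
Proof.
induction (dom_wf ZM τ) as [τ _ IH]; split; intros [H]; constructor; intros w Hw.
- apply (elt_mem (proj1 hM)) in Hw; destruct Hw as (w' & -> & Hw).
  destruct (H w' Hw) as (π & p & Hwp & Hπ & Hp); exists (elt_set π), (elt_set p).
  split; [now apply (opair_elt (proj1 hM))|split; trivial].
  apply IH; trivial; exists p, w'; auto.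
- destruct (H (elt_set w) Hw) as (σ & p & Hwp & Hσ & Hp).
  destruct (opair_parts (proj1 hM) Hwp) as (π & p' & -> & -> & Hw').
  exists π, p'; split; trivial; split; trivial.
  apply IH; trivial; exists p', w; auto.
Qed.

Lemma elt_name (x : elt N) : ∃ τ, name (E := @emem M) P τ ∧ elt_set x = V τ.
Proof.
destruct x as [x (τ & Hτ & Hn & Hv)]; exists (in_elt Hτ); split.
- now apply name_elt.
- exact (proj1 (valuationE G τ x) Hv).
Qed.

Lemma name_value τ : name (E := @emem M) P τ → ∃ x : elt N, elt_set x = V τ.
Proof.
intros Hτ; assert (H : N (V τ)); [|now exists (in_elt H)].
exists (elt_set τ); split; [exact (proj2_sig τ)|split; [now apply name_elt|]].
now apply valuationE.
Qed.

Lemma extension_transitive x y : N y → mem x y → N x.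
Proof.
intros Hy Hx; destruct (elt_name (in_elt Hy)) as (τ & Hτ & H); simpl in H.
rewrite H in Hx; apply mem_V in Hx; destruct Hx as (π & q & [_ Hπ] & _ & ->).
destruct (name_value (proj1 (name_el Hτ Hπ))) as [z Hz]; rewrite <- Hz.
exact (proj2_sig z).
Qed.

Lemma generic_conditions :
  (∀ p, Gen p → emem p P) ∧ (∃ p, Gen p) ∧
  (∀ p q, Gen p → leq (E := @emem M) P le p q → Gen q) ∧
  (∀ p q, Gen p → Gen q → ∃ r, Gen r ∧ leq (E := @emem M) P le r p ∧
                                   leq (E := @emem M) P le r q) ∧
  ∀ D, (∀ p, emem p D → emem p P) →
    (∀ p, emem p P → ∃ q, emem q D ∧ leq (E := @emem M) P le q p) →
    ∃ p, emem p D ∧ Gen p.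
Proof.
destruct hG as [(H1 & [p0 H2] & H3 & H4) H5].
assert (HGP : ∀ p, Gen p → emem p P) by (intros p Hp; now apply H1).
split; [exact HGP|split; [|split; [|split]]].
- destruct (generic_in H2) as (p & -> & _ & Hp); eauto.
- intros p q Hp Hpq; apply leq_elt in Hpq; now apply (H3 (elt_set p)).
- intros p q Hp Hq; destruct (H4 _ _ Hp Hq) as (r & Hr & Hrp & Hrq).
  destruct (generic_in Hr) as (r' & -> & _ & Hr'); exists r'; rewrite !leq_elt.
  repeat split; trivial; now apply HGP.
- intros D HD Hdense; destruct (H5 (elt_set D)) as (p & HpD & Hp).
  + exact (proj2_sig D).
  + split.
    * intros p Hp; apply (elt_mem (proj1 hM)) in Hp; destruct Hp as (p' & -> & Hp).
      now apply HD.
    * intros p Hp; apply (elt_mem (proj1 hM)) in Hp; destruct Hp as (p' & -> & Hp).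
      destruct (Hdense p' Hp) as (q & Hq & Hqp); apply leq_elt in Hqp.
      exists (elt_set q); split; trivial; apply Hqp.
  + destruct (generic_in Hp) as (p' & -> & _ & Hp'); eauto.
Qed.

Lemma generic_extension_zermelo :
  Zermelo (@emem N) ∧ orderable (@emem N).
Proof.
destruct generic_conditions as (H1 & H2 & H3 & H4 & H5).
pose proof (transitive_superset (proj2 hM) (@emem_wf M)) as HT.
split.
- exact (extension_zermelo ZM (proj2 hP) H1 H2 H3 H4 H5 HT mem_V (@elt_eq N)
    elt_name name_value).
- exact (extension_orderable ZM (proj2 hP) H1 H2 H3 H4 H5 HT mem_V (@elt_eq N)
    elt_name name_value (well_ordering (proj2 hM) (@emem_wf M))).
Qed.

End GenericExtension.

(** * The Baer-Specker group *)

Lemma divide_fact n i : n ≠ 0 → n ≤ i → ∃ m, fact i = n * m.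
Proof.
intros Hn; induction i as [|i IH]; intros Hi; [lia|].
destruct (Nat.eq_dec n (Datatypes.S i)) as [->|Hne]; [now exists (fact i)|].
destruct IH as [m Hm]; [lia|]; exists (Datatypes.S i * m).
change (fact (Datatypes.S i)) with (Datatypes.S i * fact i); rewrite Hm; lia.
Qed.

Section BaerSpecker.

Context {S : Type} {E : S → S → Prop} (ZF : Zermelo E).
Variables (B G : gstr S) (hB : is_baer_specker E B).
Variables (hG : is_subgroup E G B) (hGB : car G = car B).

Lemma codes_gadd x y f g : E x (car B) → E y (car B) → codes ZF x f → codes ZF y g →
  codes ZF (gadd ZF G x y) (λ i, f i + g i)%Z.
Proof.
destruct hB as (Hcar & _ & Hop), hG as (HG & _ & Hsub); rewrite <- hGB in *.
intros Hx Hy Hf Hg; pose proof (gadd_car ZF HG Hx Hy) as Hz.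
apply Hcar in Hz; destruct (sequence_codes ZF Hz) as [h Hh].
destruct Hz as (w & Zs & _ & HZ & _).
enough (H : ∀ n, h n = (f n + g n)%Z).
{ intros z; rewrite (Hh z); split; intros [n Hn]; exists n; [now rewrite <- H|now rewrite H]. }
intros n; apply (zc_inj (ZF := ZF)), (integers_add ZF HZ).
apply (Hop Zs HZ x y (gadd ZF G x y) (num ZF n)).
- now apply Hsub, (gopE ZF HG).
- now apply (codes_rel n _ Hf).
- now apply (codes_rel n _ Hg).
- now apply (codes_rel n _ Hh).
Qed.

Lemma codes_gmul x f n : n ≠ 0 → E x (car B) → codes ZF x f →
  codes ZF (gmul ZF G (Z.of_nat n) x) (λ i, Z.of_nat n * f i)%Z.
Proof.
intros Hn Hx Hf; pose proof (proj1 hG) as HG; pose proof Hx as Hx'; rewrite <- hGB in Hx'.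
induction n as [|n IH]; [easy|].
rewrite Nat2Z.inj_succ, <- Z.add_1_l, (gmul_plus ZF HG), (gmul_one ZF HG) by trivial.
destruct (Nat.eq_dec n 0) as [->|Hn0].
- change (gmul ZF G (Z.of_nat 0) x) with (gzero ZF G); rewrite (gadd0 ZF HG) by trivial.
  intros z; rewrite (Hf z); split; intros [i Hi]; exists i;
    replace ((1 + Z.of_nat 0) * f i)%Z with (f i) in * by lia; exact Hi.
- assert (Hnx : E (gmul ZF G (Z.of_nat n) x) (car B)) by (rewrite <- hGB; now apply gmul_car).
  intros z; rewrite (codes_gadd Hx Hnx Hf (IH Hn0) z).
  split; intros [i Hi]; exists i;
    replace ((1 + Z.of_nat n) * f i)%Z with (f i + Z.of_nat n * f i)%Z in * by lia; exact Hi.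
Qed.

End BaerSpecker.

Theorem proposition3p6 (M : set → Prop) (hM : transitive_model_ZFC M)
  (P le : elt M) (hP : forcing_notion P le)
  (G : set) (hG : generic M (elt_set P) (elt_set le) G)
  (hreals : adds_reals M (generic_extension M (elt_set P) G))
  (A : gstr (elt M)) (hA : is_baer_specker (@emem M) A)
  (B : gstr (elt (generic_extension M (elt_set P) G)))
  (hB : is_baer_specker (@emem (generic_extension M (elt_set P) G)) B) :
  ¬ ∃ A' δ F : elt (generic_extension M (elt_set P) G),
      elt_set A' = elt_set (car A) ∧
      is_filtration (@emem (generic_extension M (elt_set P) G))
        (cotorsionfree (@emem (generic_extension M (elt_set P) G)))
        A' B δ F.
Proof.
pose proof (extension_transitive hM hG) as hN.
destruct (generic_extension_zermelo hM hP hG) as [ZN Hord].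
pose proof (ZFC_zermelo (proj2 hM) (@emem_wf M)) as ZM.
set (N := generic_extension M (elt_set P) G) in *.
intros (A' & δ & F & HAA & Hfil).
assert (HA : ∀ x : elt N, emem x A' ↔ ∃ y, elt_set x = elt_set y ∧ is_integer_sequence (@emem M) y).
{ intros x; unfold emem; rewrite HAA; split.
  - intros Hx; apply (elt_mem (proj1 hM)) in Hx; destruct Hx as (y & -> & Hy).
    exists y; split; trivial; now apply hA.
  - intros (y & -> & Hy); now apply hA. }
(* The zero of the first stage is an integer sequence of [M]; by definition of such sequences it
   brings along the ω and the ℤ of [M] used below. *)
assert (HneA : ∃ a, emem a A').
{ destruct (empty_ex ZN) as [o Ho].
  destruct Hfil as (_ & _ & Hsub & _ & _ & H0 & _).
  destruct (Hsub o A' (H0 o Ho)) as (H & <- & HH & _); exists (gzero ZN H).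
  exact (gzero_car ZN HH). }
destruct HneA as [a0 Ha0]; apply HA in Ha0.
destruct Ha0 as (a1 & _ & WM & IM & HWM & HIM & _).
destruct hreals as (r & Hr & HrM); destruct (sequence_codes ZN Hr) as [f Hf].
destruct Hr as (W & I & HW & HI & _).
destruct (filtration_reduced ZN Hord HW (proj1 (proj2 hB)) Hfil) as (K & HK & HKB & Hred).
assert (HB : ∀ x g, codes ZN x g → emem x (car B)).
{ intros x g Hx; apply hB; exact (codes_sequence HW HI Hx). }
destruct (codes_fact HW HI Hf) as [x Hx].
assert (HxA : emem x A').
{ apply Hred; [exact (HB _ _ Hx)|intros n Hn].
  (* The quotient [y] is (i!/n) r i for i ≥ n, where the division is exact, and 0 below n. *)
  destruct (codes_div (g := λ i, (Z.of_nat (fact i) / Z.of_nat n * f i)%Z) HW HI Hx Hn)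
    as [y Hy].
  { intros i Hi; destruct (divide_fact Hn Hi) as [m ->]; rewrite Nat2Z.inj_mul.
    rewrite (Z.mul_comm (Z.of_nat n)), Z.div_mul by lia; lia. }
  (* The remainder consists of the first n terms of [x]. Being finitely supported it exists in [M],
     although the whole sequence might not. *)
  destruct (codes_finite ZM HWM HIM (λ i, (Z.of_nat (fact i) * f i)%Z) n) as [a1' Ha1].
  destruct (@elt_mem N hN (elt_set a1') A') as (a & Ha & HaA).
  { rewrite HAA; apply hA; exact (codes_sequence HWM HIM Ha1). }
  pose proof (codes_absolute (proj1 hM) hN ZN Ha Ha1) as Hac.
  exists y, a; split; [exact (HB _ _ Hy)|split; trivial].
  pose proof (codes_gmul hB HK HKB Hn (HB _ _ Hy) Hy) as Hny.
  apply (codes_inj Hx (codes_gadd hB HK HKB (HB _ _ Hny) (HB _ _ Hac) Hny Hac)).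
  intros i; cbv beta; destruct (Nat.ltb_spec i n) as [Hi|Hi]; [lia|].
  destruct (divide_fact Hn Hi) as [m ->]; rewrite Nat2Z.inj_mul.
  rewrite (Z.mul_comm (Z.of_nat n) (Z.of_nat m)), Z.div_mul by lia; lia. }
(* Now [x] is in [M]; dividing by i! there gives a sequence with the same entries as [r], hence [r]
   itself, contrary to its choice. *)
apply HrM; apply HA in HxA; destruct HxA as (y & Hxy & _).
pose proof (codes_absolute hN (proj1 hM) ZM Hxy Hx) as Hy.
destruct (codes_of_fact HWM HIM Hy) as [s Hs].
rewrite <- (codes_elt_eq (proj1 hM) hN Hs Hf); exact (proj2_sig s).
Qed.
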